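(* Let $g\ge0$, $r\ge 0$ and $\ell\ge 1$ be integers, let $G$ be a graph of Euler genus $g$, and let $H$ be an $r$-shallow minor of $G\boxtimes K_\ell$. Then for every integer $s\ge1$, $$\mathrm{scol}_s(H)\le \ell\big((4g+5)(2rs+2r+s)+2g+1\big)$$ and $$\mathrm{wcol}_s(H)\le \ell\Big(2g+\tbinom{(2r+1)s+2r+2}{2}\Big)\big((4r+2)s+4r+1\big).$$
   Context: Graphs are finite, simple, undirected. The Euler genus of a graph is the minimum Euler genus of a surface in which it embeds (orientable surface with $h$ handles has Euler genus $2h$, non-orientable with $c$ cross-caps has Euler genus $c$). $G\boxtimes K_\ell$ has vertex set $V(G)\times[\ell]$ with distinct $(a,i),(b,j)$ adjacent iff $a=b$ or $ab\in E(G)$. $H$ is an $r$-shallow minor of $G'$ if there are pairwise vertex-disjoint connected subgraphs $\mu(v)$ ($v\in V(H)$) of $G'$, each of radius at most $r$, such that for every $vw\in E(H)$ some edge of $G'$ joins $\mu(v)$ and $\mu(w)$. For a total order $\preceq$ of $V(G)$, vertex $v$, integer $s\ge1$: $R(G,\preceq,v,s)$ is the set of $w$ with a path $v=w_0,\dots,w_{s'}=w$, $0\le s'\le s$, $w\preceq v$, $v\prec w_i$ for $i\in[s'-1]$; $Q(G,\preceq,v,s)$ is defined the same but with $w\prec w_i$ for $i\in[s'-1]$. $\mathrm{scol}_s(G)$ (resp. $\mathrm{wcol}_s(G)$) is the minimum over total orders of $\max_v|R(G,\preceq,v,s)|$ (resp. $\max_v|Q(G,\preceq,v,s)|$). *)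

(* Defs.v *)
From mathcomp Require Import all_boot all_order.
From mathcomp Require Import fingraph perm.
Set Implicit Arguments. Unset Strict Implicit. Unset Printing Implicit Defensive.

(* Graphs: a finite simple graph is a symmetric irreflexive relation e on a finType. *)

Definition strong_prod (V : finType) (e : rel V) (l : nat) : rel (V * 'I_l) :=
  fun x y => (x != y) && ((x.1 == y.1) || e x.1 y.1).
Arguments strong_prod {V} e l.

Definition shallow_minor (r : nat) (W : finType) (h : rel W)
    (V' : finType) (e' : rel V') : Prop :=
  exists mu : W -> {set V'},
    [/\ (forall v w, v != w -> [disjoint mu v & mu w]),
        (forall v, exists2 c, c \in mu v &
           forall x, x \in mu v -> exists p : seq V',
             [/\ path e' c p, last c p = x, all (fun y => y \in mu v) p
               & size p <= r])
      & (forall v w, h v w -> exists x y, [/\ x \in mu v, y \in mu w & e' x y])].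

(* Euler genus, via combinatorial maps (flag / graph-encoded maps, as in
   Mohar--Thomassen): flags F with fixed-point-free involutions t0 t1 t2,
   t0 t2 = t2 t0 fixed-point-free.  Vertices = <t1,t2>-orbits,
   edges = <t0,t2>-orbits, faces = <t0,t1>-orbits, map components =
   <t0,t1,t2>-orbits.  A map on a (possibly disconnected) collection of
   closed surfaces has Euler genus  sum_i (2 - v_i + e_i - f_i)
   = 2c - V + E - F.                                                     *)

Definition rel2 (F : finType) (a b : F -> F) : rel F :=
  fun x y => (y == a x) || (y == b x).
Definition rel3 (F : finType) (a b c : F -> F) : rel F :=
  fun x y => [|| y == a x, y == b x | y == c x].

(* number of classes of connect r (r is symmetric in all uses below) *)
Definition norbits (F : finType) (r : rel F) : nat := #|[set root r x | x : F]|.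

Definition flag_map (F : finType) (t0 t1 t2 : F -> F) : Prop :=
  [/\ involutive t0, involutive t1, involutive t2,
      (forall x, [&& t0 x != x, t1 x != x & t2 x != x])
    & (forall x, t0 (t2 x) = t2 (t0 x) /\ t0 (t2 x) != x)].

(* phi labels each flag by its vertex of G; the map's underlying graph is
   exactly G minus its isolated vertices (no loops, no parallel edges). *)
Definition map_of_graph (V : finType) (e : rel V) (F : finType)
    (t0 t1 t2 : F -> F) (phi : F -> V) : Prop :=
  [/\ flag_map t0 t1 t2,
      (forall x y, (phi x == phi y) = connect (rel2 t1 t2) x y),
      (forall x, e (phi x) (phi (t0 x))),
      (forall u v, e u v -> exists x, phi x = u /\ phi (t0 x) = v)
    & (forall x y, phi x = phi y -> phi (t0 x) = phi (t0 y) ->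
                   connect (rel2 t0 t2) x y)].

(* G has an embedding (in a surface) whose Euler genus is k; isolated
   vertices contribute 0. *)
Definition embeds_with_eg (V : finType) (e : rel V) (k : nat) : Prop :=
  exists (F : finType) (t0 t1 t2 : F -> F) (phi : F -> V),
    map_of_graph e t0 t1 t2 phi /\
    k + norbits (rel2 t1 t2) + norbits (rel2 t0 t1)
      = 2 * norbits (rel3 t0 t1 t2) + norbits (rel2 t0 t2).

Definition euler_genus_is (V : finType) (e : rel V) (g : nat) : Prop :=
  embeds_with_eg e g /\ forall k, embeds_with_eg e k -> g <= k.

(* Generalised colouring numbers.  A total order on W is given by a
   permutation sigma: u <= v iff rank(sigma u) <= rank(sigma v); every
   total order of W arises this way.                                    *)
Definition key (W : finType) (sigma : {perm W}) (x : W) : nat :=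
  enum_rank (sigma x).

Definition Rset (W : finType) (h : rel W) (sigma : {perm W}) (v : W) (s : nat)
    : {set W} :=
  [set w | (key sigma w <= key sigma v) &&
     [exists n : 'I_s.+1, exists p : n.-tuple W,
        [&& path h v p, last v p == w &
            all (fun x => key sigma v < key sigma x) (take (size p).-1 p)]]].

Definition Qset (W : finType) (h : rel W) (sigma : {perm W}) (v : W) (s : nat)
    : {set W} :=
  [set w | (key sigma w <= key sigma v) &&
     [exists n : 'I_s.+1, exists p : n.-tuple W,
        [&& path h v p, last v p == w &
            all (fun x => key sigma w < key sigma x) (take (size p).-1 p)]]].

(* min over total orders of max over v; the neutral element #|W| of minn
   is harmless as every value is <= #|W| and {perm W} is nonempty. *)
Definition scol (W : finType) (h : rel W) (s : nat) : nat :=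
  \big[minn/#|W|]_(sigma : {perm W}) \max_(v : W) #|Rset h sigma v s|.
Definition wcol (W : finType) (h : rel W) (s : nat) : nat :=
  \big[minn/#|W|]_(sigma : {perm W}) \max_(v : W) #|Qset h sigma v s|.

(* Main.v *)
Require Import Defs.
From mathcomp Require Import all_boot all_order.
From mathcomp Require Import fingraph perm zify.
Set Implicit Arguments. Unset Strict Implicit. Unset Printing Implicit Defensive.

(* By a tree-cotree argument at most g edges have fundamental cycles, with
   respect to a fixed breadth-first tree of G, that generate the F_2-homology
   of the surface modulo boundaries of faces.  Let S be the union of the at
   most 2g vertical tree paths to the ends of these edges.  Every closed walk
   of G - S bounds, which gives a Jordan-type property: the edges leaving a
   connected set with connected complement are cyclically ordered, and a
   closed walk crossing this bond in exactly two edges separates it.  A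
   geodesic meets a ball of radius s in at most 2s+1 vertices, so putting S
   first costs at most 2g(2s+1).

   G - S is decomposed recursively into geodesics, as in planar graphs: a
   remaining region is attached to at most two geodesics A and B, and a geodesic
   through the region joining the first and the last exits at A leaves regions
   that are again attached to two geodesics.  The two parents of a geodesic are
   themselves parent and child, so within distance s at most C(s+2,2) ancestors
   are weakly reachable, with 2s+1 vertices each.  For strong
   reachability, a geodesic that some ball meets in 2s+1 vertices is first
   rerouted through the region, after which it is met in at most 2s vertices.

   For a shallow minor, the branch sets are ordered by their least vertices:
   reachability within s steps in H then projects to reachability within
   (2r+1)s+2r steps in G, and each vertex of G lies in at most l branch sets. *)

(** Topology enters the ordering arguments only through [arc_separation], a statement about a graph
    alone. It is derived over F_2 on flags, with cocycles instead of cycles: no chain complex is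
    needed, and one parity argument serves for the cotree, in the dual map for the tree, and for the
    cyclic order around a bond.

    The obstacle for strong reachability is the additive constant. Two parent geodesics met in
    [2s+1] vertices each, and [s+1] vertices on the current geodesic, would give [5s+3]; the bound
    needs [5s+1], so both parents must lose one vertex. The property that yields this ([tight]) is
    not known for a newly chosen geodesic. Hence the induction maintains it for only one of the two
    parents and restores it for the other by rerouting; the shortest alternate route is taken
    because the part that it bypasses is then tight.

    For weak reachability [2s+1] vertices per geodesic are affordable. There the parents remain
    whole geodesics, and only their connectivity matters, not the order of the exits along them. *)

Definition restr (V : finType) (e : rel V) (A : {set V}) : rel V :=
  fun x y => [&& x \in A, y \in A & e x y].

Definition connected (V : finType) (e : rel V) (C : {set V}) :=
  forall x y, x \in C -> y \in C -> connect (restr e C) x y.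

Definition exits (V : finType) (e : rel V) (C : {set V}) (u c : V) :=
  [&& u \notin C, c \in C & e u c].

(* pos enumerates the edges leaving C in their cyclic order around C; the
   conclusion is the Jordan curve theorem for closed walks crossing this bond twice. *)
Definition arc_separation (V : finType) (e : rel V) :=
  forall (C : {set V}) u0 c0, connected e C -> exits e C u0 c0 ->
    (forall u c, exits e C u c -> connect (restr e (~: C)) u0 u) ->
  exists pos : V -> V -> nat,
  [/\ pos u0 c0 = 0,
      forall u c u' c', exits e C u c -> exits e C u' c' -> pos u c = pos u' c' ->
        u = u' /\ c = c'
    & forall u1 c1 u2 c2 pc pu, exits e C u1 c1 -> exits e C u2 c2 ->
        path e c1 pc -> last c1 pc = c2 -> {subset pc <= C} ->
        path e u2 pu -> last u2 pu = u1 -> {subset pu <= ~: C} ->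
        let D := [set v in u1 :: c1 :: pc ++ u2 :: pu] in
        let side u c := (pos u1 c1 < pos u c) (+) (pos u2 c2 < pos u c) in
        forall u3 c3 u4 c4 x y, exits e C u3 c3 -> exits e C u4 c4 ->
          side u3 c3 != side u4 c4 -> x \in [:: u3; c3] -> y \in [:: u4; c4] ->
          x \notin D -> y \notin D -> ~~ connect (restr e (~: D)) x y].

(** * Walks and components inside a vertex set *)

Section Restr.
Variables (V : finType) (e : rel V).
Hypothesis eS : symmetric e.

Lemma restr_sym A : symmetric (restr e A).
Proof. by move=> x y; rewrite /restr eS andbCA. Qed.

Lemma restr_csym A : connect_sym (restr e A).
Proof. exact/sym_connect_sym/restr_sym. Qed.

Lemma connect_restrS (A B : {set V}) x y :
  {subset A <= B} -> connect (restr e A) x y -> connect (restr e B) x y.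
Proof.
move=> AB; apply: connect_sub => u v /and3P[uA vA uv].
by apply: connect1; rewrite /restr !AB.
Qed.

Lemma path_restr (A : {set V}) x p :
  path (restr e A) x p -> path e x p /\ {subset p <= A}.
Proof.
elim: p x => //= z p IHp y /andP[/and3P[_ zA eyz] /IHp[pp pA]].
by rewrite eyz pp; split=> // w; rewrite inE => /predU1P[->//|/pA].
Qed.

Lemma restr_path (A : {set V}) x p :
  path e x p -> {subset x :: p <= A} -> path (restr e A) x p.
Proof.
elim: p x => //= z p IHp x /andP[xz pp] sub.
rewrite /restr xz !sub ?inE ?eqxx ?orbT //=; apply: IHp => // w wp.
by apply: sub; rewrite inE wp orbT.
Qed.

Lemma connect_restrP (A : {set V}) x y : x \in A -> reflect
  (exists p, [/\ path e x p, last x p = y & {subset p <= A}]) (connect (restr e A) x y).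
Proof.
move=> xA; apply: (iffP connectP) => [[p /path_restr[pp pA] ->]|[p [pp <- pA]]].
  by exists p.
exists p => //; apply: restr_path => // z; rewrite inE => /predU1P[->//|]; exact: pA.
Qed.

Lemma connect_restr1 (A : {set V}) x y : x \in A -> y \in A -> e x y -> connect (restr e A) x y.
Proof. by move=> xA yA xy; apply: connect1; rewrite /restr xA yA. Qed.

Lemma sorted_connected A : sorted e A -> connected e [set z in A].
Proof.
case: A => [|a A] /= pA x y; first by rewrite inE.
have key z : z \in a :: A -> connect (restr e [set z in a :: A]) a z.
  move=> zA; have /path_connect : path (restr e [set z in a :: A]) a A.
    by apply: restr_path => // w wA; rewrite inE.
  by apply.
rewrite inE => xA; rewrite inE => yA; apply: connect_trans (key _ yA).
by rewrite restr_csym; apply: key.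
Qed.

Lemma rev_walk x q y : path e x (rcons q y) -> path e y (rcons (rev q) x).
Proof.
move=> pq; have := rev_path e x (rcons q y).
rewrite last_rcons belast_rcons rev_cons => ->.
by rewrite (@eq_path _ _ e) // => a b; rewrite eS.
Qed.

Definition component (D C : {set V}) :=
  [/\ C != set0, C \subset D, connected e C
    & forall c y, c \in C -> y \in D -> e c y -> y \in C].

Lemma component_exists (D : {set V}) x : x \in D ->
  exists2 C, component D C & x \in C.
Proof.
move=> xD; pose C := [set y in D | connect (restr e D) x y].
have xC : x \in C by rewrite inE xD connect0.
exists C => //; split=> [|||c y].
- by apply/set0Pn; exists x.
- by apply/subsetP => y; rewrite inE => /andP[].
- have key y : y \in C -> connect (restr e C) x y.
    rewrite inE => /andP[_ /connectP[p pp el]].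
    have : {subset x :: p <= C}.
      move=> z zp; have zx := path_connect pp zp; rewrite inE zx andbT.
      by move: zp; rewrite inE => /predU1P[->//|]; case/path_restr: pp => _; apply.
    case/path_restr: pp => pe _ pC; apply/connectP; exists p => //.
    exact: restr_path.
  move=> y z yC zC; apply: connect_trans (key _ zC).
  by rewrite restr_csym; apply: key.
rewrite !inE => /andP[cD xc] yD cy; rewrite yD; apply: connect_trans xc _.
exact: connect_restr1.
Qed.
End Restr.

(** * Bounded reachability through a set *)

Section Reach.
Variables (V : finType) (e : rel V).

(** The ends [x] and [y] are free, only the interior of the walk must lie in [Z]. Both colouring
    numbers take this form, with [Z] the vertices above the start or above the target. *)
Fixpoint reach (Z : {set V}) k x y :=
  (x == y) || (if k is k'.+1 then e x y || [exists z in Z, e x z && reach Z k' z y] else false).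

Lemma reachP (Z : {set V}) k x y : reflect
  (x = y \/ exists q, [/\ path e x (rcons q y), {subset q <= Z} & size q < k]) (reach Z k x y).
Proof.
elim: k x => [|k IHk] x /=; case: eqP => [->|nxy] /=; try by constructor; left.
  by constructor; case=> // -[q []].
apply: (iffP orP) => [[exy|/existsP[z /andP[zZ /andP[exz /IHk h]]]]|[//|[[|z q] []]]] /=.
- by right; exists [::]; rewrite /= exy.
- right; case: h => [<-|[q [pq qZ sq]]]; first by exists [::]; rewrite /= exz.
  by exists (z :: q); rewrite /= exz pq; split=> // w; rewrite inE => /predU1P[->//|/qZ].
- by rewrite andbT; left.
case/andP=> xz pq sub sq; right; apply/existsP; exists z; rewrite sub ?inE ?eqxx // xz /=.
by apply/IHk; right; exists q; split=> // w wq; apply: sub; rewrite inE wq orbT.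
Qed.

Definition reached (Z : {set V}) s v := [set w | (w \notin Z) && reach Z s v w].
End Reach.

(** * Homology of embedded graphs *)

Lemma even_card_involution (T : finType) (f : T -> T) (A : {set T}) :
  (forall x, x \in A -> [/\ f x \in A, f (f x) = x & f x != x]) -> ~~ odd #|A|.
Proof.
have [n] := ubnP #|A|; elim: n A => // n IHn A ltAn fA.
have [->|[x xA]] := set_0Vmem A; first by rewrite cards0.
have [fxA ffx fxx] := fA _ xA.
have fx1 : f x \in A :\ x by rewrite !inE fxx.
have cardA : #|A| = (#|A :\ x :\ f x|).+2.
  by rewrite (cardsD1 x A) xA (cardsD1 (f x)) fx1.
rewrite cardA /= negbK; apply: IHn => [|y]; first by rewrite cardA in ltAn; lia.
rewrite !inE => /and3P[yfx yx yA]; have [fyA ffy fyy] := fA _ yA.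
split=> //; rewrite fyA andbT; apply/andP; split.
  by apply: contra yx => /eqP eqf; rewrite -ffy eqf ffx.
by apply: contra yfx => /eqP eqf; rewrite -ffy eqf.
Qed.

Section Parity.
Variables (F : finType) (a b t : F -> F) (psi : F -> bool) (K : {set F}).
Hypothesis (aK : involutive a) (bK : involutive b) (tK : involutive t).
Hypothesis (aN : forall x, a x != x) (tN : forall x, t x != x).
Hypothesis (abC : forall x, a (b x) = b (a x)).
Hypothesis (abN : forall x, a (b x) != x) (bN : forall x, b x != x).
Hypothesis (psit : forall x, psi (t x) = psi x).
Let alpha x := psi x (+) psi (a x).
Hypothesis (alphab : forall x, alpha (b x) = alpha x).
Hypothesis (Kt : forall x, x \in K -> t x \in K).
Hypothesis (Ka : forall x, x \in K -> a x \in K).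
Variable (y : F).
Hypothesis (Kb : forall x, x \in K -> alpha x -> x != y -> x != a y -> b x \in K).

(* The coboundary alpha of psi vanishes in total on the boundary of K. Halving the count of
   alpha avoids choosing one flag per edge side: N counts the flags of K from which alpha
   leaves psi, once per edge side. *)
Lemma cocycle_cut_edge : y \in K -> b y \notin K -> alpha y = false.
Proof.
move=> yK byK; apply/negP => ay.
pose A1 := [set x in K | psi x].
pose A2 := [set x in K | psi x && psi (a x)].
pose N := [set x in K | psi x && ~~ psi (a x)].
have e1 : ~~ odd #|A1|.
  apply: (@even_card_involution _ t) => x; rewrite !inE => /andP[xK px].
  by rewrite Kt // psit px tK tN.
have e2 : ~~ odd #|A2|.
  apply: (@even_card_involution _ a) => x; rewrite !inE => /and3P[xK px pax].
  by rewrite Ka // aK px pax aN.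
have cA1 : #|A1| = #|A2| + #|N|.
  rewrite -(cardsID [set x | psi (a x)] A1); congr (_ + _); apply: eq_card => x.
    by rewrite !inE andbA.
  by rewrite !inE andbC -andbA.
have e3 : ~~ odd #|N| by move: e1; rewrite cA1 oddD (negbTE e2).
pose y' := if psi y then y else a y.
have y'N : y' \in N.
  rewrite !inE /y'; case: (boolP (psi y)) => py.
    by rewrite yK py; move: ay; rewrite /alpha py.
  by rewrite Ka // aK py; move: ay; rewrite /alpha (negbTE py) /= => ->.
pose f x := if psi (b x) then b x else a (b x).
suff: ~~ odd #|N :\ y'| by move: e3; rewrite (cardsD1 y') y'N /= negbK => ->.
apply: (@even_card_involution _ f) => x; rewrite !inE => /and4P[xy' xK px pax].
have ax : alpha x by rewrite /alpha px.
have abx : alpha (b x) by rewrite alphab.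
have xy : x != y.
  by apply: contra xy' => /eqP exy; rewrite /y' -exy px.
have xay : x != a y.
  apply: contra xy' => /eqP exy; rewrite /y' exy.
  by move: pax; rewrite exy aK => /negbTE->.
have bxK := Kb xK ax xy xay.
have fbx : (f x == b x) || (f x == a (b x)) by rewrite /f; case: ifP; rewrite eqxx ?orbT.
have fy' : f x != y'.
  apply/negP=> /eqP fxy'.
  have : b x == y \/ b x == a y.
    case/orP: fbx => /eqP efx; move: fxy'; rewrite efx /y'; case: ifP => _ e'.
    - by left; rewrite e'.
    - by right; rewrite e'.
    - by right; rewrite -e' aK.
    - by left; rewrite -(aK (b x)) e' aK.
  case=> /eqP ebx; first by rewrite -ebx bK xK in byK.
  by move: byK; rewrite -(aK y) -ebx -abC Ka // bK.
rewrite fy' /=; move: abx; rewrite /f /alpha; case: (boolP (psi (b x))) => pb /=.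
  by move=> pab; rewrite bxK pb pab bK px bN.
move=> pab; rewrite Ka // pab aK pb; split=> //.
  by rewrite -abC bK (negbTE pax) aK.
Qed.
End Parity.

Lemma norbits_leq (F : finType) (r r' : rel F) :
  connect_sym r -> connect_sym r' ->
  (forall u v, r' u v -> connect r u v) -> norbits r <= norbits r'.
Proof.
move=> rS rS' sub; rewrite /norbits.
suff -> : [set root r x | x : F] = [set root r x | x in [set root r' x | x : F]].
  exact: leq_imset_card.
apply/setP=> z; apply/imsetP/imsetP => [[x _ ->]|[x _ ->]]; last by exists x.
exists (root r' x); first exact: imset_f.
apply/(rootP rS).
exact: connect_sub sub _ _ (connect_root r' x).
Qed.

Lemma norbits_add_link (F : finType) (r r' : rel F) (x z : F) :
  connect_sym r -> connect_sym r' ->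
  (forall u v, r' u v -> [\/ connect r u v, connect r u x /\ connect r v z
                          | connect r u z /\ connect r v x]) ->
  norbits r <= (norbits r').+1.
Proof.
move=> rS rS' r'r; rewrite /norbits.
set A := [set _ | _ in _]; set A' := [set _ | _ in _].
(* [k] redirects the class of [z] to that of [x], which makes it constant on [r']-classes. So the
   roots of [r] other than that of [z] have distinct [r']-roots. *)
pose k u := if connect r u z then root r x else root r u.
have kE u v : connect r' u v -> k u = k v.
  case/connectP=> p; elim: p u => [|w p IHp] u /=; first by move=> _ ->.
  case/andP=> ruw pw elast; rewrite -(IHp w) // /k.
  case: (r'r _ _ ruw) => [cuw|[cux cwz]|[cuz cwx]].
  - by rewrite (same_connect rS cuw); case: ifP => // _; apply/rootP.
  - by rewrite cwz; case: ifP => // _; apply/rootP.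
  - by rewrite cuz; case: ifP => // _; apply/rootP => //; rewrite rS.
rewrite (cardsD1 (root r z)) -add1n; apply: leq_add; first by case: (_ \in _).
rewrite -(@card_in_imset _ _ (root r')) => [|u v].
  by apply/subset_leq_card/subsetP => _ /imsetP[u _ ->]; apply: imset_f.
rewrite !inE => /andP[uz /imsetP[u0 _ eu]] /andP[vz /imsetP[v0 _ ev]].
move/(rootP rS')/kE; rewrite /k.
have ku w w0 : w = root r w0 -> w != root r z -> connect r w z = false.
  move=> -> wz; apply/negP => /(rootP rS); rewrite root_root // => ew.
  by rewrite ew eqxx in wz.
rewrite (ku _ _ eu uz) (ku _ _ ev vz).
by rewrite eu ev !root_root.
Qed.

(** * Spanning forests of the dual graph *)

Section Cotree.
Variables (F : finType) (t0 t1 t2 : F -> F).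
Hypothesis (fm : flag_map t0 t1 t2).
Let t0K : involutive t0. Proof. by case: fm. Qed.
Let t1K : involutive t1. Proof. by case: fm. Qed.
Let t2K : involutive t2. Proof. by case: fm. Qed.
Let t0N x : t0 x != x. Proof. by case: fm => _ _ _ /(_ x)/and3P[]. Qed.
Let t1N x : t1 x != x. Proof. by case: fm => _ _ _ /(_ x)/and3P[]. Qed.
Let t2N x : t2 x != x. Proof. by case: fm => _ _ _ /(_ x)/and3P[]. Qed.
Let t02C x : t0 (t2 x) = t2 (t0 x). Proof. by case: fm => _ _ _ _ /(_ x)[]. Qed.
Let t02N x : t0 (t2 x) != x. Proof. by case: fm => _ _ _ _ /(_ x)[]. Qed.

(** The classes are the components of the dual graph with edge set [Y]: [t0] and [t1] move inside a
    face, [t2] crosses an edge. *)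
Definition face_rel (Y : {set F}) : rel F :=
  fun x y => [|| y == t0 x, y == t1 x | (x \in Y) && (y == t2 x)].

Definition edge_closed (Y : {set F}) := forall x, x \in Y -> t0 x \in Y /\ t2 x \in Y.

Lemma face_rel_sym Y : edge_closed Y -> symmetric (face_rel Y).
Proof.
move=> Yc x y; rewrite /face_rel.
have e f : involutive f -> (y == f x) = (x == f y).
  by move=> fK; rewrite -(inv_eq fK) eq_sym.
rewrite (e _ t0K) (e _ t1K) (e _ t2K).
congr [|| _, _ | _].
case: (x =P t2 y) => [->|]; rewrite ?andbF // !andbT.
by apply/idP/idP => /Yc[_]; rewrite ?t2K.
Qed.

Lemma face_csym Y : edge_closed Y -> connect_sym (face_rel Y).
Proof. by move=> Yc; apply/sym_connect_sym/face_rel_sym. Qed.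

Definition edge_flags (y : F) : {set F} := [set y; t0 y; t2 y; t0 (t2 y)].

Lemma card_edge_flags y : #|edge_flags y| = 4.
Proof.
have h1 : t0 y != t0 (t2 y) by rewrite (inj_eq (inv_inj t0K)) eq_sym.
have h2 : t0 y != t2 y by rewrite (inv_eq t0K) eq_sym.
have -> : #|edge_flags y| = #|[:: y; t0 y; t2 y; t0 (t2 y)]|.
  by apply: eq_card => x; rewrite !inE -!orbA.
apply/card_uniqP; rewrite /= !inE !negb_or h1 h2 ![y == _]eq_sym t0N t2N t02N.
by rewrite eq_sym t0N.
Qed.

Lemma edge_flags_closed y : edge_closed (edge_flags y).
Proof.
move=> x; rewrite !inE -!orbA => /or4P[] /eqP->;
  by rewrite -?t02C ?t0K ?t2K -?t02C ?t0K ?t2K !eqxx ?orbT.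
Qed.

Lemma edge_closedD Y y : edge_closed Y -> edge_closed (Y :\: edge_flags y).
Proof.
move=> Yc x; rewrite !in_setD => /andP[xy xY]; have [-> ->] := Yc _ xY; rewrite !andbT.
split; apply: contra xy => /(@edge_flags_closed y) []; first by rewrite t0K.
by rewrite t2K.
Qed.

Lemma edge_flagsE (T : Type) (al : F -> T) y x :
  (forall w, al (t0 w) = al w) -> (forall w, al (t2 w) = al w) ->
  x \in edge_flags y -> al x = al y.
Proof.
by move=> a0 a2; rewrite !inE -!orbA => /or4P[] /eqP->; rewrite ?a0 ?a2.
Qed.

(** For a [t1]-invariant [psi] this is an edge function of which [psi] is a potential along the
    boundary of every face. If it is also [t2]-invariant, it is a 1-cocycle over F_2: its sum around
    each face is zero. *)
Definition cobd (psi : F -> bool) x := psi x (+) psi (t0 x).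

Lemma cobd0 psi x : cobd psi (t0 x) = cobd psi x.
Proof. by rewrite /cobd t0K addbC. Qed.

(* Kruskal's algorithm in the dual graph: X collects the edges of Y closing a dual cycle. *)
Lemma cotree_complement (Y : {set F}) : edge_closed Y ->
  exists X : seq F,
    4 * size X + 4 * norbits (rel2 t0 t1) <= #|Y| + 4 * norbits (face_rel Y) /\
    (forall psi : F -> bool, (forall x, psi (t1 x) = psi x) ->
      (forall x, cobd psi (t2 x) = cobd psi x) ->
      (forall x, cobd psi x -> x \in Y) ->
      (forall x, x \in X -> cobd psi x = false) ->
      forall x, cobd psi x = false).
Proof.
have [n] := ubnP #|Y|; elim: n Y => // n IHn Y ltYn Yc.
have [Y0|[y yY]] := set_0Vmem Y.
  exists [::]; split=> [|psi _ _ h _ x].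
    rewrite Y0 cards0 add0n leq_mul2l /=; apply: norbits_leq => [||u v].
    - apply/sym_connect_sym => x y; rewrite /rel2.
      by congr (_ || _); rewrite eq_sym -(inv_eq t0K, inv_eq t1K) // (inv_eq t1K).
    - by apply: face_csym; rewrite -Y0.
    - by rewrite /face_rel inE /= orbF => ruv; apply: connect1.
  by apply/negP => /h; rewrite Y0 inE.
pose Y' := Y :\: edge_flags y.
have sub : edge_flags y \subset Y.
  apply/subsetP => x; rewrite !inE -!orbA => /or4P[] /eqP->; rewrite ?(Yc _ yY).1 ?(Yc _ yY).2 //.
  by case: (Yc _ (Yc _ yY).2).
have cY : #|Y| = #|Y'| + 4.
  by rewrite -(cardsID (edge_flags y) Y) addnC (setIidPr sub) card_edge_flags.
have Y'c := edge_closedD Yc (y := y).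
have ltY' : #|Y'| < n by rewrite cY in ltYn; lia.
have [X [szX XP]] := IHn _ ltY' Y'c.
have csY := face_csym Yc; have csY' : connect_sym (face_rel Y') := face_csym Y'c.
have link u v : face_rel Y u v -> [\/ connect (face_rel Y') u v,
    connect (face_rel Y') u y /\ connect (face_rel Y') v (t2 y)
   | connect (face_rel Y') u (t2 y) /\ connect (face_rel Y') v y].
  have c0 w : connect (face_rel Y') (t0 w) w.
    by apply: connect1; rewrite /face_rel t0K eqxx.
  case/or3P=> [/eqP->|/eqP->|/andP[uY /eqP->]].
  - by constructor 1; rewrite csY'.
  - by constructor 1; apply: connect1; rewrite /face_rel eqxx orbT.
  case: (boolP (u \in edge_flags y)) => [|uy].
    rewrite !inE -!orbA => /or4P[] /eqP->.
    - by constructor 2.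
    - by rewrite -t02C; constructor 2.
    - by rewrite t2K; constructor 3.
    - by rewrite -t02C t2K; constructor 3.
  by constructor 1; apply: connect1; rewrite /face_rel in_setD uy uY eqxx !orbT.
have le1 := norbits_add_link csY' csY link.
case: (boolP (connect (face_rel Y') y (t2 y))) => cyy.
  (* The edge of [y] closes a dual cycle. Its removal does not increase the number of classes, so
     its four flags pay for the new member of [X]. *)
  exists (y :: X); split=> /=.
    have : norbits (face_rel Y') <= norbits (face_rel Y).
      apply: norbits_leq => // u v /link[//|[c1 c2]|[c1 c2]].
        by apply: connect_trans c1 _; apply: connect_trans cyy _; rewrite csY'.
      by apply: connect_trans c1 _; rewrite csY'; apply: connect_trans c2 _.
    lia.
  move=> psi p1 p2 pY pX; apply: XP => // [x px|x xX]; last by apply: pX; rewrite inE xX orbT.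
  rewrite inE pY // andbT; apply/negP=> /edge_flagsE -/(_ _ (cobd psi) (cobd0 psi) p2) e.
  by move: px; rewrite e pX // inE eqxx.
(* Here the edge of [y] is a bridge of the dual graph. [K] is one side of it, and no other edge in
   the support of the cocycle leaves [K], so the cocycle vanishes on [y] too. *)
exists X; split=> [|psi p1 p2 pY pX]; first lia.
apply: XP => // x px; rewrite inE pY // andbT; apply/negP => xy.
move: px; rewrite (edge_flagsE (cobd0 psi) p2 xy).
pose K := [set u | connect (face_rel Y') y u].
have Kcl u v : u \in K -> face_rel Y' u v -> v \in K.
  by rewrite !inE => cu /connect1; apply: connect_trans.
rewrite /cobd (@cocycle_cut_edge _ t0 t2 t1 psi K) //.
- by move=> u uK; apply: (Kcl _ _ uK); rewrite /face_rel eqxx orbT.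
- by move=> u uK; apply: (Kcl _ _ uK); rewrite /face_rel eqxx.
- move=> u uK au uy uty.
  have uY := pY _ au.
  case: (boolP (u \in edge_flags y)) => [|uny].
    rewrite !inE (negbTE uy) (negbTE uty) /= => /orP[] /eqP eu.
      by move: uK; rewrite inE eu (negbTE cyy).
    have : t0 u \in K by apply: (Kcl _ _ uK); rewrite /face_rel eqxx.
    by rewrite inE eu t0K (negbTE cyy).
  by apply: (Kcl _ _ uK); rewrite /face_rel in_setD uny uY eqxx !orbT.
- by rewrite inE connect0.
- by rewrite inE.
Qed.
End Cotree.

(** The vertices of level 0 are the roots, at most one per component and fixed by [par]. The first
    clause lets levels bound distances from below, so vertical paths are geodesics. *)
Definition bfs_forest (V : finType) (e : rel V) (lev : V -> nat) (par : V -> V) :=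
  [/\ forall x y, e x y -> lev y <= (lev x).+1,
      forall x, 0 < lev x -> e x (par x) /\ lev x = (lev (par x)).+1,
      forall x, lev x = 0 -> par x = x
    & forall x y, connect e x y -> lev x = 0 -> lev y = 0 -> x = y].

(** Levels are distances from [root e x], the canonical representative of the component of [x]. *)
Lemma bfs_forest_exists (V : finType) (e : rel V) :
  symmetric e -> exists lev par, bfs_forest e lev par.
Proof.
move=> eS; have cS := sym_connect_sym eS.
pose P x n := [exists p : n.-tuple V, path e (root e x) p && (last (root e x) p == x)].
have Pp x p : path e (root e x) p -> last (root e x) p = x -> P x (size p).
  by move=> pp pl; apply/existsP; exists (in_tuple p); rewrite pp pl eqxx.
have exP x : exists n, P x n.
  have /connectP[p pp pl] : connect e (root e x) x by rewrite cS connect_root.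
  by exists (size p); apply: Pp.
pose lev x := ex_minn (exP x).
have levP x : P x (lev x) by rewrite /lev; case: ex_minnP.
have lev_min x n : P x n -> lev x <= n by rewrite /lev; case: ex_minnP => m _; apply.
have step x y : e x y -> lev y <= (lev x).+1.
  move=> exy; have /existsP[p /andP[pp /eqP pl]] := levP x.
  have rxy : root e x = root e y by apply/rootP => //; apply: connect1.
  have := @Pp y (rcons p y); rewrite -rxy rcons_path last_rcons pp pl exy size_rcons size_tuple.
  by move=> h; apply/lev_min/h.
pose par x := odflt x [pick y | e x y && (lev x == (lev y).+1)].
have parP x : 0 < lev x -> e x (par x) /\ lev x = (lev (par x)).+1.
  move=> lx; rewrite /par; case: pickP => [y /andP[exy /eqP->] //|no].
  have /existsP[[p /= /eqP sp] /andP[pp /eqP pl]] := levP x.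
  case/lastP: p sp pp pl => [|p z] sp; first by rewrite -sp in lx.
  rewrite rcons_path last_rcons => /andP[pp ez] ezx; subst z.
  set y := last _ p in ez.
  have ryx : root e x = root e y by apply/rootP => //; apply: connect1; rewrite eS.
  have Py : P y (size p) by apply: Pp; rewrite -ryx.
  have := no y; rewrite eS ez /= eqn_leq step //.
  by rewrite -sp size_rcons ltnS lev_min.
exists lev, par; split=> // [x lx|x y cxy lx ly].
  by rewrite /par; case: pickP => // y; rewrite lx andbC.
have lev0 z : lev z = 0 -> root e z = z.
  move=> lz; have /existsP[[p /= /eqP sp] /andP[_ /eqP pl]] := levP z.
  by rewrite lz in sp; move: pl; rewrite (size0nil sp).
by rewrite -(lev0 _ lx) -(lev0 _ ly); apply/rootP.
Qed.

(** * Tree and cotree of an embedded graph *)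

Section Map.
Variables (V : finType) (e : rel V) (F : finType) (t0 t1 t2 : F -> F) (phi : F -> V).
Hypothesis (eS : symmetric e) (eI : irreflexive e).
Hypothesis (mg : map_of_graph e t0 t1 t2 phi).
Let fm : flag_map t0 t1 t2. Proof. by case: mg. Qed.
Let t0K : involutive t0. Proof. by case: fm. Qed.
Let t1K : involutive t1. Proof. by case: fm. Qed.
Let t2K : involutive t2. Proof. by case: fm. Qed.
Let t0N x : t0 x != x. Proof. by case: fm => _ _ _ /(_ x)/and3P[]. Qed.
Let t1N x : t1 x != x. Proof. by case: fm => _ _ _ /(_ x)/and3P[]. Qed.
Let t2N x : t2 x != x. Proof. by case: fm => _ _ _ /(_ x)/and3P[]. Qed.
Let t02C x : t0 (t2 x) = t2 (t0 x). Proof. by case: fm => _ _ _ _ /(_ x)[]. Qed.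
Let t02N x : t0 (t2 x) != x. Proof. by case: fm => _ _ _ _ /(_ x)[]. Qed.

Lemma phiE x y : (phi x == phi y) = connect (rel2 t1 t2) x y.
Proof. by case: mg. Qed.

Lemma phi1 x : phi (t1 x) = phi x.
Proof. by apply/esym/eqP; rewrite phiE connect1 // /rel2 eqxx. Qed.

Lemma phi2 x : phi (t2 x) = phi x.
Proof. by apply/esym/eqP; rewrite phiE connect1 // /rel2 eqxx orbT. Qed.

Lemma flag_edge x : e (phi x) (phi (t0 x)).
Proof. by case: mg. Qed.

Lemma flag_of_edge u v : e u v -> exists x, phi x = u /\ phi (t0 x) = v.
Proof. by case: mg => _ _ _ h _; apply: h. Qed.

Lemma phi0N x : phi (t0 x) != phi x.
Proof. by apply: contraTneq (flag_edge x) => ->; rewrite eI. Qed.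

Lemma rel2_edge_flags x y : connect (rel2 t0 t2) x y = (y \in edge_flags t0 t2 x).
Proof.
have cl := edge_flags_closed fm (y := x).
apply/idP/idP.
  have xE : x \in edge_flags t0 t2 x by rewrite !inE eqxx.
  have cl' : closed (rel2 t0 t2) (mem (edge_flags t0 t2 x)).
    have clv w : (t0 w \in edge_flags t0 t2 x) = (w \in edge_flags t0 t2 x) /\
                 (t2 w \in edge_flags t0 t2 x) = (w \in edge_flags t0 t2 x).
      by split; apply/idP/idP => /cl[]; rewrite ?t0K ?t2K.
    by move=> u v /orP[] /eqP->; case: (clv u).
  by move=> cxy; rewrite -(closed_connect cl' cxy).
have c0 w : connect (rel2 t0 t2) w (t0 w) by apply: connect1; rewrite /rel2 eqxx.
have c2 w : connect (rel2 t0 t2) w (t2 w) by apply: connect1; rewrite /rel2 eqxx orbT.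
rewrite !inE -!orbA => /or4P[] /eqP-> //.
exact: connect_trans (c2 _) (c0 _).
Qed.

(** Flags with the same ends lie on one edge, as there are no parallel edges, and two of its four
    flags have the ends swapped. What remains is the two sides of an oriented edge. *)
Lemma flags_of_arc x y :
  (phi y == phi x) && (phi (t0 y) == phi (t0 x)) = (y \in [set x; t2 x]).
Proof.
apply/andP/idP => [[/eqP exy /eqP exy0]|]; last first.
  by rewrite !inE => /orP[] /eqP->; rewrite ?t02C ?phi2 !eqxx.
have : connect (rel2 t0 t2) x y by case: mg => _ _ _ _; apply.
rewrite rel2_edge_flags !inE -!orbA => /or4P[] /eqP ey; rewrite ey ?eqxx ?orbT //.
  by move: exy; rewrite ey => /eqP; rewrite (negbTE (phi0N x)).
by move: exy; rewrite ey t02C phi2 => /eqP; rewrite (negbTE (phi0N x)).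
Qed.

Lemma card_flags : #|F| = 4 * norbits (rel2 t0 t2).
Proof.
have cs : connect_sym (rel2 t0 t2).
  apply: sym_connect_sym => x y; rewrite /rel2.
  have e' f : involutive f -> (y == f x) = (x == f y).
    by move=> fK; rewrite -(inv_eq fK) eq_sym.
  by rewrite (e' _ t0K) (e' _ t2K).
rewrite /norbits; set R := [set _ | _ in _].
rewrite -cardsT -sum1_card (partition_big (root (rel2 t0 t2)) (mem R)) => [|x _]; last exact: imset_f.
rewrite mulnC -sum_nat_const; apply: eq_bigr => z /imsetP[x0 _ ez].
rewrite -(card_edge_flags fm z) -sum1_card; apply: eq_bigl => x.
rewrite in_setT /= -rel2_edge_flags -(root_connect cs) eq_sym.
by rewrite {2}ez root_root // -ez.
Qed.

Variables (k : nat) (lev : V -> nat) (par : V -> V).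
Hypothesis (kE : k + norbits (rel2 t1 t2) + norbits (rel2 t0 t1)
      = 2 * norbits (rel3 t0 t1 t2) + norbits (rel2 t0 t2)).
Hypothesis (bf : bfs_forest e lev par).
Let lev_e x y : e x y -> lev y <= (lev x).+1. Proof. by case: bf => h _ _ _; apply: h. Qed.
Let par_e x : 0 < lev x -> e x (par x). Proof. by case: bf => _ h _ _ /h[]. Qed.
Let lev_par x : 0 < lev x -> lev x = (lev (par x)).+1. Proof. by case: bf => _ h _ _ /h[]. Qed.

Definition tree_up : {set F} := [set x | (0 < lev (phi x)) && (phi (t0 x) == par (phi x))].
Definition tree_flags : {set F} := [set x | (x \in tree_up) || (t0 x \in tree_up)].

Lemma tree_up2 x : (t2 x \in tree_up) = (x \in tree_up).
Proof. by rewrite !inE t02C !phi2. Qed.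

Lemma tree_flags_closed : edge_closed t0 t2 tree_flags.
Proof.
move=> x xT; split; move: xT; rewrite [x \in _]in_set => xT; rewrite in_set.
  by rewrite t0K orbC.
by rewrite t02C !tree_up2.
Qed.

(** Each vertex of positive level carries two flags of the edge to its parent, and [t0] gives the
    two at the other end. The two families are disjoint, as levels cannot decrease in both
    directions. *)
Lemma card_tree_flags : #|tree_flags| = 4 * #|[set v | 0 < lev v]|.
Proof.
have -> : #|tree_flags| = #|tree_up| + #|t0 @: tree_up|.
  rewrite -cardsUI [X in _ + X](_ : _ = 0) ?addn0.
    apply: eq_card => x; rewrite in_setU [in LHS]inE; congr (_ || _).
    apply/idP/imsetP => [xT|[y yT ->]]; last by rewrite t0K.
    by exists (t0 x); rewrite ?t0K.
  apply/eqP; rewrite cards_eq0; apply/eqP/setP => x; rewrite in_setI in_set0.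
  apply/negP => /andP[xT /imsetP[y yT exy]]; move: xT yT; rewrite exy !inE t0K.
  case/andP=> l1 /eqP e1 /andP[l2 /eqP e2].
  by move: (lev_par l1) (lev_par l2); rewrite -e1 -e2; lia.
rewrite card_imset; last exact: inv_inj.
suff -> : #|tree_up| = 2 * #|[set v | 0 < lev v]| by lia.
rewrite -sum1_card (partition_big phi (mem [set v | 0 < lev v])); last first.
  by move=> x; rewrite !inE => /andP[].
rewrite mulnC -sum_nat_const; apply: eq_bigr => v; rewrite !inE => lv.
have [x [ex ex0]] := flag_of_edge (par_e lv).
have -> : 2 = #|[set x; t2 x]| by rewrite cards2 eq_sym t2N.
rewrite -sum1_card; apply: eq_bigl => y; rewrite -flags_of_arc ex ex0 !inE.
by case: (phi y =P v) => [->|]; rewrite ?lv ?andbT ?andbF.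
Qed.

Let csym3 : connect_sym (rel3 t0 t1 t2).
Proof.
apply: sym_connect_sym => x y; rewrite /rel3.
have e' f : involutive f -> (y == f x) = (x == f y).
  by move=> fK; rewrite -(inv_eq fK) eq_sym.
by rewrite (e' _ t0K) (e' _ t1K) (e' _ t2K).
Qed.

Let csym12 : connect_sym (rel2 t1 t2).
Proof.
apply: sym_connect_sym => x y; rewrite /rel2.
have e' f : involutive f -> (y == f x) = (x == f y).
  by move=> fK; rewrite -(inv_eq fK) eq_sym.
by rewrite (e' _ t1K) (e' _ t2K).
Qed.

Lemma norbits_vertices : norbits (rel2 t1 t2) = #|[set phi x | x : F]|.
Proof.
rewrite /norbits; set R := [set _ | _ in _].
have -> : [set phi x | x : F] = [set phi x | x in R].
  apply/setP=> v; apply/imsetP/imsetP => [[x _ ->]|[x _ ->]]; last by exists x.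
  exists (root (rel2 t1 t2) x); first exact: imset_f.
  by apply/eqP; rewrite phiE connect_root.
rewrite card_in_imset // => _ _ /imsetP[x _ ->] /imsetP[y _ ->] /eqP.
by rewrite phiE => /(rootP csym12); rewrite !root_root.
Qed.

Lemma rel3_connect_vertices x y : connect (rel3 t0 t1 t2) x y -> connect e (phi x) (phi y).
Proof.
case/connectP=> p; elim: p x => [|z p IHp] x /=; first by move=> _ ->.
case/andP=> /or3P[] /eqP-> pp el.
- apply: connect_trans (connect1 (flag_edge x)) _; exact: IHp.
- by rewrite -(phi1 x); apply: IHp.
- by rewrite -(phi2 x); apply: IHp.
Qed.

(** Flags in one component of the map lie over one component of the graph, which contains only one
    root. *)
Lemma card_roots_leq : #|[set v in [set phi x | x : F] | lev v == 0]| <= norbits (rel3 t0 t1 t2).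
Proof.
set A := [set _ in _ | _].
pose g z := odflt (phi z) [pick v | connect e (phi z) v && (lev v == 0)].
rewrite /norbits; set R := [set _ | _ in _].
apply: leq_trans (leq_imset_card g R); apply/subset_leq_card/subsetP => v.
rewrite inE => /andP[/imsetP[x _ ev] lv].
apply/imsetP; exists (root (rel3 t0 t1 t2) x); first exact: imset_f.
have cxv : connect e (phi (root (rel3 t0 t1 t2) x)) v.
  by rewrite ev; apply: rel3_connect_vertices; rewrite csym3 connect_root.
rewrite /g; case: pickP => [w /andP[cw lw]|/(_ v)]; last by rewrite cxv lv.
case: bf => _ _ _; apply; try exact/eqP.
by apply: connect_trans cw; rewrite (sym_connect_sym eS).
Qed.

Let csymY Y := face_csym fm (Y := Y).

(** Suppose that the two sides of a tree edge, with flag [w] at the child, lie in different classes.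
    The indicator of one class is a function on faces and changes only across tree edges, while the
    subtree [K] below [w] is left by this tree edge alone. Read in the dual map, with [t0] and [t2]
    exchanged, [cocycle_cut_edge] excludes this. *)
Lemma nontree_faces_connected :
  norbits (face_rel t0 t1 t2 (~: tree_flags)) <= norbits (rel3 t0 t1 t2).
Proof.
set r := face_rel _ _ _ _.
have cr : connect_sym r.
  by apply: csymY => x; rewrite !in_setC => xT; split; apply: contra xT => /tree_flags_closed[];
     rewrite ?t0K ?t2K.
apply: norbits_leq => // u v.
have r0 w : connect r w (t0 w) by apply: connect1; rewrite /r /face_rel eqxx.
have r1 w : connect r w (t1 w) by apply: connect1; rewrite /r /face_rel eqxx orbT.
have r2 w : w \notin tree_flags -> connect r w (t2 w).
  by move=> wT; apply: connect1; rewrite /r /face_rel inE wT eqxx !orbT.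
suff up w : w \in tree_up -> connect r w (t2 w).
  case/or3P=> /eqP-> //; case: (boolP (u \in tree_flags)) => [|/r2//].
  rewrite inE => /orP[/up//|/up]; rewrite -t02C => cu.
  by apply: connect_trans (r0 _) (connect_trans cu _); rewrite cr.
move=> wT; apply/negPn/negP => ncw.
pose f x := connect r w x.
have f0 x : f (t0 x) = f x by rewrite /f (same_connect_r cr (r0 x)).
have f1 x : f (t1 x) = f x by rewrite /f (same_connect_r cr (r1 x)).
pose K := [set x | fconnect par (phi x) (phi w)].
have fT x : f x (+) f (t2 x) -> x \in tree_flags.
  by apply: contraLR => /r2 cx; rewrite /f (same_connect_r cr cx) addbb.
suff : f w (+) f (t2 w) = false by rewrite /f connect0 (negbTE ncw).
apply: (@cocycle_cut_edge _ t2 t0 t1 f K) => //.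
- by move=> x; rewrite -t02C.
- by move=> x /=; rewrite -t02C !f0.
- by move=> x; rewrite !inE phi1.
- by move=> x; rewrite !inE phi2.
- move=> x; rewrite [x \in K]inE => xK /fT; rewrite inE => xT xw xtw; rewrite inE.
  case/orP: xT; rewrite inE ?t0K => /andP[lx /eqP ex].
    rewrite ex; move/connectP: xK => [[|z p] /= pp el].
      have : x \in [set w; t2 w].
        move: (wT); rewrite inE => /andP[_ /eqP ew].
        by rewrite -flags_of_arc el ew el ex !eqxx.
      by rewrite !inE (negbTE xw) (negbTE xtw).
    by case/andP: pp => /eqP ez pp; apply/connectP; exists p; rewrite ?ez // -?ez.
  by apply: connect_trans xK; apply: connect1; rewrite /= ex.
- by rewrite inE.
rewrite inE; apply/negP => /connectP[p pp el].
have : lev (last (phi (t0 w)) p) <= lev (phi (t0 w)).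
  elim: p (phi (t0 w)) pp {el} => //= z p IHp v0 /andP[/eqP <- /IHp] h.
  apply: leq_trans h _; case: (posnP (lev v0)) => [l0|/lev_par->] //.
  by case: bf => _ _ /(_ _ l0)-> _.
move: wT; rewrite inE -el => /andP[lw /eqP->].
by rewrite {1}(lev_par lw) ltnn.
Qed.


(** If the map has [c] components, at most [E - V + c] edges lie off the tree, and a dual spanning
    forest takes up at least [F - c] of them. This leaves [2c - V + E - F = k]. A cocycle vanishing
    on the tree is supported off it, so [cotree_complement] applies. *)
Lemma cohomology_basis : exists X : seq F, size X <= k /\
  forall psi : F -> bool, (forall x, psi (t1 x) = psi x) ->
    (forall x, cobd t0 psi (t2 x) = cobd t0 psi x) ->
    (forall x, x \in tree_up -> cobd t0 psi x = false) ->
    (forall x, x \in X -> cobd t0 psi x = false) ->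
    forall x, cobd t0 psi x = false.
Proof.
have [|X [szX XP]] := cotree_complement fm (Y := ~: tree_flags).
  by move=> x; rewrite !in_setC => xT; split; apply: contra xT => /tree_flags_closed[];
     rewrite ?t0K ?t2K.
exists X; split.
  have := cardsC tree_flags; rewrite card_flags card_tree_flags.
  have := nontree_faces_connected; have := card_roots_leq.
  set A := [set _ in _ | _] => cA.
  have : norbits (rel2 t1 t2) = #|A| + #|[set v | 0 < lev v]|.
    rewrite norbits_vertices -(cardsID [set v | lev v == 0]); congr (_ + _).
      by apply: eq_card => v; rewrite !inE.
    apply: eq_card => v; rewrite in_setD !inE lt0n.
    case: (posnP (lev v)) => //= lv; apply/imsetP.
    by have [x [<- _]] := flag_of_edge (par_e lv); exists x.
  by move: kE szX cA; lia.
move=> psi p1 p2 pT pX; apply: XP => // x px; rewrite in_setC; apply/negP; rewrite in_set.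
by case/orP => /pT; rewrite ?(cobd0 fm) px.
Qed.

(** [ph v] sums the cocycle along the tree path from [v] to its root, so adding the coboundary of
    [ph] kills the cocycle on the tree. The vertical paths from [ends] form a set closed under
    [par]; the cocycle is zero inside it, hence so is [ph], and the sum vanishes on [X] as well. By
    the choice of [X] it is zero. *)
Lemma homology_cut : exists ends : seq V, size ends <= 2 * k /\
  forall psi : F -> bool, (forall x, psi (t1 x) = psi x) ->
    (forall x, cobd t0 psi (t2 x) = cobd t0 psi x) ->
    (forall x, has (fconnect par ^~ (phi x)) ends ->
               has (fconnect par ^~ (phi (t0 x))) ends -> cobd t0 psi x = false) ->
    exists ph : V -> bool, forall x, cobd t0 psi x = ph (phi x) (+) ph (phi (t0 x)).
Proof.
have [X [szX XP]] := cohomology_basis.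
exists (flatten [seq [:: phi x; phi (t0 x)] | x <- X]); split.
  have -> : size (flatten [seq [:: phi x; phi (t0 x)] | x <- X]) = 2 * size X.
    by elim: (X) => //= x X' ->; rewrite mulnS.
  by rewrite leq_mul2l.
set ends := flatten _ => psi p1 p2 pS.
set inS := fun v => has (fconnect par ^~ v) ends.
have al_eq x y : phi x = phi y -> phi (t0 x) = phi (t0 y) -> cobd t0 psi x = cobd t0 psi y.
  move=> exy exy0; have : x \in [set y; t2 y] by rewrite -flags_of_arc exy exy0 !eqxx.
  by rewrite !inE => /orP[] /eqP->.
pose av u v := [exists x, [&& phi x == u, phi (t0 x) == v & cobd t0 psi x]].
have avE x : av (phi x) (phi (t0 x)) = cobd t0 psi x.
  apply/existsP/idP => [[y /and3P[/eqP e1 /eqP e2]]|ax]; last by exists x; rewrite !eqxx.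
  by rewrite (al_eq _ _ e1 e2).
pose phn := fix phn n v := if n is n'.+1 then av v (par v) (+) phn n' (par v) else false.
pose ph v := phn (lev v) v.
have phE v : 0 < lev v -> ph v = av v (par v) (+) ph (par v).
  by move=> lv; rewrite /ph {1}(lev_par lv).
have inSpar v : inS v -> inS (par v).
  case/hasP=> w wE cw; apply/hasP; exists w => //; apply: connect_trans cw _.
  by apply: connect1 => /=.
have phS v : inS v -> ph v = false.
  move: {-1}(lev v) (erefl (lev v)) => n; elim: n v => [|n IHn] v lv vS; first by rewrite /ph lv.
  have lv0 : 0 < lev v by rewrite lv.
  have lpar : lev (par v) = n by move: lv; rewrite (lev_par lv0) => -[].
  rewrite phE // (IHn _ lpar (inSpar _ vS)) addbF.
  have [x [ex ex0]] := flag_of_edge (par_e lv0).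
  rewrite -ex0 -{1}ex avE; apply: pS; first by rewrite ex.
  by rewrite ex0; apply: inSpar.
pose psi' x := psi x (+) ph (phi x).
have cE x : cobd t0 psi' x = cobd t0 psi x (+) (ph (phi x) (+) ph (phi (t0 x))).
  by rewrite /cobd /psi' addbACA.
suff c0 x : cobd t0 psi' x = false.
  by exists ph => x; move: (c0 x); rewrite cE; case: (cobd _ _ x); case: (ph (phi x)); case: (ph _).
move: x; apply: XP => [x|x|x|x xX].
- by rewrite /psi' p1 phi1.
- by rewrite !cE p2 t02C !phi2.
- rewrite inE => /andP[lx /eqP ex].
  by rewrite cE (phE _ lx) -ex avE addbK addbb.
have endsX v : v \in [:: phi x; phi (t0 x)] -> inS v.
  move=> vx; apply/hasP; exists v; last exact: connect0.
  by apply/flattenP; exists [:: phi x; phi (t0 x)] => //; apply: map_f xX.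
have xS : inS (phi x) by apply: endsX; rewrite !inE eqxx.
have x0S : inS (phi (t0 x)) by apply: endsX; rewrite !inE eqxx orbT.
by rewrite cE (phS _ xS) (phS _ x0S) (pS _ xS x0S).
Qed.
End Map.

(** * The cyclic order around a connected set *)

(* A reflection of a cycle fixes a vertex or an edge, that is, a point of b or of a. *)
Lemma dihedral_no_flip (T : finType) (a b : T -> T) :
  involutive a -> involutive b -> (forall x, a x != x) -> (forall x, b x != x) ->
  forall k x, iter k (a \o b) x != b x.
Proof.
move=> aK bK aN bN k; have [n] := ubnP k; elim: n k => // n IHn [|[|k]] lt x /=.
- by rewrite eq_sym.
- exact: aN.
have : iter k (a \o b) (a (b x)) != b (a (b x)) by apply: IHn; lia.
apply: contra => /eqP /= h.
by apply/eqP; rewrite -[a (b x)]/((a \o b) x) -iterSr iterS /= -h aK bK.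
Qed.

Lemma in_set2_addb (T : finType) (a b w : T) :
  a != b -> (w \in [set a; b]) = (w == a) (+) (w == b).
Proof. by rewrite !inE; case: (w =P a) => [->|]; case: (_ =P b) => // ->; rewrite ?eqxx. Qed.

(** * Closed walks off S bound sets of faces *)

Section Map.
Variables (V : finType) (e : rel V) (F : finType) (t0 t1 t2 : F -> F) (phi : F -> V).
Hypothesis (eS : symmetric e) (eI : irreflexive e).
Hypothesis (mg : map_of_graph e t0 t1 t2 phi).
Let fm : flag_map t0 t1 t2. Proof. by case: mg. Qed.
Let t0K : involutive t0. Proof. by case: fm. Qed.
Let t1K : involutive t1. Proof. by case: fm. Qed.
Let t2K : involutive t2. Proof. by case: fm. Qed.
Let t0N x : t0 x != x. Proof. by case: fm => _ _ _ /(_ x)/and3P[]. Qed.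
Let t1N x : t1 x != x. Proof. by case: fm => _ _ _ /(_ x)/and3P[]. Qed.
Let t2N x : t2 x != x. Proof. by case: fm => _ _ _ /(_ x)/and3P[]. Qed.
Let t02C x : t0 (t2 x) = t2 (t0 x). Proof. by case: fm => _ _ _ _ /(_ x)[]. Qed.
Let phi1 x : phi (t1 x) = phi x := phi1 mg x.
Let phi2 x : phi (t2 x) = phi x := phi2 mg x.

Definition dart u v (w : F) := (phi w == u) && (phi (t0 w) == v).

Lemma dart2 u v w : dart u v (t2 w) = dart u v w.
Proof. by rewrite /dart t02C !phi2. Qed.

Lemma dart0 u v w : dart u v (t0 w) = dart v u w.
Proof. by rewrite /dart t0K andbC. Qed.

Lemma dartE x w : dart (phi x) (phi (t0 x)) w = (w \in [set x; t2 x]).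
Proof. exact: (flags_of_arc eI mg). Qed.

(** [psi] marks the corners passed when turning around the vertex from [x] to [y], so across edge
    sides it changes only at the two ends of the turn. *)
Lemma arc_potential x y : connect (rel2 t1 t2) x y -> exists psi : F -> bool,
  [/\ forall w, psi (t1 w) = psi w, forall w, psi w -> phi w = phi x &
      forall w, psi w (+) psi (t2 w) = (w \in [set x; t2 x]) (+) (w \in [set y; t2 y])].
Proof.
case/connectP=> p; elim: p x => [|z p IHp] x /=.
  by move=> _ ->; exists (fun=> false); split=> // w; rewrite !addbb.
case/andP=> xz pp ely; have [psi [p1 pS p2]] := IHp _ pp ely.
have pzx : phi z = phi x by case/orP: xz => /eqP->.
case/orP: xz => /eqP ez.
  exists (fun w => psi w (+) (w \in [set x; z])); split=> w.
  - by rewrite p1 !inE ez (inv_eq t1K) (inj_eq (inv_inj t1K)) orbC.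
  - case pw: (psi w) => /=; first by rewrite (pS w pw).
    by rewrite !inE => /orP[] /eqP->.
  have xz : x != z by rewrite ez eq_sym.
  have zN : z != t2 z by rewrite eq_sym.
  have xN : x != t2 x by rewrite eq_sym.
  rewrite addbACA p2 !(in_set2_addb _ xz) (in_set2_addb w zN) (in_set2_addb w xN).
  rewrite (inv_eq t2K w x) (inv_eq t2K w z).
  by case: (w == x); case: (w == z); case: (w == t2 x); case: (w == t2 z); case: (w \in _).
exists psi; split=> // w; first by move/pS; rewrite pzx.
by rewrite p2 ez t2K; congr (_ (+) _); rewrite setUC.
Qed.

Lemma corner_potential v n m : e v n -> e v m -> exists psi : F -> bool,
  [/\ forall w, psi (t1 w) = psi w, forall w, psi w -> phi w = v &
      forall w, psi w (+) psi (t2 w) = dart v n w (+) dart v m w].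
Proof.
move=> /(flag_of_edge mg)[x [<- <-]] /(flag_of_edge mg)[y [eyx <-]].
have [|psi [p1 pS p2]] := @arc_potential x y; first by rewrite -(phiE mg) eyx.
by exists psi; split=> // w; rewrite p2 -!dartE eyx.
Qed.

(** The number of times, mod 2, that the walk uses the edge of [w] in either direction. *)
Fixpoint walk_parity x p w :=
  if p is y :: p' then dart x y w (+) dart y x w (+) walk_parity y p' w else false.

Lemma walk_parity_cat x p q w :
  walk_parity x (p ++ q) w = walk_parity x p w (+) walk_parity (last x p) q w.
Proof. by elim: p x => //= y p IHp x; rewrite IHp addbA. Qed.

Lemma walk_parity0 x p w : walk_parity x p (t0 w) = walk_parity x p w.
Proof. by elim: p x => //= y p IHp x; rewrite IHp !dart0 [dart y x w (+) _]addbC. Qed.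

Lemma walk_parity_out x p w : (phi w \notin x :: p) || (phi (t0 w) \notin x :: p) ->
  walk_parity x p w = false.
Proof.
elim: p x => //= y p IHp x nw.
have key v : v \notin x :: y :: p -> [/\ v != x, v != y & v \notin y :: p].
  by rewrite !inE !negb_or => /and3P[-> -> ->].
have /andP[/andP[d1 d2] sub] : ~~ dart x y w && ~~ dart y x w &&
    ((phi w \notin y :: p) || (phi (t0 w) \notin y :: p)).
  by rewrite /dart; case/orP: nw => /key[/negbTE-> /negbTE-> ->]; rewrite ?andbF ?orbT.
by rewrite IHp // (negbTE d1) (negbTE d2).
Qed.

(** At every visit [psi] marks the corners on one side of the walk, from the incoming to the
    outgoing edge; [n] and [m] stand in for the missing edges at the two ends. The sides chosen at
    different visits are unrelated. *)
Lemma walk_potential p : forall x n m, path e x p -> e x n -> e (last x p) m ->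
  exists psi : F -> bool,
  [/\ forall w, psi (t1 w) = psi w, forall w, psi w -> phi w \in x :: p &
      forall w, psi w (+) psi (t2 w) =
        walk_parity x p w (+) (dart x n w (+) dart (last x p) m w)].
Proof.
elim: p => [|y p IHp] x n m /=.
  move=> _ xn xm; have [psi [p1 pS p2]] := corner_potential xn xm.
  by exists psi; split=> // w /pS->; rewrite inE.
case/andP=> xy pp xn lm; have [psi [p1 pS p2]] := corner_potential xn xy.
have yx : e y x by rewrite eS.
have [ps [q1 qS q2]] := IHp y x m pp yx lm.
exists (fun w => psi w (+) ps w); split=> w.
- by rewrite p1 q1.
- case pw: (psi w) => /=; first by rewrite (pS w pw) inE eqxx.
  by move/qS => h; rewrite inE h orbT.
rewrite addbACA p2 q2 /=; case: (dart x n w); case: (dart x y w); case: (dart y x w);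
  by case: (dart _ _ w); case: walk_parity.
Qed.

Variable S : {set V}.
Hypothesis SP : forall psi : F -> bool, (forall x, psi (t1 x) = psi x) ->
    (forall x, cobd t0 psi (t2 x) = cobd t0 psi x) ->
    (forall x, phi x \in S -> phi (t0 x) \in S -> cobd t0 psi x = false) ->
    exists ph : V -> bool, forall x, cobd t0 psi x = ph (phi x) (+) ph (phi (t0 x)).

(** The side chosen by [psi] may switch along edges. This defect [cobd t0 psi] is a cocycle that
    vanishes on edges inside [S], because [psi] lives on the walk, so it is the coboundary of some
    [ph]. Exchanging the sides where [ph] holds gives a function on faces, which changes exactly
    across the edges used an odd number of times. *)
Lemma closed_walk_bounds x p : path e x p -> last x p = x -> {subset x :: p <= ~: S} ->
  exists f : F -> bool,
  [/\ forall w, f (t0 w) = f w, forall w, f (t1 w) = f w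
    & forall w, f (t2 w) = f w (+) walk_parity x p w].
Proof.
move=> pp lp pS.
case: p pp lp pS => [|y p] pp lp pS; first by exists xpredT.
have xy : e x y by case/andP: pp.
have lxy : e (last x (y :: p)) y by rewrite lp.
(* With [y] as extra neighbour at both ends the two end terms cancel, as the walk is closed. *)
have [psi [p1 pS' p2]] := walk_potential pp xy lxy.
have {}p2 w : psi (t2 w) = psi w (+) walk_parity x (y :: p) w.
  by move: (p2 w); rewrite lp addbb addbF => <-; rewrite addbA addbb.
have [|w wS w0S|ph phP] := SP p1.
- by move=> w; rewrite /cobd t02C !p2 walk_parity0 addbACA addbb addbF.
- have n v : phi v \in S -> psi v = false.
    by move=> vS; apply/negP => /pS'/pS; rewrite inE vS.
  by rewrite /cobd !n.
exists (fun w => psi w (+) ph (phi w)); split=> w.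
- move: (phP w); rewrite /cobd.
  by case: (psi w); case: (psi _); case: (ph _); case: (ph _).
- by rewrite p1 phi1.
- by rewrite p2 phi2 addbAC.
Qed.
End Map.

(** * The cyclic order of a bond *)

Section Bond.
Variables (V : finType) (e : rel V) (F : finType) (t0 t1 t2 : F -> F) (phi : F -> V).
Hypothesis (eS : symmetric e) (eI : irreflexive e).
Hypothesis (mg : map_of_graph e t0 t1 t2 phi).
Let fm : flag_map t0 t1 t2. Proof. by case: mg. Qed.
Let t0K : involutive t0. Proof. by case: fm. Qed.
Let t1K : involutive t1. Proof. by case: fm. Qed.
Let t2K : involutive t2. Proof. by case: fm. Qed.
Let t0N x : t0 x != x. Proof. by case: fm => _ _ _ /(_ x)/and3P[]. Qed.
Let t1N x : t1 x != x. Proof. by case: fm => _ _ _ /(_ x)/and3P[]. Qed.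
Let t2N x : t2 x != x. Proof. by case: fm => _ _ _ /(_ x)/and3P[]. Qed.
Let t02C x : t0 (t2 x) = t2 (t0 x). Proof. by case: fm => _ _ _ _ /(_ x)[]. Qed.
Let t02N x : t0 (t2 x) != x. Proof. by case: fm => _ _ _ _ /(_ x)[]. Qed.
Let phi1 x : phi (t1 x) = phi x := phi1 mg x.
Let phi2 x : phi (t2 x) = phi x := phi2 mg x.

Variable S : {set V}.
Let e' := restr e (~: S).
Hypothesis bound : forall x p, path e x p -> last x p = x -> {subset x :: p <= ~: S} ->
  exists f : F -> bool,
  [/\ forall w, f (t0 w) = f w, forall w, f (t1 w) = f w
    & forall w, f (t2 w) = f w (+) walk_parity t0 phi x p w].

Variables (C : {set V}) (u0 c0 : V).
Hypothesis (Cc : connected e' C) (ex0 : exits e' C u0 c0).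
Hypothesis (Uc : forall u c, exits e' C u c -> connect (restr e' (~: C)) u0 u).

Notation dart := (dart t0 phi).
Notation wpar := (walk_parity t0 phi).

Let outer v := (v \notin C) && (v \notin S).
Let sig w := if outer (phi w) && outer (phi (t0 w)) then t0 w else t2 w.
(* rho walks around C: along the faces, past the edges inside the complement of C and S,
   crossing the edges into C or S. *)
Let rho := t1 \o sig.

Let sigK : involutive sig.
Proof.
move=> w; rewrite /sig; case ow: (outer (phi w) && outer (phi (t0 w))); rewrite /=.
  by rewrite t0K andbC ow.
by rewrite t02C !phi2 ow t2K.
Qed.

Let sigN w : sig w != w. Proof. by rewrite /sig; case: ifP. Qed.

Let rhoI : injective rho.
Proof. by move=> x y /(inv_inj t1K)/(inv_inj sigK). Qed.

Let rho_outer w : outer (phi (rho w)) = outer (phi w).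
Proof. by rewrite /rho /= phi1 /sig; case: ifP => [/andP[-> ->]|]; rewrite ?phi2. Qed.

Let e'S u v : e' u v -> [/\ u \notin S, v \notin S & e u v].
Proof. by case/and3P; rewrite !inE. Qed.

Let exit_flag u c : exits e' C u c -> exists x, dart u c x.
Proof.
case/and3P=> _ _ /e'S[_ _ /(flag_of_edge mg)[x [<- <-]]].
by exists x; rewrite /dart !eqxx.
Qed.

Let sig_exit u c w : exits e' C u c -> dart u c w -> sig w = t2 w /\ outer (phi w).
Proof.
case/and3P=> uC cC /e'S[uS cS _] /andP[/eqP ew /eqP ew0].
by rewrite /sig /outer ew ew0 uC cC uS.
Qed.

Lemma bond_anchor : exists x0, dart u0 c0 x0.
Proof. exact: exit_flag ex0. Qed.

Section Anchor.
Variable x0 : F.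
Hypothesis x0E : dart u0 c0 x0.

Let O w := fconnect rho x0 w.
Let M w := O w || O (sig w).

Let O_rho w : O (rho w) = O w.
Proof.
rewrite /O; apply: (same_connect_r (fconnect_sym rhoI)).
by rewrite (fconnect_sym rhoI) fconnect1.
Qed.

Let M_sig w : M (sig w) = M w. Proof. by rewrite /M sigK orbC. Qed.

Let M_t1 w : M (t1 w) = M w.
Proof.
have e1 : t1 w = rho (sig w) by rewrite /rho /= sigK.
have e2 : O (sig (t1 w)) = O w by rewrite -O_rho /rho /= sigK t1K.
by rewrite /M e2 e1 O_rho orbC.
Qed.

Let O_outer w : O w -> outer (phi w).
Proof.
have ox0 : outer (phi x0) by case: (sig_exit ex0 x0E).
case/connectP=> p; elim/last_ind: p w => [|p z IHp] w /=; first by move=> _ ->.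
by rewrite rcons_path last_rcons => /andP[pp /eqP <-] ->; rewrite rho_outer; apply: IHp.
Qed.

Let sig_outer w : outer (phi (sig w)) = outer (phi w).
Proof. by rewrite -[RHS]rho_outer /rho /= phi1. Qed.

Let M_outer w : M w -> outer (phi w).
Proof. by case/orP => /O_outer //; rewrite sig_outer. Qed.

(** Otherwise a power of [rho], the composition of two involutions without fixed points, would agree
    with one of them at [w], which [dihedral_no_flip] forbids. So the orbit passes each exit on one
    side only. *)
Let O_sig w : O w -> ~~ O (sig w).
Proof.
move=> ow; apply/negP => osw; have : fconnect rho w (sig w).
  by apply: connect_trans osw; rewrite (fconnect_sym rhoI).
by move/iter_findex/eqP; apply/negP; apply: dihedral_no_flip.
Qed.

Let walk_in_C w x p : {subset x :: p <= C} -> outer (phi w) || outer (phi (t0 w)) -> wpar x p w = false.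
Proof.
move=> pC ow; apply: walk_parity_out.
by case/orP: ow => /andP[nC _]; [rewrite (contra (pC _) nC)|rewrite (contra (pC _) nC) orbT].
Qed.

Let walk_in_U w x p : {subset x :: p <= ~: C} -> ~~ (outer (phi w) && outer (phi (t0 w))) ->
  {subset x :: p <= ~: S} -> wpar x p w = false.
Proof.
move=> pC ow pS; apply: walk_parity_out; move: ow; rewrite -negb_and; apply: contra.
by case/andP=> h1 h2; rewrite /outer -!in_setC !pC ?pS.
Qed.

(** Neither the part inside [C] nor the part outside uses an edge with exactly one outer end, so on
    such an edge only the two crossings count. *)
Let loop_parity u1 c1 u2 c2 pc pu w : exits e' C u1 c1 -> exits e' C u2 c2 ->
  last c1 pc = c2 -> {subset pc <= C} -> last u2 pu = u1 -> {subset pu <= ~: C} ->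
  {subset pu <= ~: S} -> outer (phi w) -> ~~ outer (phi (t0 w)) ->
  wpar u1 (c1 :: pc ++ u2 :: pu) w = dart u1 c1 w (+) dart u2 c2 w.
Proof.
case/and3P=> u1C c1C /e'S[u1S c1S _] /and3P[u2C c2C /e'S[u2S c2S _]] el1 pcC el2 puC puS ow ow0.
have nd c u : c \in C -> dart c u w = false.
  move=> cC; apply/negP => /andP[/eqP ec _].
  by move: ow; rewrite /outer ec cC.
rewrite /= walk_parity_cat /= el1 (nd c1) // (nd c2) // addbF.
rewrite (@walk_in_C w) ?ow // => [|z]; last by rewrite inE => /predU1P[->|/pcC].
rewrite (@walk_in_U w) ?(negbTE ow0) ?andbF //= ?addbF // => z; rewrite !inE => /predU1P[->//|].
  by move/puC; rewrite in_setC.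
by move/puS; rewrite in_setC.
Qed.

Let loop_path u1 c1 u2 c2 pc pu : exits e' C u1 c1 -> exits e' C u2 c2 ->
  path e' c1 pc -> last c1 pc = c2 -> path e' u2 pu -> last u2 pu = u1 ->
  [/\ path e u1 (c1 :: pc ++ u2 :: pu), last u1 (c1 :: pc ++ u2 :: pu) = u1
    & {subset u1 :: c1 :: pc ++ u2 :: pu <= ~: S}].
Proof.
case/and3P=> _ _ ue1 /and3P[_ _ ue2] pc1 el1 pu2 el2.
have sub : subrel e' e by move=> x y /e'S[].
have e'sym : symmetric e' by move=> x y; rewrite /e' /restr eS andbCA.
have pp : path e' u1 (c1 :: pc ++ u2 :: pu).
  by rewrite /= ue1 cat_path pc1 /= el1 e'sym ue2.
split; first exact: sub_path sub _ _ pp.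
  by rewrite /= last_cat.
have pS x p : path e' x p -> x \in ~: S -> {subset x :: p <= ~: S}.
  elim: p x => [|y p IHp] x /=; first by move=> _ xS z; rewrite inE => /eqP->.
  case/andP=> /e'S[_ yS _] pp' xS z; rewrite inE => /predU1P[->//|].
  by apply: (IHp y pp'); rewrite in_setC.
by apply: pS pp _; rewrite in_setC; case/e'S: ue1.
Qed.

(** If [M] missed an exit, a closed walk through it and the exit at [u0] would bound a set [f] of
    faces. The cochain [M w (+) M (t0 w)] is nonzero only on edges with exactly one outer end; of
    these the walk uses its two crossings, and [M] misses one. So it meets the boundary of [f] in
    the exit at [u0] alone, against [cocycle_cut_edge]. *)
Let single_orbit u c x : exits e' C u c -> dart u c x -> M x.
Proof.
move=> exu xE; apply/negPn/negP => nMx.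
have [u0C c0C ue0] : [/\ u0 \notin C, c0 \in C & e' u0 c0] by apply/and3P.
have [uC cC uec] : [/\ u \notin C, c \in C & e' u c] by apply/and3P.
have /connectP[pc pc1 el1] : connect (restr e' C) c0 c by apply: Cc.
have /connectP[pu pu1 el2] : connect (restr e' (~: C)) u u0.
  rewrite sym_connect_sym ?(Uc exu) // => a b; rewrite /restr /e' /restr.
  by rewrite [e a b]eS; do 4! case: (_ \in _).
have restrP A y p : path (restr e' A) y p -> path e' y p /\ {subset p <= A}.
  elim: p y => //= z p IHp y /andP[/and3P[_ zA eyz] /IHp[pp pA]].
  by rewrite eyz pp; split=> // w; rewrite inE => /predU1P[->//|/pA].
have [pc2 pcC] := restrP _ _ _ pc1; have [pu2 puC] := restrP _ _ _ pu1.
have [lp1 lp2 lpS] := loop_path ex0 exu pc2 (esym el1) pu2 (esym el2).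
have puS : {subset pu <= ~: S}.
  by move=> z zp; apply: lpS; rewrite !(inE, mem_cat) zp !orbT.
have [f [f0 f1 f2]] := bound lp1 lp2 lpS.
have Z w : outer (phi w) -> ~~ outer (phi (t0 w)) ->
    wpar u0 (c0 :: pc ++ u :: pu) w = dart u0 c0 w (+) dart u c w.
  by move=> o1 o2; apply: loop_parity => //.
have Mx0 : M x0 by rewrite /M /O connect0.
have Mt0 w : M w -> ~~ outer (phi (t0 w)) -> M (t2 w).
  by move=> mw ow; move: (mw); rewrite -M_sig /sig (negbTE ow) andbF.
have dx0 w : dart u0 c0 w -> w = x0 \/ w = t2 x0.
  have [/eqP eu /eqP ec] := andP x0E; rewrite -eu -ec (dartE eI mg) !inE.
  by case/orP => /eqP->; [left|right].
have dx w : M w -> dart u c w = false.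
  move=> mw; have [/eqP eu /eqP ec] := andP xE; apply/negP.
  rewrite -eu -ec (dartE eI mg) !inE => /orP[] /eqP ew; subst w; first by rewrite mw in nMx.
  have [sx _] := sig_exit exu xE.
  by rewrite -sx M_sig (negbTE nMx) in mw.
have ox0 : outer (phi x0) by apply: M_outer.
have ox00 : ~~ outer (phi (t0 x0)).
  by have [_ /eqP ec] := andP x0E; rewrite ec /outer c0C.
have Z0 : f (t2 x0) = ~~ f x0.
  by rewrite f2 Z // x0E dx // addbF addbT.
(* Of the two sides of the exit at [u0], [y] is the one inside [f]. *)
pose y := if f x0 then x0 else t2 x0.
have fy : f y by rewrite /y; case: ifP => // fx0; rewrite Z0 fx0.
have fy2 : ~~ f (t2 y) by rewrite /y; case: ifP => fx0; rewrite ?t2K ?Z0 fx0.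
have y2 : y = x0 \/ y = t2 x0 by rewrite /y; case: ifP; [left|right].
have My : M y by case: y2 => ->; rewrite ?Mt0.
have Mty : M (t0 y) = false.
  apply/negP => /M_outer; case: y2 => ->; rewrite ?t02C ?phi2; exact/negP.
suff: M y (+) M (t0 y) = false by rewrite My Mty.
apply: (@cocycle_cut_edge _ t0 t2 t1 M [set w | f w]) => //.
- move=> w; case ow: (outer (phi w) && outer (phi (t0 w))).
    rewrite t02C; have -> : M (t0 w) = M w by rewrite -[in RHS]M_sig /sig ow.
    have -> : t2 (t0 w) = sig (t2 w) by rewrite /sig t02C !phi2 ow.
    by rewrite M_sig !addbb.
  have -> : t2 w = sig w by rewrite /sig ow.
  have -> : t0 (sig w) = sig (t0 w).
    by rewrite /sig ow t0K [outer (phi (t0 w)) && _]andbC ow t02C.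
  by rewrite !M_sig.
- by move=> w; rewrite !inE f1.
- by move=> w; rewrite !inE f0.
- move=> w; rewrite !inE => fw mw wy wty; rewrite f2 fw addTb.
  case ow: (outer (phi w) && outer (phi (t0 w))).
    have e1 : M (t0 w) = M w by rewrite -[in RHS]M_sig /sig ow.
    by rewrite e1 addbb in mw.
  wlog Mw : w fw mw wy wty ow / M w.
    move=> th; case Mw: (M w); first exact: th.
    rewrite Mw /= in mw.
    rewrite -(walk_parity0 mg); apply: th; rewrite ?f0 ?t0K ?mw ?Mw //.
    + by rewrite -(inj_eq (inv_inj t0K)) t0K.
    + by rewrite (inj_eq (inv_inj t0K)).
    + by rewrite andbC.
  have o1 := M_outer Mw; have o2 : ~~ outer (phi (t0 w)) by move: ow; rewrite o1 /= => ->.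
  rewrite Z // dx // addbF; apply/negP => /dx0 ew.
  have : w = y \/ w = t2 y.
    by case: ew => ->; case: y2 => ->; rewrite ?t2K; by [left|right].
  case=> ewy; first by rewrite ewy eqxx in wy.
  by rewrite ewy (negbTE fy2) in fw.
- by rewrite inE.
- by rewrite inE.
Qed.

(** By [single_orbit] and [O_sig] the orbit of [x0] contains exactly one of the two flags of an exit
    at its outer end. Its index on the orbit is the cyclic position. *)
Let rep u c := odflt x0 [pick w | O w && dart u c w].
Let pos u c := findex rho x0 (rep u c).

Let repP u c : exits e' C u c -> O (rep u c) /\ dart u c (rep u c).
Proof.
move=> exu; rewrite /rep; case: pickP => [w /andP[]//|no].
have [x xE] := exit_flag exu; have [sx _] := sig_exit exu xE.
case/orP: (single_orbit exu xE) => Ox.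
  by move: (no x); rewrite Ox xE.
by move: (no (sig x)); rewrite Ox sx (dart2 mg) xE.
Qed.

Let O_dart u c w w' : exits e' C u c -> O w -> O w' -> dart u c w -> dart u c w' -> w = w'.
Proof.
move=> exu Ow Ow' wE w'E; have [/eqP eu /eqP ec] := andP w'E.
move: wE; rewrite -eu -ec (dartE eI mg) !inE => /orP[] /eqP // ew.
have [sx _] := sig_exit exu w'E.
by move: (O_sig Ow'); rewrite sx -ew Ow.
Qed.

Let iter_rep u c : exits e' C u c -> iter (pos u c) rho x0 = rep u c.
Proof. by case/repP => Or _; rewrite /pos iter_findex. Qed.

(** Let [f] be bounded by the closed walk. Along the orbit [f] changes exactly at the two crossed
    exits, so at an exit it is determined by [side]. At a vertex off the walk [f] has a single
    value, and this value is preserved along edges that avoid the walk; hence a path off [D] cannot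
    change sides. *)
Lemma bond_order : exists pos : V -> V -> nat,
  [/\ pos u0 c0 = 0,
      forall u c u' c', exits e' C u c -> exits e' C u' c' -> pos u c = pos u' c' ->
        u = u' /\ c = c'
    & forall u1 c1 u2 c2 pc pu, exits e' C u1 c1 -> exits e' C u2 c2 ->
        path e' c1 pc -> last c1 pc = c2 -> {subset pc <= C} ->
        path e' u2 pu -> last u2 pu = u1 -> {subset pu <= ~: C} ->
        let D := [set v in u1 :: c1 :: pc ++ u2 :: pu] in
        let side u c := (pos u1 c1 < pos u c) (+) (pos u2 c2 < pos u c) in
        forall u3 c3 u4 c4 x y, exits e' C u3 c3 -> exits e' C u4 c4 ->
          side u3 c3 != side u4 c4 -> x \in [:: u3; c3] -> y \in [:: u4; c4] ->
          x \notin D -> y \notin D -> ~~ connect (restr e' (~: D)) x y].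
Proof.
exists pos; split.
- have [Or rE] := repP ex0.
  have Ox0 : O x0 by rewrite /O connect0.
  by apply/eqP; rewrite /pos (O_dart ex0 Or Ox0 rE x0E) findex_eq0.
- move=> u c u' c' exu exu' epos.
  have := iter_rep exu; rewrite epos iter_rep // => er.
  have [_ /andP[/eqP e1 /eqP e2]] := repP exu.
  by have [_ /andP[/eqP e3 /eqP e4]] := repP exu'; split; [rewrite -e3 er e1|rewrite -e4 er e2].
move=> u1 c1 u2 c2 pc pu ex1 ex2 pc1 el1 pcC pu2 el2 puC D side u3 c3 u4 c4 x y ex3 ex4.
move=> side34 xE yE xD yD.
have [lp1 lp2 lpS] := loop_path ex1 ex2 pc1 el1 pu2 el2.
have puS : {subset pu <= ~: S}.
  by move=> z zp; apply: lpS; rewrite !(inE, mem_cat) zp !orbT.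
have [f [f0 f1 f2]] := bound lp1 lp2 lpS.
have f_rho w : outer (phi w) -> f (rho w) = f w (+) (dart u1 c1 w (+) dart u2 c2 w).
  move=> ow; rewrite /rho /= f1 /sig ow /=; case: ifPn => ow0.
    have nd u c : exits e' C u c -> dart u c w = false.
      case/and3P=> _ cC _; apply/negP => /andP[_ /eqP ec].
      by move: ow0; rewrite /outer ec cC.
    by rewrite f0 (nd u1 c1) // (nd u2 c2) // !addbF.
  by rewrite f2 (loop_parity (u1 := u1) (c1 := c1) (u2 := u2) (c2 := c2)) //.
(* The inequalities are strict because [f] changes on leaving a crossed exit: the exit itself still
   has the old value. *)
have f_iter i : i < order rho x0 ->
    f (iter i rho x0) = f x0 (+) ((pos u1 c1 < i) (+) (pos u2 c2 < i)).
  elim: i => [|i IHi] lti; first by rewrite /= !ltn0 addbF.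
  have lti' := ltnW lti.
  have Oi : O (iter i rho x0) by apply: fconnect_iter.
  rewrite iterS f_rho ?O_outer // IHi // -addbA; congr (_ (+) _).
  have dpos u c : exits e' C u c -> dart u c (iter i rho x0) = (pos u c == i).
    move=> exu; have [Or rE] := repP exu; apply/idP/eqP => [dE|<-]; last by rewrite iter_rep.
    by rewrite /pos (O_dart exu Or Oi rE dE) findex_iter.
  rewrite !dpos // addbACA.
  have h a : (a < i) (+) (a == i) = (a < i.+1) by rewrite ltnS; case: ltngtP.
  by rewrite !h.
have f_rep u c : exits e' C u c -> f (rep u c) = f x0 (+) side u c.
  by move=> exu; rewrite -iter_rep // f_iter //; apply: findex_max; case: (repP exu).
pose at_v v b := forall w, phi w = v -> f w = b.
have at_phi w : phi w \notin D -> at_v (phi w) (f w).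
  move=> wD w' /esym/eqP; rewrite (phiE mg) => /connectP[p].
  elim: p w wD => [|z p IHp] w wD /=; first by move=> _ ->.
  case/andP=> /orP[] /eqP-> pp el.
    by rewrite (IHp (t1 w)) ?f1 ?phi1.
  rewrite (IHp (t2 w)) ?phi2 // f2 walk_parity_out ?addbF //.
  by move: wD; rewrite inE => ->.
have at_exit u c v : exits e' C u c -> v \in [:: u; c] -> v \notin D -> at_v v (f x0 (+) side u c).
  move=> exu + vD; rewrite -f_rep //; have [_ /andP[/eqP eu /eqP ec]] := repP exu.
  rewrite !inE => /orP[] /eqP ev; move: vD; rewrite ev; first by rewrite -{1 2}eu; apply: at_phi.
  by rewrite -{1 2}ec -f0; apply: at_phi.
have at3 := at_exit _ _ _ ex3 xE xD; have at4 := at_exit _ _ _ ex4 yE yD.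
have at_connect v w b : at_v v b -> connect (restr e' (~: D)) v w -> at_v w b.
  move=> + /connectP[p]; elim: p v => [|z p IHp] v av /=; first by move=> _ ->.
  case/andP=> /and3P[vD zD /e'S[_ _ /(flag_of_edge mg)[q [qv qz]]]] pp el.
  apply: IHp pp el; rewrite -qz -(av q qv) -f0; apply: at_phi.
  by rewrite qz -in_setC.
apply/negP => /(at_connect _ _ _ at3) at4'.
have [w wE] : exists w, phi w = y.
  move: yE; rewrite !inE => /orP[] /eqP->; have [_ /andP[/eqP eu /eqP ec]] := repP ex4.
    by exists (rep u4 c4).
  by exists (t0 (rep u4 c4)).
move: (at4 w wE) (at4' w wE) => -> /addbI h.
by rewrite h eqxx in side34.
Qed.
End Anchor.
End Bond.

Lemma arc_separation_flags (V : finType) (e : rel V) (F : finType) (t0 t1 t2 : F -> F)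
    (phi : F -> V) (S : {set V}) :
  symmetric e -> irreflexive e -> map_of_graph e t0 t1 t2 phi ->
  (forall psi : F -> bool, (forall x, psi (t1 x) = psi x) ->
    (forall x, cobd t0 psi (t2 x) = cobd t0 psi x) ->
    (forall x, phi x \in S -> phi (t0 x) \in S -> cobd t0 psi x = false) ->
    exists ph : V -> bool, forall x, cobd t0 psi x = ph (phi x) (+) ph (phi (t0 x))) ->
  arc_separation (restr e (~: S)).
Proof.
move=> eS eI mg SP C u0 c0 Cc ex0 Uc.
have bound := closed_walk_bounds eS eI mg SP.
have [x0 x0E] := bond_anchor mg ex0.
exact: (bond_order eS eI mg bound Cc ex0 Uc x0E).
Qed.

(** * Strong reachability *)

Section Good.
Variables (V : finType) (e : rel V).
Hypothesis eS : symmetric e.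
Variables (s N : nat).

(** [L] is increasing and [L'] is what lies above [v]. Targets need only be outside [L']: all
    vertices outside [L] are counted as if they came first, which allows orders to be built piece by
    piece. *)
Fixpoint back_bounded (L : seq V) :=
  if L is v :: L' then (#|reached e [set w in L'] s v| <= N) && back_bounded L' else true.

Definition orderable (C : {set V}) := exists L : seq V, [/\ uniq L, L =i C & back_bounded L].

(** The interior of a walk that starts in [C] and runs through [Z] never leaves [C], so only the
    part of [Z] in [C] matters. *)
Lemma reached_local (Z Z' C : {set V}) v w : v \in C -> Z' \subset Z -> Z :&: C \subset Z' ->
  (forall c z, c \in C -> z \in Z -> e c z -> z \in C) ->
  w \in reached e Z s v -> w \in reached e Z' s v.
Proof.
move=> vC /subsetP Z'Z /subsetP ZZ' clC; rewrite !inE => /andP[wZ /reachP h].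
rewrite (contra (Z'Z w) wZ) /=.
apply/reachP; case: h => [->|[q [pq qZ sq]]]; [by left|right; exists q; split=> //].
elim: q v vC {sq} pq qZ => //= z q IHq v vC /andP[vz pq] qZ u.
have zZ : z \in Z by apply: qZ; rewrite inE eqxx.
have zC := clC _ _ vC zZ vz.
rewrite inE => /predU1P[->|]; first by apply: ZZ'; rewrite inE zZ.
by apply: (IHq z) => // a aq; apply: qZ; rewrite inE aq orbT.
Qed.

Lemma back_bounded_cat L1 L2 : (forall x y, x \in L1 -> y \in L2 -> ~~ e x y) ->
  uniq (L1 ++ L2) -> back_bounded L1 -> back_bounded L2 -> back_bounded (L1 ++ L2).
Proof.
elim: L1 => //= v L1 IHL sep /andP[nvL uL] /andP[okv ok1] ok2.
rewrite IHL ?andbT // => [|x y xL yL]; last by apply: sep => //; rewrite inE xL orbT.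
apply: leq_trans okv; apply/subset_leq_card/subsetP => w.
apply: (@reached_local _ _ [set z in v :: L1]); first by rewrite !inE eqxx.
- by apply/subsetP => z; rewrite !inE mem_cat => ->.
- apply/subsetP => z; rewrite !inE => /andP[zL /predU1P[zv|//]].
  by rewrite zv (negbTE nvL) in zL.
move=> c z; rewrite inE => cL; rewrite inE mem_cat => /orP[zL _|zL cz].
  by rewrite !inE zL orbT.
by move: (sep _ _ cL zL); rewrite cz.
Qed.

Lemma orderable_components (D : {set V}) : (forall C, component e D C -> orderable C) -> orderable D.
Proof.
have [n] := ubnP #|D|; elim: n D => // n IHn D ltD gD.
have [->|[x xD]] := set_0Vmem D.
  by exists [::]; split=> // z; rewrite !inE.
have [C Cc xC] := component_exists eS xD; have [_ /subsetP CD _ clC] := Cc.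
have [|C' [C'0 C'D C'c clC']|L2 [u2 m2 ok2]] := IHn (D :\: C).
- suff : #|D :\: C| < #|D| by move: ltD; lia.
  by apply: proper_card; apply/properP; split; [apply: subsetDl|exists x; rewrite ?inE ?xC].
- apply: gD; split=> // [|c y cC' yD cy]; first by apply: subset_trans C'D (subsetDl _ _).
  apply: (clC' c) => //; rewrite inE yD andbT; apply/negP => yC.
  have /setDP[cD] := subsetP C'D _ cC'.
  by move=> /negP; apply; apply: (clC y c) => //; rewrite eS.
have [L1 [u1 m1 ok1]] := gD C Cc.
have d12 x' : x' \in L1 -> x' \notin L2 by rewrite m1 m2 inE => ->.
have u12 : uniq (L1 ++ L2).
  rewrite cat_uniq u1 u2 andbT /=; apply/hasPn => z z2; apply/negP => /d12.
  by rewrite z2.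
exists (L1 ++ L2); split=> // [z|].
  rewrite mem_cat m1 m2 in_setD; case: (boolP (z \in C)) => //= zC.
  by rewrite CD.
apply: back_bounded_cat => // a b; rewrite m1 m2 inE => aC /andP[bC bD].
by apply/negP => /(clC _ _ aC bD); rewrite (negbTE bC).
Qed.

Lemma orderable_step (P : seq V) (C : {set V}) : uniq P -> {subset P <= C} ->
  (forall P1 v P2, P = P1 ++ v :: P2 ->
     #|reached e ([set w in P2] :|: (C :\: [set w in P])) s v| <= N) ->
  (forall C', component e (C :\: [set w in P]) C' -> orderable C') -> orderable C.
Proof.
move=> uP PC okP /orderable_components[L [uL mL okL]].
exists (P ++ L); split=> [|z|].
- rewrite cat_uniq uP uL andbT; apply/hasPn => z.
  by rewrite mL !inE => /andP[].
- rewrite mem_cat mL !inE; case: (boolP (z \in P)) => //= zP.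
  by rewrite PC.
have : forall P2, (exists P1, P = P1 ++ P2) -> back_bounded (P2 ++ L).
  elim=> //= v P2 IHP [P1 eP]; apply/andP; split; last first.
    by apply: IHP; exists (rcons P1 v); rewrite cat_rcons.
  have := okP _ _ _ eP; congr (#|reached _ _ _ _| <= _).
  by apply/setP => z; rewrite !inE mem_cat mL !inE.
by apply; exists [::].
Qed.
End Good.

(** * Geodesics and the balls that meet them *)

Section Geod.
Variables (V : finType) (e : rel V).
Hypothesis eS : symmetric e.

(** [A] need not lie in [C]: only detours whose interior is in [C] are compared with the positions
    on [A], so the property passes to smaller regions. *)
Definition geodesic (A : seq V) (C : {set V}) := forall x y q,
  x \in A -> y \in A -> path e x (rcons q y) -> {subset q <= C} ->
  index y A <= index x A + (size q).+1.

(** No route through [C] of length at most [2s] equals the stretch of [A] that it bypasses. A walk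
    of length [2s] through the centre of a ball is what would join the extreme positions of a window
    of [2s+1]. *)
Definition tight (s : nat) (A : seq V) (C : {set V}) := forall x y q,
  x \in A -> y \in A -> path e x (rcons q y) -> {subset q <= C} ->
  0 < size q -> (size q).+1 <= 2 * s -> index y A != index x A + (size q).+1.

Definition seg (A : seq V) i j := take (j - i).+1 (drop i A).

Lemma geodesicS A (C C' : {set V}) : C' \subset C -> geodesic A C -> geodesic A C'.
Proof.
by move=> /subsetP CC gA x y q xA yA pq qC; apply: gA => // z /qC/CC.
Qed.

Lemma tightS s A (C C' : {set V}) : C' \subset C -> tight s A C -> tight s A C'.
Proof.
by move=> /subsetP CC gA x y q xA yA pq qC; apply: gA => // z /qC/CC.
Qed.

Lemma geodesic1 x C : geodesic [:: x] C.
Proof. by move=> y z q; rewrite !inE => /eqP-> /eqP->; rewrite /= eqxx. Qed.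

Lemma tight1 s x C : tight s [:: x] C.
Proof. by move=> y z q; rewrite !inE => /eqP-> /eqP->; rewrite /= eqxx. Qed.

Section Seg.
Variables (A : seq V) (i j : nat).
Hypothesis (uA : uniq A) (ij : i <= j) (jA : j < size A).

Lemma size_seg : size (seg A i j) = (j - i).+1.
Proof. by rewrite size_take size_drop; case: ltnP; lia. Qed.

Lemma uniq_seg : uniq (seg A i j).
Proof. by rewrite take_uniq // drop_uniq. Qed.

Lemma sorted_seg : sorted e A -> sorted e (seg A i j).
Proof. by move=> sA; rewrite take_sorted // drop_sorted. Qed.

Lemma mem_seg z : (z \in seg A i j) = (z \in A) && (i <= index z A <= j).
Proof.
apply/idP/andP => [zS|[zA /andP[iz zj]]].
  have /(nthP z)[k] := zS; rewrite size_seg => kl.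
  rewrite nth_take ?nth_drop // => ez.
  have kA : i + k < size A by lia.
  by rewrite -ez mem_nth // index_uniq //; split=> //; lia.
rewrite -(nth_index z zA) -(subnKC iz) -nth_drop -(@nth_take (j - i).+1); last lia.
by apply: mem_nth; rewrite -/(seg _ _ _) size_seg; lia.
Qed.

Lemma index_seg z : z \in seg A i j -> index z (seg A i j) = index z A - i.
Proof.
move=> zS; have := zS; rewrite mem_seg => /andP[zA /andP[iz zj]].
rewrite -{1}(nth_index z zA) -{1}(subnKC iz) -nth_drop -(@nth_take (j - i).+1); last lia.
by rewrite index_uniq ?uniq_seg // -/(seg _ _ _) size_seg; lia.
Qed.

Lemma geodesic_seg C : geodesic A C -> geodesic (seg A i j) C.
Proof.
move=> gA x y q xS yS pq qC; rewrite !index_seg //.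
move: xS yS; rewrite !mem_seg => /andP[xA /andP[ix _]] /andP[yA /andP[iy _]].
by have := gA _ _ _ xA yA pq qC; lia.
Qed.

Lemma tight_seg s C : tight s A C -> tight s (seg A i j) C.
Proof.
move=> gA x y q xS yS pq qC s1 s2; rewrite !index_seg //.
move: xS yS; rewrite !mem_seg => /andP[xA /andP[ix _]] /andP[yA /andP[iy _]].
by have := gA _ _ _ xA yA pq qC s1 s2; lia.
Qed.
End Seg.

Lemma card_inj_interval (f : V -> nat) (B : {set V}) lo m : {in B &, injective f} ->
  (forall w, w \in B -> lo <= f w < lo + m) -> #|B| <= m.
Proof.
move=> fI Blo; rewrite -(size_iota lo m) cardE -(size_map f).
apply: uniq_leq_size => [|k /mapP[w]]; last by rewrite mem_enum mem_iota => /Blo wl ->.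
by rewrite map_inj_in_uniq ?enum_uniq // => x y; rewrite !mem_enum => xB yB; apply: fI.
Qed.

Lemma card_inj_window (f : V -> nat) (B : {set V}) m : {in B &, injective f} ->
  (forall w w', w \in B -> w' \in B -> f w' < f w + m) -> #|B| <= m.
Proof.
move=> fI Bm; have [->|[w0 w0B]] := set_0Vmem B; first by rewrite cards0.
case: (arg_minnP f w0B) => w wB wmin.
by apply: (card_inj_interval (lo := f w) fI) => // w' w'B; rewrite wmin // Bm.
Qed.

Lemma card_interval (A : seq V) (B : {set V}) lo m : {subset B <= A} ->
  (forall w, w \in B -> lo <= index w A < lo + m) -> #|B| <= m.
Proof.
move=> BA; apply: (@card_inj_interval (index^~ A)) => x y xB yB.
by apply: (index_inj x); apply: BA.
Qed.

Lemma card_window (A : seq V) (B : {set V}) m : {subset B <= A} ->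
  (forall w w', w \in B -> w' \in B -> index w' A < index w A + m) -> #|B| <= m.
Proof.
move=> BA; apply: (@card_inj_window (index^~ A)) => x y xB yB.
by apply: (index_inj x); apply: BA.
Qed.

(** Two vertices of [A] in the ball are joined through [v] by a walk in [C] of length at most [2s].
    So their positions differ by at most [2s], and by less if [A] is tight. *)
Lemma reach_window s (A : seq V) (C Z : {set V}) v : Z \subset C -> v \in C ->
  {subset A <= ~: C} -> geodesic A C ->
  #|[set w in A | reach e Z s v w]| <= 2 * s + 1 /\
  (tight s A C -> #|[set w in A | reach e Z s v w]| <= 2 * s).
Proof.
move=> /subsetP ZC vC AC gA.
have key w : w \in [set w in A | reach e Z s v w] ->
    exists q, [/\ w \in A, path e v (rcons q w), {subset q <= C} & size q < s].
  rewrite inE => /andP[wA /reachP[vw|[q [pq qZ sq]]]].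
    by have := AC _ wA; rewrite inE -vw vC.
  by exists q; split=> // z /qZ/ZC.
have join w w' q q' : path e v (rcons q w) -> path e v (rcons q' w') ->
    {subset q <= C} -> {subset q' <= C} ->
    path e w (rcons (rev q ++ v :: q') w') /\ {subset rev q ++ v :: q' <= C}.
  move=> pq pq' qC qC'; split; last first.
    by move=> z; rewrite mem_cat mem_rev inE => /or3P[/qC|/eqP->|/qC'].
  by rewrite rcons_cat -cat_rcons cat_path rev_walk //= last_rcons.
split=> [|tA]; apply: (@card_window A); try by move=> w; rewrite inE => /andP[].
  move=> w w' /key[q [wA pq qC sq]] /key[q' [w'A pq' qC' sq']].
  have [pp sub] := join _ _ _ _ pq pq' qC qC'.
  by have := gA _ _ _ wA w'A pp sub; rewrite size_cat size_rev /=; lia.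
move=> w w' /key[q [wA pq qC sq]] /key[q' [w'A pq' qC' sq']].
have [pp sub] := join _ _ _ _ pq pq' qC qC'.
have := gA _ _ _ wA w'A pp sub; have := tA _ _ _ wA w'A pp sub.
by rewrite size_cat size_rev /= addnS => /(_ isT); lia.
Qed.

Lemma walk_split x (q : seq V) z : path e x q -> z \in x :: q ->
  let i := index z (x :: q) in
  [/\ path e x (take i q), last x (take i q) = z, size (take i q) = i,
      path e z (drop i q) & last z (drop i q) = last x q].
Proof.
move=> pq zq i; have iq : i <= size q by rewrite -ltnS -index_mem in zq *.
have el : last x (take i q) = z.
  rewrite (last_nth x) size_takel //.
  by rewrite -[x :: take i q]/(take i.+1 (x :: q)) nth_take // nth_index.
move: pq; rewrite -{1}(cat_take_drop i q) cat_path el => /andP[p1 p2].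
split=> //; first by rewrite size_takel.
by rewrite -[in RHS](cat_take_drop i q) last_cat el.
Qed.

Lemma geodesic_exists (C : {set V}) x y : x \in C -> connect (restr e C) x y ->
  exists q, [/\ path e x q, last x q = y, {subset x :: q <= C}, uniq (x :: q)
              & geodesic (x :: q) C].
Proof.
move=> xC /(connect_restrP e y xC)[q0 [pq0 lq0 q0C]].
pose ok n := [exists q : n.-tuple V, [&& path e x q, last x q == y & all (mem C) q]].
have okq q : path e x q -> last x q = y -> {subset q <= C} -> ok (size q).
  move=> pq lq qC; apply/existsP; exists (in_tuple q); rewrite pq lq eqxx /=.
  exact/allP.
have exn : exists n, ok n by exists (size q0); apply: okq.
case: (ex_minnP exn) => n /existsP[[q /= /eqP sq] /and3P[pq /eqP lq /allP qC]] nmin.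
subst n; have qC' : {subset x :: q <= C}.
  by move=> z; rewrite inE => /predU1P[->//|/qC].
exists q; split=> // [|a b p aA bA pp pC].
  case: (shortenP pq) (nmin) lq => q' pq' uq' sub min' lq'.
  have sz := min' _ (okq _ pq' lq' (fun z zq => qC _ (sub z zq))).
  have sub1 : {subset x :: q' <= x :: q}.
    by move=> z; rewrite !inE => /predU1P[->|/sub->]; rewrite ?eqxx ?orbT.
  exact: (leq_size_uniq uq' sub1 sz).
have [p1 l1 s1 _ _] := walk_split pq aA.
have [_ _ s2 p2 l2] := walk_split pq bA.
set i := index a _ in p1 l1 s1 *; set j := index b _ in s2 p2 l2 *.
have pn : path e x (take i q ++ rcons p b ++ drop j q).
  by rewrite cat_path p1 l1 cat_path pp last_rcons.
have ln : last x (take i q ++ rcons p b ++ drop j q) = y.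
  by rewrite !last_cat last_rcons l2.
have sn : {subset take i q ++ rcons p b ++ drop j q <= C}.
  move=> z; rewrite !mem_cat mem_rcons inE.
  case/or3P => [/mem_take/qC//|/predU1P[->|/pC//]|/mem_drop/qC//].
  exact: qC'.
have := nmin _ (okq _ pn ln sn); rewrite !size_cat s1 size_rcons size_drop.
have : j <= size q by rewrite -s2 size_take; case: ifP => // /ltnW.
by move: (size q) (size p) => a1 a2; clearbody i j; lia.
Qed.
End Geod.

(** * Regions attached to two geodesics *)

Section Region.
Variables (V : finType) (e : rel V).
Hypothesis eS : symmetric e.

Definition isend (A : seq V) x :=
  (x \in A) && ((index x A == 0) || (index x A == (size A).-1)).

(** The connection avoids the rest of [A], so deleting a segment of [A] that does not contain [x]
    leaves [x] joined to [B]. *)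
Definition end_linked (C : {set V}) (A B : seq V) x := exists2 b, b \in B &
  connect (restr e [set z | (z \notin C) && ((z \notin A) || (z == x))]) x b.

(* regAe and regBe close A and B up to a cycle around C; this makes the exits of C at A
   appear in the order of A. *)
Record region (C : {set V}) (A B : seq V) : Prop := Region {
  regC : connected e C;
  regN : forall u c, exits e C u c -> (u \in A) || (u \in B);
  regAu : uniq A; regAs : sorted e A; regBu : uniq B; regBs : sorted e B;
  regAC : forall x, x \in A -> x \notin C;
  regBC : forall x, x \in B -> x \notin C;
  regAB : forall x, x \in A -> x \notin B;
  regAg : geodesic e A C; regBg : geodesic e B C;
  regAe : forall x, isend A x -> end_linked C A B x;
  regBe : forall x, isend B x -> end_linked C B A x }.

Lemma region_sym C A B : region C A B -> region C B A.
Proof.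
move=> R; case: (R) => *; split=> // [u c /(regN R)|x xB]; first by rewrite orbC.
by apply/negP => /(regAB R); rewrite xB.
Qed.

Lemma exits_in C u c : exits e C u c -> [/\ u \notin C, c \in C & e u c].
Proof. by case/and3P. Qed.

Lemma exit_mem C u c : exits e C u c -> c \in C.
Proof. by case/and3P. Qed.

Lemma geodesic_between (C : {set V}) c1 c2 : connected e C -> c1 \in C -> c2 \in C ->
  exists P : seq V, [/\ c1 \in P, c2 \in P, uniq P, sorted e P & {subset P <= C}] /\
  [/\ geodesic e P C & forall x, isend P x -> x = c1 \/ x = c2].
Proof.
move=> Cc c1C c2C.
have [q [pq lq qC uq gq]] := geodesic_exists c1C (Cc _ _ c1C c2C).
exists (c1 :: q); split; split=> //; rewrite ?mem_head -?lq ?mem_last //.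
move=> x /andP[xq /orP[]] /eqP xi; [left|right].
  by apply: (index_inj x xq); rewrite ?mem_head //= eqxx.
by apply: (index_inj x xq); rewrite ?mem_last // index_last.
Qed.

Lemma isend_head x A : x \in A -> exists2 y, isend A y & index y A = 0.
Proof.
case: A => // y A _; exists y => //=; last by rewrite eqxx.
by rewrite /isend inE eqxx /= eqxx.
Qed.

Lemma isend_last x A : uniq A -> x \in A -> exists2 y, isend A y & index y A = (size A).-1.
Proof.
case: A => // y A uA _; have il : index (last y A) (y :: A) = size A.
  by rewrite index_last.
by exists (last y A); rewrite /isend ?mem_last il //= eqxx orbT.
Qed.

Lemma sorted_seg_connect A (W : {set V}) x y : uniq A -> sorted e A -> x \in A -> y \in A ->
  index x A <= index y A ->
  (forall z, z \in A -> index x A <= index z A <= index y A -> z \in W) ->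
  connect (restr e W) x y.
Proof.
move=> uA sA xA yA xy sub.
have jA : index y A < size A by rewrite index_mem.
have := sorted_connected eS (sorted_seg (index x A) (index y A) sA).
move=> /(_ x y); rewrite !inE !mem_seg // xA yA xy !leqnn => /(_ isT isT).
apply: connect_restrS => z; rewrite inE mem_seg // => /andP[zA]; exact: sub.
Qed.

Lemma sorted_connect A (W : {set V}) x y : sorted e A -> x \in A -> y \in A ->
  {subset A <= W} -> connect (restr e W) x y.
Proof.
move=> sA xA yA AW; have := sorted_connected eS sA => /(_ x y).
rewrite !inE => /(_ xA yA); apply: connect_restrS => z; rewrite inE; exact: AW.
Qed.

(** A vertex of [B] off the deleted segment follows [B] to the end on its own side of the segment,
    and [regBe] leads from there to [A]. *)
Lemma outside_connected C A B lo hi y a : region C A B -> a \in A ->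
  (y \in A) || ((y \in B) && ((index y B < lo) || (hi < index y B))) ->
  connect (restr e [set z | (z \notin C) && ~~ ((z \in B) && (lo <= index z B <= hi))]) y a.
Proof.
set W := [set z | _] => R aA.
have AW : {subset A <= W}.
  by move=> z zA; rewrite inE (regAC R zA) (negbTE (regAB R zA)).
case/orP=> [yA|/andP[yB /orP ylh]]; first exact: sorted_connect (regAs R) yA aA AW.
have endW x : isend B x -> ~~ (lo <= index x B <= hi) -> connect (restr e W) x a.
  move=> xe xlh; have [b bA xb] := regBe R xe.
  apply: connect_trans (sorted_connect (regAs R) bA aA AW).
  apply: connect_restrS xb => z; rewrite !inE => /andP[-> /=].
  by case/orP=> [/negbTE->//|/eqP->]; rewrite (negbTE xlh) andbF.
have BW z : z \in B -> ~~ (lo <= index z B <= hi) -> z \in W.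
  by move=> zB zlh; rewrite inE (regBC R zB) zB.
case: ylh => ylh.
  have [x xe x0] := isend_head yB; have /andP[xB _] := xe.
  apply: connect_trans (endW _ xe _); last by rewrite x0; lia.
  rewrite restr_csym //; apply: (sorted_seg_connect (regBu R) (regBs R)) => // [|z zB zx].
    by rewrite x0.
  by apply: BW => //; lia.
have [x xe x0] := isend_last (regBu R) yB; have /andP[xB _] := xe.
have yx : index y B <= index x B.
  by rewrite x0; move: yB; rewrite -index_mem; lia.
apply: connect_trans (endW _ xe _); last by lia.
apply: (sorted_seg_connect (regBu R) (regBs R)) => // z zB zx.
by apply: BW => //; lia.
Qed.

Lemma region_connected C A B x y : region C A B -> (x \in A) || (x \in B) ->
  (y \in A) || (y \in B) -> connect (restr e (~: C)) x y.
Proof.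
move=> R; have sub : {subset A <= ~: C} by move=> z /(regAC R); rewrite inE.
have key z a : a \in A -> (z \in A) || (z \in B) -> connect (restr e (~: C)) z a.
  (* As [hi = 0 < lo], the deleted segment is empty; [lo] exceeds the position of [z] to meet the
     side condition. *)
  move=> aA zAB; apply: connect_restrS (outside_connected (lo := (index z B).+1) (hi := 0) R aA _).
    by move=> w; rewrite !inE => /andP[].
  by case/orP: zAB => -> //=; rewrite ltnSn orbT.
have exA z : (z \in A) || (z \in B) -> exists a, a \in A.
  case/orP=> [|zB]; first by exists z.
  by have [w we _] := isend_head zB; have [a aA _] := regBe R we; exists a.
move=> xAB yAB; have [a aA] := exA x xAB.
apply: connect_trans (key x a aA xAB) _; rewrite restr_csym //; exact: key.
Qed.

Section Cut.
Variables (C : {set V}) (A B P : seq V) (u1 c1 u2 c2 : V) (C' : {set V}).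
Hypothesis (R : region C A B).
Hypothesis (ex1 : exits e C u1 c1) (ex2 : exits e C u2 c2).
Hypothesis (u1A : u1 \in A) (u2A : u2 \in A).
Hypothesis (uP : uniq P) (sP : sorted e P) (PC : {subset P <= C}) (gP : geodesic e P C).
Hypothesis (c1P : c1 \in P) (c2P : c2 \in P).
Hypothesis (endP : forall x, isend P x -> x = c1 \/ x = c2).
Hypothesis (Cc : component e (C :\: [set z in P]) C').

Let C'C x : x \in C' -> (x \in C) && (x \notin P).
Proof.
by case: Cc => _ /subsetP sub _ _ /sub; rewrite !inE andbC.
Qed.
Let C'sC : C' \subset C. Proof. by apply/subsetP => x /C'C /andP[]. Qed.
Let PC' x : x \in P -> x \notin C'. Proof. by move=> xP; apply/negP => /C'C; rewrite xP andbF. Qed.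
Let CC' x : x \notin C -> x \notin C'. Proof. by apply: contra => /C'C /andP[]. Qed.

(** The edges [u1 c1] and [u2 c2] join the ends of the segment to the ends of [P], which closes the
    new cycle. *)
Lemma region_between : index u1 A <= index u2 A ->
  (forall u c, exits e C' u c -> (u \in seg A (index u1 A) (index u2 A)) || (u \in P)) ->
  region C' (seg A (index u1 A) (index u2 A)) P.
Proof.
move=> u12 N; have u2s : index u2 A < size A by rewrite index_mem.
have uA := regAu R; have memA := mem_seg uA u12 u2s.
have [u1C c1C uc1] := exits_in ex1; have [u2C c2C uc2] := exits_in ex2.
have AC x : x \in seg A (index u1 A) (index u2 A) -> x \notin C.
  by rewrite memA => /andP[xA _]; apply: (regAC R).
have link u c x : (x = u \/ x = c) -> u \in seg A (index u1 A) (index u2 A) -> u \notin C ->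
   c \in P -> e u c ->
   (x = u -> end_linked C' (seg A (index u1 A) (index u2 A)) P x) /\
   (x = c -> end_linked C' P (seg A (index u1 A) (index u2 A)) x).
  move=> _ uS uC cP uc; split=> ->.
    exists c => //; apply: connect_restr1 => //; first by rewrite inE eqxx orbT CC'.
    by rewrite inE PC' //= (contraL (@AC c)) ?PC.
  exists u => //; apply: connect_restr1; last by rewrite eS.
    by rewrite inE eqxx orbT PC'.
  by rewrite inE CC' //= (contra (@PC u) uC).
have u1S : u1 \in seg A (index u1 A) (index u2 A) by rewrite memA u1A leqnn.
have u2S : u2 \in seg A (index u1 A) (index u2 A) by rewrite memA u2A leqnn andbT.
split=> //.
- by case: Cc.
- exact: uniq_seg.
- exact: sorted_seg (regAs R).
- by move=> x /AC/CC'.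
- by move=> x xS; apply/negP => /PC; apply/negP/AC.
- apply: geodesic_seg => //; exact: geodesicS (regAg R).
- exact: geodesicS gP.
- move=> x /andP[xS]; rewrite index_seg // size_seg //.
  have := xS; rewrite memA => /andP[xA xi] /orP xe.
  have [ex|ex] : x = u1 \/ x = u2.
    move: xe xi u12 => xe xi u12; case: xe => /eqP xe; [left|right].
      by apply: (index_inj x xA u1A); rewrite /=; clear -xe xi u12; lia.
    by apply: (index_inj x xA u2A); rewrite /=; clear -xe xi u12; lia.
  + by case: (link _ _ _ (or_introl ex) u1S u1C c1P uc1) => h _; apply: h.
  + by case: (link _ _ _ (or_introl ex) u2S u2C c2P uc2) => h _; apply: h.
move=> x /endP[] ex.
+ by case: (link _ _ _ (or_intror ex) u1S u1C c1P uc1) => _ h; apply: h.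
+ by case: (link _ _ _ (or_intror ex) u2S u2C c2P uc2) => _ h; apply: h.
Qed.

(** [A] is no longer a parent but still lies outside [C'], and it links the ends of [P] to [B] and
    those of [B] to [P]. *)
Lemma region_beyond : (forall u c, exits e C' u c -> (u \in P) || (u \in B)) ->
  region C' P B.
Proof.
move=> N.
have [u1C c1C uc1] := exits_in ex1; have [u2C c2C uc2] := exits_in ex2.
have linkP u c : u \in A -> e u c -> c \in P -> end_linked C' P B c.
  move=> uA uc cP; have [w we _] := isend_head uA; have [b bB _] := regAe R we.
  exists b => //; apply: (@connect_trans _ _ u); last first.
    apply: connect_restrS (region_connected R _ _); rewrite ?uA ?bB ?orbT //.
    by move=> z; rewrite !inE => zC; rewrite CC' //= (contra (@PC z) zC).
  apply: connect_restr1; last by rewrite eS.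
    by rewrite inE eqxx orbT PC'.
  by rewrite inE CC' ?(regAC R uA) //= (contra (@PC u)) // (regAC R).
split=> //.
- by case: Cc.
- exact: regBu R.
- exact: regBs R.
- by move=> x /(regBC R)/CC'.
- by move=> x /PC xC; apply/negP => /(regBC R); rewrite xC.
- exact: geodesicS gP.
- exact: geodesicS (regBg R).
- by move=> x /endP[] ->; [apply: (linkP u1)|apply: (linkP u2)].
move=> x xe; have /andP[xB _] := xe; have [a aA xa] := regBe R xe.
exists c1 => //.
have sub z : z \notin C -> (z \notin B) || (z == x) ->
    z \in [set z | (z \notin C') && ((z \notin B) || (z == x))].
  by move=> zC zB; rewrite inE CC'.
apply: connect_trans (_ : connect _ x a) _.
  by apply: connect_restrS xa => z; rewrite inE => /andP[]; apply: sub.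
apply: (@connect_trans _ _ u1).
  apply: (sorted_connect (regAs R)) => // z zA; apply: sub; first exact: (regAC R).
  by rewrite (regAB R).
apply: connect_restr1 => //; first by rewrite sub ?(regAC R u1A) ?(regAB R u1A).
rewrite inE PC' //=; apply/orP; left; apply/negP => /(regBC R).
by rewrite c1C.
Qed.
End Cut.
End Region.

(* lia does not identify size terms whose eqType argument is only convertible. *)
Ltac slia := clear; repeat match goal with
  | |- context [@size _ ?s] => move: (size s) => ?
  | |- context [@index _ ?x ?s] => move: (index x s) => ?
  end; lia.

(** * Replacing a stretch of a geodesic *)

Section Reroute.
Variables (V : finType) (e : rel V).
Hypothesis eS : symmetric e.

Lemma sorted_adjacent (B : seq V) x y : sorted e B -> x \in B -> y \in B ->
  index y B = (index x B).+1 -> e x y.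
Proof.
move=> sB xB yB exy; move/(sortedP x): sB => /(_ (index x B)).
by rewrite -exy index_mem => /(_ yB); rewrite !nth_index.
Qed.

Variables (C : {set V}) (A B X : seq V) (x0 y0 : V).
Hypothesis (R : region e C A B) (x0B : x0 \in B) (y0B : y0 \in B).
Hypothesis (pX : path e x0 (rcons X y0)) (uX : uniq X) (XC : {subset X <= C}).
Hypothesis (X0 : 0 < size X) (ixy : index y0 B = index x0 B + (size X).+1).

Let i := index x0 B.
Let j := index y0 B.
(** [X] takes the place of the vertices strictly between [x0] and [y0]. Their number is the same, so
    all other vertices keep their positions. *)
Definition rerouted := take i.+1 B ++ X ++ drop j B.
Notation B' := rerouted.

Let ixyE : j = i + (size X).+1. Proof. by []. Qed.
Let uB : uniq B := regBu R.
Let jB : j < size B. Proof. by rewrite index_mem. Qed.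
Let size_prefix : size (take i.+1 B) = i.+1.
Proof. by rewrite size_takel ?index_mem. Qed.

Let mem_suffix z : (z \in drop j B) = (z \in B) && (j <= index z B).
Proof.
apply/idP/andP=> [zd|[zB jz]]; last first.
  rewrite -(nth_index z zB) -(subnKC jz) -nth_drop mem_nth // size_drop.
  by move: zB; rewrite -index_mem; lia.
have zB := mem_drop zd; split=> //; rewrite leqNgt; apply/negP => zj.
have zt : z \in take j B by rewrite in_take.
move: uB; rewrite -{1}(cat_take_drop j B) cat_uniq => /and3P[_ /hasPn/(_ z zd)].
by rewrite /= zt.
Qed.

Lemma mem_rerouted z :
  (z \in B') = (z \in X) || (z \in B) && ((index z B <= i) || (j <= index z B)).
Proof.
rewrite /rerouted !mem_cat mem_suffix; case zB: (z \in B) => /=.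
  by rewrite in_take // ltnS orbCA.
rewrite orbF; suff -> : z \in take i.+1 B = false by [].
by apply/negP => /mem_take; rewrite zB.
Qed.

Let XB z : z \in X -> z \notin B.
Proof. by move/XC => zC; apply/negP => /(regBC R); rewrite zC. Qed.

Lemma index_rerouted_old z : z \in B -> (index z B <= i) || (j <= index z B) ->
  index z B' = index z B.
Proof.
move=> zB zij; rewrite /rerouted index_cat.
case: ifPn => zt.
  by rewrite -[in RHS](cat_take_drop i.+1 B) index_cat zt.
rewrite index_cat (negbTE (contraL (@XB z) zB)) size_prefix.
have jz : j <= index z B by move: zt zij; rewrite in_take // ltnS => /negbTE->.
have zd : z \notin take j B by rewrite in_take // -leqNgt.
rewrite -[in RHS](cat_take_drop j B) index_cat (negbTE zd) size_takel 1?ltnW //.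
by move: ixyE; slia.
Qed.

Lemma index_rerouted_new z : z \in X -> index z B' = i.+1 + index z X.
Proof.
move=> zX; rewrite /rerouted index_cat ifF ?size_prefix; last first.
  by apply/negP => /mem_take; rewrite (negbTE (XB zX)).
by rewrite index_cat zX.
Qed.

Lemma size_rerouted : size B' = size B.
Proof.
rewrite /rerouted !size_cat size_prefix size_drop.
by move: ixyE jB; slia.
Qed.

Lemma uniq_rerouted : uniq B'.
Proof.
rewrite /rerouted !cat_uniq take_uniq // uX drop_uniq // andbT /=.
apply/andP; split.
  apply/hasPn => z; rewrite mem_cat mem_suffix => /orP[zX|/andP[zB jz]].
    by apply/negP => /mem_take; rewrite (negbTE (XB zX)).
  by rewrite in_take // -leqNgt; move: ixyE jz; slia.
by apply/hasPn => z; rewrite mem_suffix => /andP[zB _]; apply: contraL zB; apply: XB.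
Qed.

Lemma sorted_rerouted : sorted e B'.
Proof.
have := regBs R; rewrite /rerouted /i /j.
case: B x0B y0B => //= b Bt xB yB pB.
have [p1 l1 s1 _ _] := walk_split pB xB.
have [_ l2 s2 p2 _] := walk_split pB yB.
rewrite cat_path p1 l1.
have -> : drop (index y0 (b :: Bt)) (b :: Bt) = y0 :: drop (index y0 (b :: Bt)) Bt.
  rewrite (drop_nth b) ?index_mem // nth_index //.
by rewrite -cat_rcons cat_path pX last_rcons.
Qed.

(* A walk ending on X extends along X to an end of X, where the geodesic B applies. *)
Lemma geodesic_rerouted : geodesic e B' C.
Proof.
have gB := regBg R.
have toX z q w : z \in X -> path e z (rcons q w) -> {subset q <= C} ->
    path e x0 (rcons (take (index z X) X ++ z :: q) w) /\
    {subset take (index z X) X ++ z :: q <= C}.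
  move=> zX pq qC; have zq : index z X < size X by rewrite index_mem.
  have eX : X = take (index z X) X ++ z :: drop (index z X).+1 X.
    by rewrite -{1}(cat_take_drop (index z X) X) (drop_nth z) // nth_index.
  move: pX; rewrite {1}eX rcons_cat cat_path /= => /andP[p1 /andP[p2 _]].
  split; first by rewrite rcons_cat cat_path p1 /= p2.
  by move=> y; rewrite mem_cat inE => /or3P[/mem_take/XC|/eqP->|/qC] //; apply: XC.
have fromX z q w : z \in X -> path e w (rcons q z) -> {subset q <= C} ->
    path e w (rcons (q ++ z :: drop (index z X).+1 X) y0) /\
    {subset q ++ z :: drop (index z X).+1 X <= C}.
  move=> zX pq qC; have zq : index z X < size X by rewrite index_mem.
  have eX : X = take (index z X) X ++ z :: drop (index z X).+1 X.
    by rewrite -{1}(cat_take_drop (index z X) X) (drop_nth z) // nth_index.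
  move: pX; rewrite {1}eX rcons_cat cat_path /= => /andP[_ /andP[_ p2]].
  split; first by rewrite rcons_cat -cat_rcons cat_path pq last_rcons.
  by move=> y; rewrite mem_cat inE => /or3P[/qC|/eqP->|/mem_drop/XC] //; apply: XC.
move=> x y q; rewrite !mem_rerouted => /orP[xX|/andP[xB xi]] /orP[yX|/andP[yB yi]] pq qC.
- rewrite !index_rerouted_new //.
  have [p1 sub1] := fromX _ _ _ yX pq qC.
  have [p2 sub2] := toX _ _ _ xX p1 sub1.
  have := gB _ _ _ x0B y0B p2 sub2; rewrite -/i -/j.
  have := yX; have := xX; rewrite -!index_mem.
  rewrite !size_cat /= size_cat /= size_takel ?size_drop; last by rewrite ltnW ?index_mem.
  by move: ixyE; slia.
- rewrite (index_rerouted_new xX) (index_rerouted_old yB yi).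
  have [p2 sub2] := toX _ _ _ xX pq qC.
  have := gB _ _ _ x0B yB p2 sub2; rewrite -/i size_cat /= size_takel; last by rewrite ltnW ?index_mem.
  by slia.
- rewrite (index_rerouted_new yX) (index_rerouted_old xB xi).
  have [p1 sub1] := fromX _ _ _ yX pq qC.
  have := gB _ _ _ xB y0B p1 sub1; rewrite -/j size_cat /= size_drop.
  by have := yX; rewrite -index_mem; move: ixyE; slia.
by rewrite !index_rerouted_old //; apply: gB.
Qed.

Variable C' : {set V}.
Hypothesis (Cc : component e (C :\: [set z in X]) C').

Let C'C x : x \in C' -> (x \in C) && (x \notin X).
Proof. by case: Cc => _ /subsetP sub _ _ /sub; rewrite !inE andbC. Qed.
Let C'sC : C' \subset C. Proof. by apply/subsetP => x /C'C /andP[]. Qed.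
Let XC' x : x \in X -> x \notin C'. Proof. by move=> xX; apply/negP => /C'C; rewrite xX andbF. Qed.
Let CC' x : x \notin C -> x \notin C'. Proof. by apply: contra => /C'C /andP[]. Qed.

(** The ends of [B'] are those of [B]. Their links to [A] avoid [C], hence also [X]. *)
Lemma region_outside : (forall u c, exits e C' u c -> (u \in A) || (u \in B')) ->
  region e C' A B'.
Proof.
move=> N.
have B'C x : x \in B' -> (x \in X) || (x \in B).
  by rewrite mem_rerouted => /orP[->//|/andP[->]]; rewrite orbT.
have x0B' : x0 \in B' by rewrite mem_rerouted x0B leqnn orbT.
split=> //.
- by case: Cc.
- exact: regAu R.
- exact: regAs R.
- exact: uniq_rerouted.
- exact: sorted_rerouted.
- by move=> x /(regAC R)/CC'.
- by move=> x /B'C/orP[/XC'//|/(regBC R)/CC'].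
- move=> x xA; apply/negP => /B'C; rewrite (negbTE (regAB R xA)) orbF => /XC.
  by rewrite (negbTE (regAC R xA)).
- exact: geodesicS (regAg R).
- exact: geodesicS geodesic_rerouted.
- move=> x xe; have [b bB xb] := regAe R xe; exists x0 => //.
  apply: (@connect_trans _ _ b).
    by apply: connect_restrS xb => z; rewrite !inE => /andP[/CC'->].
  apply: (sorted_connect eS (regBs R)) => // z zB; rewrite inE CC' ?(regBC R zB) //=.
  by apply/orP; left; apply/negP => /(regAB R); rewrite zB.
move=> x /andP[xB' xi].
have xe : isend B x.
  move: xi; rewrite size_rerouted; move: xB'; rewrite mem_rerouted => /orP[xX|/andP[xB xij]].
    rewrite index_rerouted_new //; have := xX; rewrite -index_mem.
    by move: ixyE jB; slia.
  by rewrite index_rerouted_old // /isend xB.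
have [a aA xa] := regBe R xe; exists a => //.
apply: connect_restrS xa => z; rewrite !inE => /andP[zC zx]; rewrite CC' //=.
case/orP: zx => [zB|->]; last by rewrite orbT.
apply/orP; left; apply/negP => /B'C; rewrite (negbTE zB) orbF => /XC.
by rewrite (negbTE zC).
Qed.

(** The pocket lies between [X] and the stretch of [B] that it bypasses; the edges of [B] at [x0]
    and at [y0] close its cycle. *)
Lemma region_pocket :
  (forall u c, exits e C' u c -> (u \in seg B i.+1 j.-1) || (u \in seg B' i j)) ->
  region e C' (seg B i.+1 j.-1) (seg B' i j).
Proof.
move=> N.
have ij1 : i.+1 <= j.-1 by move: ixyE X0; slia.
have ij2 : i <= j by move: ij1; slia.
have j1B : j.-1 < size B by move: jB; slia.
have jB' : j < size B' by rewrite size_rerouted.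
have uB' := uniq_rerouted.
have memM := mem_seg uB ij1 j1B.
have memX z : z \in seg B' i j -> (z \in X) || (z \in B) && ((index z B == i) || (index z B == j)).
  rewrite (mem_seg uB' ij2 jB') mem_rerouted => /andP[/orP[->//|/andP[zB zij]]].
  rewrite index_rerouted_old // zB /= => zb; apply/orP; right; move: zb zij; clear.
  by rewrite !eqn_leq; lia.
have x0X : x0 \in seg B' i j.
  by rewrite (mem_seg uB' ij2 jB') mem_rerouted x0B index_rerouted_old ?leqnn ?ij2 ?orbT.
have y0X : y0 \in seg B' i j.
  by rewrite (mem_seg uB' ij2 jB') mem_rerouted y0B index_rerouted_old ?leqnn ?ij2 ?orbT.
have XNM z : z \in seg B' i j -> z \notin seg B i.+1 j.-1.
  move/memX/orP => [zX|/andP[zB zij]]; rewrite memM ?(negbTE (XB zX)) // zB /=.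
  by move: zij ij1; slia.
have BC' z : z \in B -> z \notin C' by move/(regBC R)/CC'.
have XbC' z : z \in seg B' i j -> z \notin C'.
  by move/memX/orP => [/XC'//|/andP[/BC']].
have nthM k : i < k < j -> exists2 z, z \in seg B i.+1 j.-1 & index z B = k.
  move=> kij; have kB : k < size B by move: kij jB; slia.
  exists (nth x0 B k); rewrite ?memM ?mem_nth // index_uniq //.
  by move: kij; slia.
have [m1 m1M m1i] : exists2 z, z \in seg B i.+1 j.-1 & index z B = i.+1.
  by apply: nthM; move: ij1; slia.
have [m2 m2M m2i] : exists2 z, z \in seg B i.+1 j.-1 & index z B = j.-1.
  by apply: nthM; move: ij1; slia.
have m1B : m1 \in B by move: m1M; rewrite memM => /andP[].
have m2B : m2 \in B by move: m2M; rewrite memM => /andP[].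
have e1 : e x0 m1 by apply: (sorted_adjacent (regBs R)).
have e2 : e m2 y0.
  apply: (sorted_adjacent (regBs R)) => //; rewrite m2i -/j.
  by move: ij1; slia.
have link m z : m \in seg B i.+1 j.-1 -> z \in seg B' i j -> e m z ->
    end_linked e C' (seg B i.+1 j.-1) (seg B' i j) m /\
    end_linked e C' (seg B' i j) (seg B i.+1 j.-1) z.
  move=> mM zX mz; have mB : m \in B by move: mM; rewrite memM => /andP[].
  have mX : m \notin seg B' i j by apply: contraL mM; apply: XNM.
  split; [exists z|exists m] => //; apply: connect_restr1; rewrite ?inE ?eqxx ?orbT ?(BC' m) ?XbC' ?XNM ?mX //.
  by rewrite eS.
split=> //.
- by case: Cc.
- exact: uniq_seg.
- exact: sorted_seg (regBs R).
- exact: uniq_seg.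
- exact: sorted_seg sorted_rerouted.
- by move=> x; rewrite memM => /andP[/BC'].
- by move=> x; apply: contraL; apply: XNM.
- apply: geodesic_seg => //; exact: geodesicS (regBg R).
- apply: geodesic_seg => //; exact: geodesicS geodesic_rerouted.
- move=> x /andP[xM]; rewrite index_seg // size_seg // => xe.
  have := xM; rewrite memM => /andP[xB xi].
  have [->|->] : x = m1 \/ x = m2.
    case/orP: xe => /eqP xe; [left|right].
      by apply: (index_inj x xB m1B); rewrite /= m1i; move: xe xi ij1; slia.
    by apply: (index_inj x xB m2B); rewrite /= m2i; move: xe xi ij1; slia.
  + by case: (link m1 x0) => //; rewrite eS.
  + by case: (link m2 y0).
move=> x /andP[xM]; rewrite index_seg // size_seg // => xe.
have := xM; rewrite (mem_seg uB' ij2 jB') => /andP[xB' xi].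
have x0i : index x0 B' = i by rewrite index_rerouted_old // leqnn.
have y0i : index y0 B' = j by rewrite index_rerouted_old // leqnn orbT.
have x0B' : x0 \in B' by rewrite mem_rerouted x0B leqnn orbT.
have y0B' : y0 \in B' by rewrite mem_rerouted y0B leqnn !orbT.
have [->|->] : x = x0 \/ x = y0.
  case/orP: xe => /eqP xe; [left|right].
    by apply: (index_inj x xB' x0B'); rewrite /= x0i; move: xe xi ij1; slia.
  by apply: (index_inj x xB' y0B'); rewrite /= y0i; move: xe xi ij1; slia.
+ by case: (link m1 x0) => //; rewrite eS.
+ by case: (link m2 y0).
Qed.
End Reroute.

(** * Arc separation applied to regions *)

Section Separation.
Variables (V : finType) (e : rel V).
Hypothesis (eS : symmetric e) (AS : arc_separation e).

(** The closed walk is hidden in two connected sets: [P] contains its part in [C] and [Q] the part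
    outside. Whatever is joined off both lies on one side. *)
Lemma arc_separation_sets (C : {set V}) u0 c0 : connected e C -> exits e C u0 c0 ->
    (forall u c, exits e C u c -> connect (restr e (~: C)) u0 u) ->
  exists pos : V -> V -> nat,
  [/\ pos u0 c0 = 0,
      forall u c u' c', exits e C u c -> exits e C u' c' -> pos u c = pos u' c' ->
        u = u' /\ c = c'
    & forall u1 c1 u2 c2 (P Q W : {set V}), exits e C u1 c1 -> exits e C u2 c2 ->
        connected e P -> P \subset C -> c1 \in P -> c2 \in P ->
        connected e Q -> Q \subset ~: C -> u1 \in Q -> u2 \in Q ->
        let side u c := (pos u1 c1 < pos u c) (+) (pos u2 c2 < pos u c) in
        forall u3 c3 u4 c4 x y, exits e C u3 c3 -> exits e C u4 c4 ->
          x \in [:: u3; c3] -> y \in [:: u4; c4] ->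
          W \subset ~: (P :|: Q) -> x \in W -> y \in W -> connect (restr e W) x y ->
          side u3 c3 = side u4 c4].
Proof.
move=> Cc ex0 Uc; have [pos [pos0 posI posS]] := AS Cc ex0 Uc.
exists pos; split=> // u1 c1 u2 c2 P Q W ex1 ex2 Pc /subsetP PC c1P c2P Qc /subsetP QU u1Q u2Q side.
move=> u3 c3 u4 c4 x y ex3 ex4 xE yE /subsetP WPQ xW yW cxy.
have /(connect_restrP _ _ c1P)[pc [pc1 pc2 pcP]] := Pc _ _ c1P c2P.
have /(connect_restrP _ _ u2Q)[pu [pu1 pu2 puQ]] := Qc _ _ u2Q u1Q.
apply/eqP/negPn/negP => nside.
have := posS u1 c1 u2 c2 pc pu ex1 ex2 pc1 pc2 (fun z h => PC z (pcP z h)) pu1 pu2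
  (fun z h => QU z (puQ z h)) u3 c3 u4 c4 x y ex3 ex4 nside xE yE.
set D := [set _ in _].
have DPQ z : z \in D -> z \in P :|: Q.
  rewrite !inE mem_cat inE => /or4P[/eqP->|/eqP->|/pcP->|/predU1P[->|/puQ->]];
    by rewrite ?c1P ?u1Q ?u2Q ?orbT.
have WD z : z \in W -> z \in ~: D.
  by rewrite [z \in ~: D]in_setC => /WPQ; rewrite in_setC; apply: contra => /DPQ.
move=> /(_ _ _)/negP; apply; try by rewrite -in_setC WD.
exact: connect_restrS cxy.
Qed.

(* Take the first and the last exit at A in the cyclic order around C, cut at an exit u0 of B. *)
Lemma cut_exits_sets (C A B : {set V}) : connected e C -> A \subset ~: C -> B \subset ~: C ->
  [disjoint A & B] -> connected e A -> connected e B ->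
  (forall u0 c0 u c, exits e C u0 c0 -> exits e C u c -> connect (restr e (~: C)) u0 u) ->
  (exists u c, exits e C u c && (u \in A)) -> (exists u c, exits e C u c && (u \in B)) ->
  exists u1 c1 u2 c2 u0, [/\ exits e C u1 c1, exits e C u2 c2, u1 \in A, u2 \in A & u0 \in B] /\
    (forall (Q W : {set V}) u c, connected e Q -> Q \subset ~: C -> u1 \in Q -> u2 \in Q ->
      exits e C u c -> u \in A -> u \notin Q ->
      W \subset ~: (C :|: Q) -> u \in W -> u0 \in W -> ~~ connect (restr e W) u u0) /\
    (forall (P C' : {set V}), connected e P -> P \subset C -> c1 \in P -> c2 \in P ->
      connected e C' -> C' \subset C :\: P -> forall u c u' c', exits e C u c -> exits e C u' c' ->
      c \in C' -> c' \in C' -> u \in A -> u' \in B -> False).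
Proof.
move=> Cc AU BU AB A_conn B_conn exits_conn [ua [ca /andP[exa uaA]]] [u0 [c0 /andP[ex0 u0B]]].
have [pos [pos0 posI posS]] := arc_separation_sets Cc ex0 (fun u c => @exits_conn u0 c0 u c ex0).
pose ok (p : V * V) := exits e C p.1 p.2 && (p.1 \in A).
have okA : ok (ua, ca) by rewrite /ok exa.
case: (arg_minnP (fun p => pos p.1 p.2) okA) => -[u1 c1] /andP[/= ex1 u1A] pmin.
case: (arg_maxnP (fun p => pos p.1 p.2) okA) => -[u2 c2] /andP[/= ex2 u2A] pmax.
have pmin' u c : exits e C u c -> u \in A -> pos u1 c1 <= pos u c.
  by move=> ex uA; apply: (pmin (u, c)); rewrite /ok /= ex.
have pmax' u c : exits e C u c -> u \in A -> pos u c <= pos u2 c2.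
  by move=> ex uA; apply: (pmax (u, c)); rewrite /ok /= ex.
(* [side] is true strictly between the extreme exits at [A], and false at [u0], which has position
   0. Both claims follow from this contrast. *)
have mid u c : exits e C u c -> u \in A -> (u, c) != (u1, c1) -> (u, c) != (u2, c2) ->
    (pos u1 c1 < pos u c) (+) (pos u2 c2 < pos u c).
  move=> ex uA n1 n2; have l1 := pmin' _ _ ex uA; have l2 := pmax' _ _ ex uA.
  have {}n1 : pos u1 c1 != pos u c.
    by apply: contra n1 => /eqP/(posI _ _ _ _ ex1 ex)[-> ->].
  have {}n2 : pos u c != pos u2 c2.
    by apply: contra n2 => /eqP/(posI _ _ _ _ ex ex2)[-> ->].
  by rewrite ltn_neqAle n1 l1 ltnNge l2.
exists u1, c1, u2, c2, u0; split=> //; split.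
  move=> Q W u c Qc QU u1Q u2Q ex uA nuQ WD uW u0W; apply/negP => cW.
  have [_ c1C _] := exits_in ex1; have [_ c2C _] := exits_in ex2.
  have := posS _ _ _ _ _ _ _ ex1 ex2 Cc (subxx _) c1C c2C Qc QU u1Q u2Q
    _ _ _ _ _ _ ex ex0 (mem_head u [:: c]) (mem_head u0 [:: c0]) WD uW u0W cW.
  by rewrite pos0 !ltn0 mid //; apply: contra nuQ => /eqP[-> _].
move=> P C' Pc PC c1P c2P C'c /subsetP C'P u c u' c' ex ex' cC' c'C' uA u'B.
have nP z : z \in C' -> (z \in C) && (z \notin P) by move/C'P; rewrite inE andbC.
have /andP[cC cP] := nP _ cC'.
have m : (pos u1 c1 < pos u c) (+) (pos u2 c2 < pos u c).
  by apply: mid => //; apply: contra cP => /eqP[_ ->].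
have WD : C' \subset ~: (P :|: A).
  apply/subsetP => z /nP /andP[zC zP]; rewrite !inE negb_or zP /=.
  by apply/negP => /(subsetP AU); rewrite inE zC.
have cE (w z : V) : z \in [:: w; z] by rewrite !inE eqxx orbT.
have := posS _ _ _ _ _ _ _ ex1 ex2 Pc PC c1P c2P A_conn AU u1A u2A
  _ _ _ _ _ _ ex ex' (cE u c) (cE u' c') WD cC' c'C' (C'c _ _ cC' c'C').
rewrite m => /esym m'.
have WD' : B \subset ~: (P :|: A).
  apply/subsetP => z zB; rewrite !inE negb_or (disjointFl AB zB) andbT.
  by apply/negP => /(subsetP PC) zC; have := subsetP BU _ zB; rewrite inE zC.
have := posS _ _ _ _ _ _ _ ex1 ex2 Pc PC c1P c2P A_conn AU u1A u2A
  _ _ _ _ _ _ ex' ex0 (mem_head u' [:: c']) (mem_head u0 [:: c0]) WD' u'B u0B (B_conn _ _ u'B u0B).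
by rewrite m' pos0 !ltn0.
Qed.

Variables (C : {set V}) (A B : seq V).
Hypothesis R : region e C A B.

Let exits_conn u0 c0 : exits e C u0 c0 ->
  forall u c, exits e C u c -> connect (restr e (~: C)) u0 u.
Proof. by move=> ex0 u c ex; apply: (region_connected eS R); apply: (regN R); eassumption. Qed.

(** If an exit at [A] lay off the stretch between [u1] and [u2], then deleting [C] and this stretch
    would leave it joined to the exit [u0] at [B], although it lies between [u1] and [u2] in the
    cyclic order. *)
Lemma cut_exits : (exists u c, exits e C u c && (u \in A)) ->
  (exists u c, exits e C u c && (u \in B)) ->
  exists u1 c1 u2 c2, [/\ exits e C u1 c1, exits e C u2 c2, u1 \in A, u2 \in A & index u1 A <= index u2 A] /\
    (forall u c, exits e C u c -> u \in A -> index u1 A <= index u A <= index u2 A) /\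
    (forall (P C' : {set V}), connected e P -> P \subset C -> c1 \in P -> c2 \in P ->
      connected e C' -> C' \subset C :\: P -> forall u c u' c', exits e C u c -> exits e C u' c' ->
      c \in C' -> c' \in C' -> u \in A -> u' \in B -> False).
Proof.
move=> [ua [ca exa]] [ub [cb exb]].
have [||||||||u1 [c1 [u2 [c2 [u0 [[ex1 ex2 u1A u2A u0B] [rng sep]]]]]]] :=
  @cut_exits_sets C [set z in A] [set z in B] (regC R).
- by apply/subsetP => z; rewrite !inE => /(regAC R).
- by apply/subsetP => z; rewrite !inE => /(regBC R).
- by apply/pred0P => z /=; rewrite !inE; apply/andP => -[/(regAB R)/negbTE->].
- exact: (sorted_connected eS (regAs R)).
- exact: (sorted_connected eS (regBs R)).
- by move=> v0 d0 u c exv; apply: exits_conn exv u c.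
- by exists ua, ca; rewrite inE.
- by exists ub, cb; rewrite inE.
rewrite !inE in u1A u2A u0B.
have range u c : exits e C u c -> u \in A ->
    (minn (index u1 A) (index u2 A) <= index u A <= maxn (index u1 A) (index u2 A)).
  move=> ex uA; apply/negPn/negP => nr.
  set lo := minn _ _ in nr; set hi := maxn _ _ in nr.
  have uA' := regAu R.
  have lohi : lo <= hi by apply: leq_trans (geq_minl _ _) (leq_maxl _ _).
  have hiA : hi < size A by rewrite /hi gtn_max !index_mem u1A.
  have memS := mem_seg uA' lohi hiA.
  have S1 : u1 \in [set z in seg A lo hi] by rewrite inE memS u1A geq_minl leq_maxl.
  have S2 : u2 \in [set z in seg A lo hi] by rewrite inE memS u2A geq_minr leq_maxr.
  have nuS : u \notin [set z in seg A lo hi] by rewrite inE memS uA.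
  pose W := [set z | (z \notin C) && ~~ ((z \in A) && (lo <= index z A <= hi))].
  have cW : connect (restr e W) u u0.
    apply: (outside_connected eS (region_sym R)) => //; rewrite uA /=; apply/orP; right.
    by move: nr; rewrite negb_and -!ltnNge.
  have segU : [set z in seg A lo hi] \subset ~: C.
    by apply/subsetP => z; rewrite !inE memS => /andP[/(regAC R)].
  have segc := sorted_connected eS (sorted_seg lo hi (regAs R)).
  have WD : W \subset ~: (C :|: [set z in seg A lo hi]).
    by apply/subsetP => z; rewrite !inE memS negb_or.
  have uW : u \in W by rewrite inE (regAC R uA) uA.
  have u0W : u0 \in W.
    have u0A : u0 \notin A by apply/negP => /(regAB R); rewrite u0B.
    by rewrite inE (regBC R u0B) (negbTE u0A).
  have uA1 : u \in [set z in A] by rewrite inE.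
  by have := rng _ _ _ _ segc segU S1 S2 ex uA1 nuS WD uW u0W; rewrite cW.
have sep' P C' : connected e P -> P \subset C -> c1 \in P -> c2 \in P ->
      connected e C' -> C' \subset C :\: P -> forall u c u' c', exits e C u c -> exits e C u' c' ->
      c \in C' -> c' \in C' -> u \in A -> u' \in B -> False.
  move=> Pc PC c1P c2P C'c C'P u c u' c' ex ex' cC' c'C' uA u'B.
  by apply: (sep P C' Pc PC c1P c2P C'c C'P u c u' c' ex ex' cC' c'C'); rewrite inE.
case: (leqP (index u1 A) (index u2 A)) => u12.
  exists u1, c1, u2, c2; split=> //; split=> // u c ex uA.
  by have := range u c ex uA; rewrite (minn_idPl u12) (maxn_idPr u12).
exists u2, c2, u1, c1; split; first by rewrite ltnW.
split=> [u c ex uA|P C' Pc PC c1P c2P]; last exact: sep'.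
by have := range u c ex uA; rewrite (minn_idPr (ltnW u12)) (maxn_idPl (ltnW u12)).
Qed.

(** The cyclic order is cut at [x0], and [p3], [p4], [pj] are the positions of the exits at [u3],
    [u4], [y0]. Three closed walks give [F1], [F2], [F3], which together make [p3 < pj] equivalent
    to [pj < p3], although the two differ. *)
Lemma reroute_separation (X : seq V) x0 y0 (C' : {set V}) : x0 \in B -> y0 \in B ->
  path e x0 (rcons X y0) -> {subset X <= C} -> 0 < size X -> index x0 B < index y0 B ->
  connected e C' -> C' \subset C :\: [set z in X] ->
  forall u3 c3 u4 c4, exits e C u3 c3 -> exits e C u4 c4 -> c3 \in C' -> c4 \in C' ->
  u3 \in B -> index x0 B < index u3 B < index y0 B ->
  (u4 \in A) || ((u4 \in B) && ((index u4 B < index x0 B) || (index y0 B < index u4 B))) -> False.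
Proof.
move=> x0B y0B pX XC X0 ij C'c /subsetP C'X u3 c3 u4 c4 ex3 ex4 c3C' c4C' u3B i3 u4AB.
have uB := regBu R; have sB := regBs R.
have [xf [xl [exx exy xfX xlX]]] : exists xf xl, [/\ exits e C x0 xf, exits e C y0 xl, xf \in X & xl \in X].
  case: X pX XC X0 {C'X} => // xf X' /= /andP[xxf pX'] XC' _.
  exists xf, (last xf X'); rewrite mem_head mem_last; split=> //.
    by apply/and3P; split; rewrite ?(regBC R x0B) ?XC' ?mem_head.
  apply/and3P; split; rewrite ?(regBC R y0B) ?XC' ?mem_last //.
  by move: pX'; rewrite rcons_path eS => /andP[].
have sX : sorted e X by move: pX; rewrite rcons_path => /andP[/path_sorted].
have [pos [pos0 posI posS]] := arc_separation_sets (regC R) exx (exits_conn exx).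
have CB z : z \in B -> z \notin C := regBC R (x := z).
pose Bs lo hi := [set z in B | lo <= index z B <= hi].
have BsE lo hi : lo <= hi -> hi < size B -> Bs lo hi = [set z in seg B lo hi].
  by move=> h1 h2; apply/setP => z; rewrite !inE mem_seg.
have Bsc lo hi : lo <= hi -> hi < size B -> connected e (Bs lo hi).
  by move=> h1 h2; rewrite BsE //; exact: (sorted_connected eS (sorted_seg lo hi sB)).
have BsU lo hi : Bs lo hi \subset ~: C by apply/subsetP => z; rewrite !inE => /andP[/CB].
have y0s : index y0 B < size B by rewrite index_mem.
have u3s : index u3 B < size B by rewrite index_mem.
have a0A : exists a, a \in A.
  by have [w we _] := isend_head x0B; have [a aA _] := regBe R we; exists a.
pose W lo hi := [set z | (z \notin C) && ~~ ((z \in B) && (lo <= index z B <= hi))].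
have WD lo hi : W lo hi \subset ~: (C :|: Bs lo hi).
  by apply/subsetP => z; rewrite !inE negb_or.
have toW lo hi z : (z \in A) || ((z \in B) && ((index z B < lo) || (hi < index z B))) -> z \in W lo hi.
  rewrite inE; case/orP=> [zA|/andP[zB zi]].
    by rewrite (regAC R zA) (negbTE (regAB R zA)).
  by rewrite (CB z zB) zB /=; move: zi; clear; lia.
have cW lo hi z w : (z \in A) || ((z \in B) && ((index z B < lo) || (hi < index z B))) ->
   (w \in A) || ((w \in B) && ((index w B < lo) || (hi < index w B))) -> connect (restr e (W lo hi)) z w.
  move=> zi wi; case: a0A => a aA.
  apply: connect_trans (outside_connected eS R aA zi) _.
  by rewrite (restr_csym eS); exact: (outside_connected eS R aA wi).
have [_ xfC _] := exits_in exx; have [_ xlC _] := exits_in exy.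
have [_ c3C _] := exits_in ex3; have [_ c4C _] := exits_in ex4.
have mB lo hi z : z \in B -> lo <= index z B <= hi -> z \in Bs lo hi by move=> zB zi; rewrite inE zB.
case/andP: i3 => i3 j3.
set p3 := pos u3 c3; set p4 := pos u4 c4; set pj := pos y0 xl.
have u4i : (u4 \in A) || ((u4 \in B) && ((index u4 B < (index x0 B).+1) || (index y0 B < index u4 B))).
  by case/orP: u4AB => [->//|/andP[-> h]]; apply/orP; right; move: h; clear; lia.
have u4j : (u4 \in A) || ((u4 \in B) && ((index u4 B < index x0 B) || ((index y0 B).-1 < index u4 B))).
  by case/orP: u4AB => [->//|/andP[-> h]]; apply/orP; right; move: h; clear; lia.
(* Without the stretch of [B] from [u3] to [y0], the vertices [x0] and [u4] are still joined. *)
have F1 : (p3 < p4) = (pj < p4).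
  have u4W : (u4 \in A) || ((u4 \in B) && ((index u4 B < index u3 B) || (index y0 B < index u4 B))).
    by case/orP: u4AB => [->//|/andP[-> h]]; apply/orP; right; move: h i3; clear; lia.
  have xW : (x0 \in A) || ((x0 \in B) && ((index x0 B < index u3 B) || (index y0 B < index x0 B))).
    by rewrite x0B i3 /= orbT.
  have := posS _ _ _ _ _ _ _ ex3 exy (regC R) (subxx _) c3C xlC (Bsc _ _ (ltnW j3) y0s) (BsU _ _)
    (mB _ _ _ u3B _) (mB _ _ _ y0B _) _ _ _ _ _ _ ex4 exx (mem_head u4 [:: c4]) (mem_head x0 [:: xf])
    (WD _ _) (toW _ _ _ u4W) (toW _ _ _ xW) (cW _ _ _ _ u4W xW).
  rewrite leqnn (ltnW j3) leqnn pos0 !ltn0 -/p3 -/p4 -/pj => /(_ isT isT).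
  by case: (p3 < p4); case: (pj < p4).
(* Without the stretch from [x0] to [u3], the vertices [y0] and [u4] are still joined. *)
have F2 : (p3 < p4) = (p3 < pj).
  have u4W : (u4 \in A) || ((u4 \in B) && ((index u4 B < index x0 B) || (index u3 B < index u4 B))).
    by case/orP: u4AB => [->//|/andP[-> h]]; apply/orP; right; move: h j3; clear; lia.
  have yW : (y0 \in A) || ((y0 \in B) && ((index y0 B < index x0 B) || (index u3 B < index y0 B))).
    by rewrite y0B j3 /= !orbT.
  have pos_gt0 u c : exits e C u c -> u != x0 -> 0 < pos u c.
    move=> ex ux; rewrite lt0n -pos0; apply: contra ux => /eqP/(posI _ _ _ _ ex exx)[-> _] //.
  have p40 : 0 < p4.
    apply: pos_gt0 => //; apply: contraTneq u4AB => ->.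
    rewrite ltnn x0B /= negb_or -leqNgt (ltnW ij) andbT.
    by apply/negP => /(regAB R); rewrite x0B.
  have pj0 : 0 < pj by apply: pos_gt0 => //; apply: contraTneq ij => ->; rewrite ltnn.
  have := posS _ _ _ _ _ _ _ exx ex3 (regC R) (subxx _) xfC c3C (Bsc _ _ (ltnW i3) u3s) (BsU _ _)
    (mB _ _ _ x0B _) (mB _ _ _ u3B _) _ _ _ _ _ _ ex4 exy (mem_head u4 [:: c4]) (mem_head y0 [:: xl])
    (WD _ _) (toW _ _ _ u4W) (toW _ _ _ yW) (cW _ _ _ _ u4W yW).
  rewrite leqnn (ltnW i3) leqnn pos0 -/p3 -/p4 -/pj p40 pj0 => /(_ isT isT).
  by case: (p3 < p4); case: (p3 < pj).
(* This walk runs along [X] and the stretch that [X] bypasses; [c3] and [c4] are joined off it,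
   inside [C']. *)
have F3 : (pj < p3) = (pj < p4).
  have Xc := sorted_connected eS sX.
  have XsC : [set z in X] \subset C by apply/subsetP => z; rewrite inE => /XC.
  have xfX' : xf \in [set z in X] by rewrite inE.
  have xlX' : xl \in [set z in X] by rewrite inE.
  have WX : C' \subset ~: ([set z in X] :|: Bs (index x0 B) (index y0 B)).
    apply/subsetP => z /C'X; rewrite !inE negb_or => /andP[-> zC] /=.
    by apply/negP => /andP[/CB]; rewrite zC.
  have cE (u w : V) : w \in [:: u; w] by rewrite !inE eqxx orbT.
  have := posS _ _ _ _ _ _ _ exx exy Xc XsC xfX' xlX' (Bsc _ _ (ltnW ij) y0s) (BsU _ _)
    (mB _ _ _ x0B _) (mB _ _ _ y0B _) _ _ _ _ _ _ ex3 ex4 (cE u3 c3) (cE u4 c4) WX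
    c3C' c4C' (C'c _ _ c3C' c4C').
  have pos_gt0 u c : exits e C u c -> u != x0 -> 0 < pos u c.
    move=> ex ux; rewrite lt0n -pos0; apply: contra ux => /eqP/(posI _ _ _ _ ex exx)[-> _] //.
  have p30 : 0 < p3 by apply: pos_gt0 => //; apply: contraTneq i3 => ->; rewrite ltnn.
  have p40 : 0 < p4.
    apply: pos_gt0 => //; apply: contraTneq u4AB => ->.
    rewrite ltnn x0B /= negb_or -leqNgt (ltnW ij) andbT.
    by apply/negP => /(regAB R); rewrite x0B.
  rewrite !leqnn (ltnW ij) pos0 -/p3 -/p4 -/pj p30 p40 => /(_ isT isT).
  by case: (pj < p3); case: (pj < p4).
have : p3 != pj.
  by apply/eqP => /(posI _ _ _ _ ex3 exy)[u3y _]; rewrite u3y ltnn in j3.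
have E : (p3 < pj) = (pj < p3) by rewrite F3 -F1 F2.
by rewrite neq_ltn E orbb => lt; move: E; rewrite lt => /(ltn_trans lt); rewrite ltnn.
Qed.
End Separation.

(** * Ordering a region recursively *)

Section Scol.
Variables (V : finType) (e : rel V).
Hypothesis (eS : symmetric e) (eI : irreflexive e).

Lemma connect_leaves (C C' : {set V}) x y : connect (restr e C) x y -> x \in C' -> y \notin C' ->
  exists a b, [/\ a \in C', b \notin C' & restr e C a b].
Proof.
case/connectP=> p; elim: p x => [|z p IHp] x /=; first by move=> _ -> ->.
case/andP=> xz pp el xC' yC'; case: (boolP (z \in C')) => zC'; first exact: IHp pp el zC' yC'.
by exists x, z.
Qed.

Lemma component_exit (C C' P : {set V}) p : connected e C -> p \in P -> P \subset C ->
  component e (C :\: P) C' -> exists u c, exits e C' u c && (u \in P).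
Proof.
move=> Cc pP /subsetP PC [/set0Pn[c cC'] /subsetP C'C _ clC'].
have /andP[cC _] : (c \in C) && (c \notin P) by move/C'C: cC'; rewrite inE andbC.
have pC' : p \notin C' by apply/negP => /C'C; rewrite inE pP.
have [a [b [aC' bC' /and3P[_ bC ab]]]] := connect_leaves (Cc _ _ cC (PC _ pP)) cC' pC'.
exists b, a; rewrite /exits bC' aC' eS ab /=; apply/negPn/negP => bP.
by move: bC'; rewrite (clC' a b) // inE bP.
Qed.

Lemma component_exits (C C' P : {set V}) u c : component e (C :\: P) C' -> exits e C' u c ->
  u \in P \/ exits e C u c.
Proof.
move=> [_ /subsetP C'C _ clC'] /and3P[uC' cC' uc].
have /andP[cC _] : (c \in C) && (c \notin P) by move/C'C: cC'; rewrite inE andbC.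
case: (boolP (u \in P)) => uP; [by left|right]; rewrite /exits cC uc !andbT.
by apply: contra uC' => uC; apply: (clC' c) => //; rewrite 1?eS // inE uP.
Qed.

Variable s : nat.

Lemma reached_region (C Z : {set V}) A B v : region e C A B -> v \in C -> Z \subset C ->
  reached e Z s v \subset [set w in C :\: Z | reach e Z s v w] :|:
    ([set w in A | reach e Z s v w] :|: [set w in B | reach e Z s v w]).
Proof.
move=> R vC /subsetP ZC; apply/subsetP => w; rewrite inE => /andP[wZ h]; rewrite !inE wZ h !andbT.
case: (boolP (w \in C)) => //= wC; apply/orP.
have [vw|[q [pq qZ _]]] := reachP _ _ _ _ _ h; first by rewrite -vw vC in wC.
apply/orP/(regN R (c := last v q)); rewrite /exits wC /=.
apply/andP; split; last by move: pq; rewrite rcons_path eS => /andP[].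
by have := mem_last v q; rewrite inE => /predU1P[->//|/qZ/ZC].
Qed.

(** On its own geodesic [v] sees only positions up to its own, so the window is one-sided: [s]
    positions and [v]. *)
Lemma own_window (C Z : {set V}) P v : geodesic e P C -> v \in P -> Z \subset C ->
  (forall w, w \in C :\: Z -> (w \in P) && (index w P <= index v P)) ->
  #|[set w in C :\: Z | reach e Z s v w]| <= s + 1.
Proof.
move=> gP vP /subsetP ZC own; apply: (@card_interval _ P _ (index v P - s)).
  by move=> w; rewrite inE => /andP[/own/andP[]].
move=> w; rewrite inE => /andP[/own/andP[wP wv]].
case/reachP=> [->|[q [/(rev_walk eS) pq qZ sq]]]; first by slia.
have := gP _ _ _ wP vP pq; rewrite size_rev => /(_ _).
have sub : {subset rev q <= C} by move=> z; rewrite mem_rev => /qZ/ZC.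
by move=> /(_ sub); move: sq wv; slia.
Qed.

(** The alternate route is chosen shortest for two purposes: the stretch that it bypasses becomes
    tight inside the pocket, and the window on [A] seen from the route shrinks. *)
Lemma tight_or_alternate (A : seq V) (C : {set V}) : geodesic e A C -> tight e s A C \/
  exists x y X, [/\ x \in A, y \in A, path e x (rcons X y), {subset X <= C} & 0 < size X] /\
   [/\ (size X).+1 <= 2 * s, index y A = index x A + (size X).+1 &
    forall x' y' q, x' \in A -> y' \in A -> path e x' (rcons q y') -> {subset q <= C} ->
      0 < size q -> (size q).+1 <= 2 * s -> index y' A = index x' A + (size q).+1 ->
      size X <= size q].
Proof.
move=> gA.
pose bad m := [&& 0 < m, m.+1 <= 2 * s & [exists x in A, [exists y in A, [exists q : m.-tuple V,
  [&& path e x (rcons q y), all (mem C) q & index y A == index x A + m.+1]]]]].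
have badP x y q : x \in A -> y \in A -> path e x (rcons q y) -> {subset q <= C} ->
      0 < size q -> (size q).+1 <= 2 * s -> index y A = index x A + (size q).+1 -> bad (size q).
  move=> xA yA pq qC q0 q2 ixy; rewrite /bad q0 q2 /=.
  apply/existsP; exists x; rewrite xA /=; apply/existsP; exists y; rewrite yA /=.
  apply/existsP; exists (in_tuple q); rewrite pq ixy eqxx andbT /=; exact/allP.
case: (boolP [exists m : 'I_(2 * s).+1, bad m]) => [/existsP[m0 bm0]|/existsPn nb].
  right; have exm : exists m, bad m by exists m0.
  case: (ex_minnP exm) => m /and3P[m0' m2 /existsP[x /andP[xA /existsP[y /andP[yA /existsP[q' qP]]]]]] mmin.
  case: q' qP => q /= /eqP sq /and3P[pq /allP qC /eqP ixy]; subst m.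
  exists x, y, q; split=> //; split=> // x' y' q' x'A y'A pq' qC' q0' q2' ixy'.
  by apply: mmin; apply: (badP x' y').
left=> x y q xA yA pq qC q0 q2; apply/eqP => ixy.
have lt : size q < (2 * s).+1 by rewrite ltnS ltnW.
by have := nb (Ordinal lt); rewrite (badP x y).
Qed.

Lemma uniq_alternate (B X : seq V) (C : {set V}) x y : geodesic e B C -> x \in B -> y \in B ->
  path e x (rcons X y) -> {subset X <= C} -> index y B = index x B + (size X).+1 -> uniq X.
Proof.
move=> gB xB yB pX XC ixy.
have := last_rcons x X y; case: (shortenP pX) => p pp up sub lp.
case/lastP: p pp up sub lp => [|X' y'].
  by move=> _ _ _ /= xy; move: ixy; rewrite xy; slia.
rewrite last_rcons => pp up sub y'y; subst y'.
have X'X : {subset X' <= X}.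
  move=> z zX'; have := sub z; rewrite !mem_rcons !inE zX' orbT => /(_ isT).
  case/predU1P=> // zy; move: up; rewrite /= rcons_uniq -zy zX' /=.
  by rewrite andbF.
have := gB _ _ _ xB yB pp (fun z h => XC z (X'X z h)); rewrite ixy leq_add2l ltnS => sz.
have uX' : uniq X' by move: up; rewrite /= rcons_uniq => /and3P[].
exact: leq_size_uniq uX' X'X sz.
Qed.

Hypothesis (s_gt0 : 0 < s) (AS : arc_separation e).
Notation orderable := (orderable e s (5 * s + 1)).
Definition has_exit (C : {set V}) := exists u c, exits e C u c.

Section Step.
Variables (C : {set V}) (A B : seq V).
Hypothesis R : region e C A B.
Hypothesis IH : forall (C' : {set V}) (A' B' : seq V), C' \proper C -> region e C' A' B' -> has_exit C' ->
  tight e s A' C' \/ tight e s B' C' -> orderable C'.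

Let comp_proper (P : seq V) p C' : p \in P -> {subset P <= C} ->
  component e (C :\: [set z in P]) C' -> C' \proper C.
Proof.
move=> pP PC [_ /subsetP C'C _ _]; apply/properP; split.
  by apply/subsetP => z /C'C; rewrite inE => /andP[].
by exists p; [exact: PC|apply/negP => /C'C; rewrite !inE pP].
Qed.

Let comp_has_exit (P : seq V) p C' : p \in P -> {subset P <= C} ->
  component e (C :\: [set z in P]) C' -> has_exit C'.
Proof.
move=> pP PC C'c; have [|||u [c /andP[ex _]]] := @component_exit C C' [set z in P] p (regC R).
- by rewrite inE.
- by apply/subsetP => z; rewrite inE => /PC.
- by [].
by exists u, c.
Qed.

(** The bound [5s+1] is [2s] for each of the two tight parents and [s+1] for [P]. *)
Lemma orderable_cut_step (P : seq V) p : p \in P -> uniq P -> {subset P <= C} -> geodesic e P C ->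
  tight e s A C -> tight e s B C ->
  (forall C' : {set V}, C' \proper C -> has_exit C' -> component e (C :\: [set z in P]) C' ->
     exists A' B', region e C' A' B' /\ (tight e s A' C' \/ tight e s B' C')) -> orderable C.
Proof.
move=> pP uP PC gP tA tB step; apply: (orderable_step eS uP PC) => [P1 v P2 eP|C' C'c]; last first.
  have pr := comp_proper pP PC C'c; have he := comp_has_exit pP PC C'c.
  by have [A' [B' [R' t']]] := step C' pr he C'c; apply: (IH pr R' he t').
have vP : v \in P by rewrite eP mem_cat mem_head orbT.
set Z := _ :|: _.
have ZC : Z \subset C.
  apply/subsetP => z; rewrite !inE => /orP[zP2|/andP[]//]; apply: PC.
  by rewrite eP mem_cat inE zP2 !orbT.
apply: leq_trans (subset_leq_card (reached_region R (PC _ vP) ZC)) _.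
have AC : {subset A <= ~: C} by move=> z /(regAC R); rewrite inE.
have BC : {subset B <= ~: C} by move=> z /(regBC R); rewrite inE.
have [_ /(_ tA) cA] := reach_window eS s ZC (PC _ vP) AC (regAg R).
have [_ /(_ tB) cB] := reach_window eS s ZC (PC _ vP) BC (regBg R).
have own : #|[set w in C :\: Z | reach e Z s v w]| <= s + 1.
  apply: (own_window gP vP ZC) => w; rewrite !inE negb_or negb_and negbK.
  move=> /andP[/andP[wP2 /orP[wP|wC]] wC']; last by rewrite wC' in wC.
  rewrite wP /=; have := uP; rewrite eP cat_uniq /= negb_or => /and3P[_ /andP[vP1 _] _].
  rewrite [index v _]index_cat (negbTE vP1) /= eqxx addn0 index_cat.
  case: ifP => wP1; first by rewrite ltnW // index_mem.
  by move: wP; rewrite eP mem_cat wP1 inE (negbTE wP2) orbF /= => /eqP->; rewrite eqxx addn0.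
apply: leq_trans (leq_card_setU _ _) _; apply: leq_trans (leq_add own (leq_card_setU _ _)) _.
by move: cA cB; move: #|_| #|_| => a b; clear; lia.
Qed.

Lemma orderable_cut_both : tight e s A C -> tight e s B C ->
  (exists u c, exits e C u c && (u \in A)) -> (exists u c, exits e C u c && (u \in B)) -> orderable C.
Proof.
move=> tA tB exA exB.
have [u1 [c1 [u2 [c2 [[ex1 ex2 u1A u2A u12] [rng sep]]]]]] := cut_exits eS AS R exA exB.
have [P [[c1P c2P uP sP PC] [gP endP]]] := geodesic_between (regC R) (exit_mem ex1) (exit_mem ex2).
apply: (orderable_cut_step c1P uP PC gP tA tB) => C' C'C _ C'c.
have C'sub := proper_sub C'C.
have cC' u c : exits e C' u c -> c \in C' by case/and3P.
have u2s : index u2 A < size A by rewrite index_mem.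
(* By [sep] a component with an exit at [A] has none at [B]. It is attached to [P] and a segment of
   the tight [A], or else to [P] and the tight [B]. *)
case: (boolP [exists u, [exists c, exits e C' u c && (u \in A)]]) => [|nA].
  case/existsP=> u /existsP[c /andP[exu uA]].
  exists (seg A (index u1 A) (index u2 A)), P; split; last first.
    left; exact/(tightS C'sub)/(tight_seg (regAu R)).
  apply: (region_between eS R ex1 ex2) => // w d exw.
  case: (component_exits C'c exw) => [|exw']; first by rewrite inE => ->; rewrite orbT.
  rewrite mem_seg ?(regAu R) //; case/orP: (regN R exw') => [wA|wB].
    by rewrite wA (rng _ _ exw' wA).
  have exu' : exits e C u c.
    case: (component_exits C'c exu) => //; rewrite inE => /PC uC.
    by move: (regAC R uA); rewrite uC.
  have [_ C'sP C'cn _] := C'c.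
  have Pc : connected e [set z in P] by exact: sorted_connected.
  have PsC : [set z in P] \subset C by apply/subsetP => z; rewrite inE => /PC.
  have c1P' : c1 \in [set z in P] by rewrite inE.
  have c2P' : c2 \in [set z in P] by rewrite inE.
  by case: (sep _ _ Pc PsC c1P' c2P' C'cn C'sP u c w d exu' exw' (cC' _ _ exu) (cC' _ _ exw) uA wB).
exists P, B; split; last by right; exact: (tightS C'sub tB).
apply: (region_beyond eS R ex1 ex2) => // w d exw.
case: (component_exits C'c exw) => [|exw']; first by rewrite inE => ->.
case/orP: (regN R exw') => [wA|->]; last by rewrite orbT.
by case/existsP: nA; exists w; apply/existsP; exists d; rewrite exw.
Qed.

(** With no exit at [B] every component lies between [A] and [P], so exits extremal along [A]
    suffice and no separation is called for. *)
Lemma orderable_cut_single : tight e s A C -> tight e s B C ->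
  (exists u c, exits e C u c && (u \in A)) -> ~ (exists u c, exits e C u c && (u \in B)) -> orderable C.
Proof.
move=> tA tB [ua [ca /andP[exa uaA]]] nB.
pose ok (p : V * V) := exits e C p.1 p.2 && (p.1 \in A).
have okA : ok (ua, ca) by rewrite /ok exa.
case: (arg_minnP (fun p => index p.1 A) okA) => -[u1 c1] /andP[/= ex1 u1A] pmin.
case: (arg_maxnP (fun p => index p.1 A) okA) => -[u2 c2] /andP[/= ex2 u2A] pmax.
have rng u c : exits e C u c -> u \in A -> index u1 A <= index u A <= index u2 A.
  move=> ex uA; rewrite (pmin (u, c)) /= ?(pmax (u, c)) //; by rewrite /ok /= ex.
have [P [[c1P c2P uP sP PC] [gP endP]]] := geodesic_between (regC R) (exit_mem ex1) (exit_mem ex2).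
apply: (orderable_cut_step c1P uP PC gP tA tB) => C' C'C _ C'c.
have u2s : index u2 A < size A by rewrite index_mem.
have u12 : index u1 A <= index u2 A by case/andP: (rng _ _ ex2 u2A).
exists (seg A (index u1 A) (index u2 A)), P; split; last first.
  left; exact/(tightS (proper_sub C'C))/(tight_seg (regAu R)).
apply: (region_between eS R ex1 ex2) => // w d exw.
case: (component_exits C'c exw) => [|exw']; first by rewrite inE => ->; rewrite orbT.
rewrite mem_seg ?(regAu R) //; case/orP: (regN R exw') => [wA|wB].
  by rewrite wA (rng _ _ exw' wA).
by case: nB; exists w, d; rewrite exw'.
Qed.

(** [X] itself is ordered first. The tight [A] contributes [2s], and [B] and [X] together [3s+1].
    Every remaining region has a tight parent: the bypassed stretch in a pocket, [A] elsewhere. *)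
Lemma orderable_reroute x0 y0 X : tight e s A C ->
  [/\ x0 \in B, y0 \in B, path e x0 (rcons X y0), {subset X <= C} & 0 < size X] ->
  [/\ (size X).+1 <= 2 * s, index y0 B = index x0 B + (size X).+1 &
    forall x' y' q, x' \in B -> y' \in B -> path e x' (rcons q y') -> {subset q <= C} ->
      0 < size q -> (size q).+1 <= 2 * s -> index y' B = index x' B + (size q).+1 ->
      size X <= size q] -> orderable C.
Proof.
move=> tA [x0B y0B pX XC X0] [X2 ixy Xmin].
have uX := uniq_alternate (regBg R) x0B y0B pX XC ixy.
have [p pX'] : exists p, p \in X by case: (X) X0 => // p X' _; exists p; rewrite mem_head.
have gB := regBg R.
have memB' := mem_rerouted R x0B y0B pX uX X0 ixy.
have oldB' := index_rerouted_old R x0B y0B XC ixy.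
have newB' z : z \in X -> index z (rerouted B X x0 y0) = (index x0 B).+1 + index z X.
  exact: (index_rerouted_new y0 R x0B XC).
have szB' := size_rerouted x0B y0B ixy.
have uB' := uniq_rerouted R x0B y0B pX uX XC X0 ixy.
have y0s : index y0 B < size B by rewrite index_mem.
apply: (orderable_step eS uX XC) => [P1 v P2 eX|C' C'c]; last first.
  have C'p := comp_proper pX' XC C'c; have he := comp_has_exit pX' XC C'c.
  have C'sub := proper_sub C'p; have [_ C'sX C'cn _] := C'c.
  have cC' u c : exits e C' u c -> c \in C' by case/and3P.
  have old u c : exits e C' u c -> u \in A \/ u \in B -> exits e C u c.
    move=> ex uAB; case: (component_exits C'c ex) => //; rewrite inE => /XC uC.
    by case: uAB => [/(regAC R)|/(regBC R)]; rewrite uC.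
  case: (boolP [exists u, [exists c, exits e C' u c && ((u \in B) &&
           (index x0 B < index u B < index y0 B))]]) => [|nP].
    case/existsP=> u /existsP[c /and3P[exu uB ui]].
    have i0 : index x0 B <= index y0 B by move: ixy; slia.
    have i1 : (index x0 B).+1 <= (index y0 B).-1 by move: ixy X0; slia.
    have i2 : (index y0 B).-1 < size B by move: y0s; slia.
    have i3 : index y0 B < size (rerouted B X x0 y0) by rewrite szB'.
    have R' : region e C' (seg B (index x0 B).+1 (index y0 B).-1)
        (seg (rerouted B X x0 y0) (index x0 B) (index y0 B)).
      apply: (region_pocket eS R x0B y0B pX uX XC X0 ixy C'c) => w d exw.
      rewrite (mem_seg (regBu R) i1 i2) (mem_seg uB' i0 i3) memB'.
      case: (component_exits C'c exw) => [|exw'].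
        rewrite inE => wX; rewrite wX newB' //=.
        have wX' : index w X < size X by rewrite index_mem.
        apply/orP; right.
        by move: wX' ixy; slia.
      have : (w \in B) && (index x0 B <= index w B <= index y0 B).
        apply/negPn/negP => nw.
        have ij : index x0 B < index y0 B by move: ixy; slia.
        apply: (reroute_separation eS AS R x0B y0B pX XC X0 ij C'cn C'sX (old _ _ exu (or_intror uB))
          exw' (cC' _ _ exu) (cC' _ _ exw) uB ui).
        case/orP: (regN R exw') => wAB; rewrite wAB //; apply/orP; right.
        by move: nw; rewrite wAB /=; slia.
      case/andP=> wB wi; rewrite wB /=.
      case: (boolP (index x0 B < index w B < index y0 B)) => wi'.
        by apply/orP; left; move: wi'; slia.
      have wj : (index w B <= index x0 B) || (index y0 B <= index w B) by move: wi wi'; slia.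
      by rewrite oldB' // wj wi !orbT.
    (* A violation of tightness between two inner vertices of the bypassed stretch would be an
       alternate route shorter than [X]. *)
    apply: (IH C'p R' he); left; apply: (tightS C'sub) => x y q xM yM pq qC q0 q2.
    rewrite !(index_seg (regBu R) i1 i2) //.
    move: xM yM; rewrite !(mem_seg (regBu R) i1 i2) => /andP[xB xi] /andP[yB yi].
    apply/eqP => xy; have xy' : index y B = index x B + (size q).+1 by move: xy xi yi; slia.
    by have := Xmin _ _ _ xB yB pq qC q0 q2 xy'; move: xy' xi yi ixy; slia.
  have R' : region e C' A (rerouted B X x0 y0).
    apply: (region_outside eS R x0B y0B pX uX XC X0 ixy C'c) => w d exw; rewrite memB'.
    case: (component_exits C'c exw) => [|exw']; first by rewrite inE => ->; rewrite orbT.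
    case/orP: (regN R exw') => [->//|wB]; rewrite wB /=.
    case: (boolP (index x0 B < index w B < index y0 B)) => wi.
      by case/existsP: nP; exists w; apply/existsP; exists d; rewrite exw wB.
    by apply/orP; right; apply/orP; right; move: wi; slia.
  by apply: (IH C'p R' he); left; exact: (tightS C'sub tA).
have vX : v \in X by rewrite eX mem_cat mem_head orbT.
have [vP1 vP2] : v \notin P1 /\ v \notin P2.
  by have := uX; rewrite eX cat_uniq /= negb_or => /and3P[_ /andP[-> _] /andP[->]].
have kv : index v X = size P1 by rewrite eX index_cat (negbTE vP1) /= eqxx addn0.
have sX : size X = size P1 + (size P2).+1 by rewrite eX size_cat.
set Z := _ :|: _.
have ZC : Z \subset C.
  apply/subsetP => z; rewrite !inE => /orP[zP2|/andP[]//]; apply: XC.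
  by rewrite eX mem_cat inE zP2 !orbT.
apply: leq_trans (subset_leq_card (reached_region R (XC _ vX) ZC)) _.
have AC : {subset A <= ~: C} by move=> z /(regAC R); rewrite inE.
have [_ /(_ tA) cA] := reach_window eS s ZC (XC _ vX) AC (regAg R).
have gX : geodesic e X C.
  have gB' := geodesic_rerouted R x0B y0B pX uX XC X0 ixy.
  move=> x y q xX yX pq qC; have mB' z : z \in X -> z \in rerouted B X x0 y0 by rewrite memB' => ->.
  by have := gB' _ _ _ (mB' _ xX) (mB' _ yX) pq qC; rewrite !newB' //; slia.
have ownX w : w \in C :\: Z -> (w \in X) && (index w X <= index v X).
  rewrite !inE negb_or negb_and negbK => /andP[/andP[wP2 /orP[wX|wC]] wC']; last by rewrite wC' in wC.
  rewrite wX kv /= eX index_cat; case: ifP => wP1; first by rewrite ltnW // index_mem.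
  by move: wX; rewrite eX mem_cat wP1 inE (negbTE wP2) orbF /= => /eqP->; rewrite eqxx addn0.
have own := own_window gX vX ZC ownX.
have [p1 p2] : path e x0 (rcons P1 v) /\ path e v (rcons P2 y0).
  by move: pX; rewrite eX rcons_cat -cat_rcons cat_path last_rcons => /andP[].
set RB := [set w in B | _].
(* On the rerouted geodesic [v] has position [index x0 B + (size P1).+1]. In the last clause,
   equality would give a route from [w] through [v] to [y0] that is an alternate shorter than
   [X]. *)
have RBP w : w \in RB -> [/\ w \in B, index w B <= index x0 B + (size P1).+1 + s,
    index x0 B + (size P1).+1 <= index w B + s &
    (index x0 B < index w B -> index x0 B + (size P1).+1 < index w B + s)].
  rewrite inE => /andP[wB /reachP[vw|[q [pq /= qZ sq]]]].
    by move: (regBC R wB); rewrite -vw XC.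
  have qC : {subset q <= C} by move=> z /qZ; apply: (subsetP ZC).
  have w1 : path e x0 (rcons (P1 ++ v :: q) w) by rewrite rcons_cat -cat_rcons cat_path last_rcons p1.
  have w2 : path e w (rcons (rev q ++ v :: P2) y0).
    by rewrite rcons_cat -cat_rcons cat_path last_rcons rev_walk.
  have s1 : {subset P1 ++ v :: q <= C}.
    move=> z; rewrite mem_cat inE => /or3P[zP|/eqP->|/qC//]; apply: XC => //.
    by rewrite eX mem_cat zP.
  have s2 : {subset rev q ++ v :: P2 <= C}.
    move=> z; rewrite mem_cat mem_rev inE => /or3P[/qC//|/eqP->|zP]; apply: XC => //.
    by rewrite eX mem_cat inE zP !orbT.
  have g1 := gB _ _ _ x0B wB w1 s1; have g2 := gB _ _ _ wB y0B w2 s2.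
  have m2 := Xmin _ _ _ wB y0B w2 s2.
  rewrite !size_cat size_rev /= in g1 g2 m2.
  split=> //; try by move: g1 g2 ixy sX sq; slia.
  move=> xw; rewrite ltn_neqAle; apply/andP; split; last by move: g1 g2 ixy sX sq; slia.
  apply/eqP => eq.
  have a1 : 0 < size q + (size P2).+1 by slia.
  have a2 : (size q + (size P2).+1).+1 <= 2 * s by move: eq g2 ixy sX sq xw X2; slia.
  have a3 : index y0 B = index w B + (size q + (size P2).+1).+1 by move: eq g2 ixy sX sq; slia.
  by have := m2 a1 a2 a3; move: eq g2 ixy sX sq xw; slia.
have RBs : {subset RB <= B} by move=> w /RBP[].
(* If [v] has at least [s] predecessors on [X], the window on [B] starts to the right of [x0] and
   loses its lowest position. Otherwise at most [s] vertices of [X] count, which compensates for the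
   full window [2s+1]. *)
have key : #|[set w in C :\: Z | reach e Z s v w]| + #|RB| <= 3 * s + 1.
  case: (leqP s (size P1)) => sP1.
    have : #|RB| <= 2 * s.
      apply: (@card_interval _ B _ (index x0 B + (size P1).+1 - s).+1) => // w /RBP[_ b1 b2 b3].
      by move: b1 b2 b3 sP1; slia.
    by move: own; slia.
  have : #|RB| <= 2 * s + 1.
    apply: (@card_interval _ B _ (index x0 B + (size P1).+1 - s)) => // w /RBP[_ b1 b2 b3].
    by move: b1 b2 b3 sP1; slia.
  have : #|[set w in C :\: Z | reach e Z s v w]| <= (size P1).+1.
    apply: (@card_interval _ X _ 0) => [w|w]; rewrite inE => /andP[/ownX/andP[]//].
    by rewrite kv add0n ltnS.
  by move: sP1; slia.
apply: leq_trans (leq_card_setU _ _) _; apply: leq_trans (leq_add (leqnn _) (leq_card_setU _ _)) _.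
by move: key cA; slia.
Qed.

End Step.

Lemma orderable_region (C : {set V}) A B : region e C A B -> has_exit C ->
  tight e s A C \/ tight e s B C -> orderable C.
Proof.
have [n] := ubnP #|C|; elim: n C A B => // n IHn C A B ltC R he t.
have IH (C' : {set V}) (A' B' : seq V) : C' \proper C -> region e C' A' B' -> has_exit C' ->
    tight e s A' C' \/ tight e s B' C' -> orderable C'.
  by move=> /proper_card lt; apply: IHn; apply: leq_trans lt _; rewrite -ltnS.
have [tA|[x [y [X [h1 h2]]]]] := tight_or_alternate (regAg R); last first.
  case: t => [tA|tB]; last exact: (orderable_reroute (region_sym R) IH tB h1 h2).
  case: h1 h2 => xA yA pX XC X0 [X2 ixy _].
  by have := tA _ _ _ xA yA pX XC X0 X2; rewrite ixy eqxx.
have [tB|[x [y [X [h1 h2]]]]] := tight_or_alternate (regBg R); last first.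
  exact: (orderable_reroute R IH tA h1 h2).
have dec (D : seq V) : (exists u c, exits e C u c && (u \in D)) \/
    ~ (exists u c, exits e C u c && (u \in D)).
  case: (boolP [exists u, [exists c, exits e C u c && (u \in D)]]) => h; [left|right].
    by have /existsP[u /existsP[c uc]] := h; exists u, c.
  by case=> u [c uc]; case/existsP: h; exists u; apply/existsP; exists c.
case: (dec A) => exA; case: (dec B) => exB.
- exact: (orderable_cut_both R IH tA tB exA exB).
- exact: (orderable_cut_single R IH tA tB exA exB).
- exact: (orderable_cut_single (region_sym R) IH tB tA exB exA).
case: he => u [c ex]; case/orP: (regN R ex) => uAB.
  by case: exA; exists u, c; rewrite ex.
by case: exB; exists u, c; rewrite ex.
Qed.

Theorem orderable_setT : orderable [set: V].
Proof.
apply: orderable_components => // K Kc; have [/set0Pn[a aK] _ Kcn clK] := Kc.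
(* An edge [ab] starts the recursion: each component left after removing it is a region between the
   one-vertex geodesics [[:: a]] and [[:: b]], which are tight. *)
case: (boolP [exists b in K, e a b]) => [/existsP[b /andP[bK ab]]|/existsPn nb]; last first.
  have Ka : K = [set a].
    apply/setP => z; rewrite inE; apply/idP/eqP => [zK|->//].
    have /connectP[[|y p] //= /andP[/and3P[_ yK ay] _] _] := Kcn _ _ aK zK.
    by have := nb y; rewrite yK ay.
  exists [:: a]; split=> // [z|/=]; first by rewrite Ka !inE.
  rewrite andbT; apply: leq_trans (_ : #|[set a]| <= _); last by rewrite cards1 addn1.
  apply/subset_leq_card/subsetP => w; rewrite !inE /= => /reachP[->//|[q [pq qZ _]]].
  case: q pq qZ => [|z q]; last by move=> _ /(_ z); rewrite !inE eqxx => /(_ isT).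
  by rewrite /= andbT => aw _; have := nb w; rewrite (clK a w) // aw.
have nab : a != b by apply: contraTneq ab => ->; rewrite eI.
have PK : {subset [:: a; b] <= K} by move=> z; rewrite !inE => /orP[] /eqP->.
have uP : uniq [:: a; b] by rewrite /= inE nab.
apply: (orderable_step eS uP PK) => [P1 v P2 eP|C' C'c].
  have vP : v \in [:: a; b] by rewrite eP mem_cat mem_head orbT.
  set Z := _ :|: _.
  have ZK : {subset Z <= K}.
    move=> z; rewrite !inE => /orP[zP|/andP[]//]; apply: PK.
    by rewrite eP mem_cat inE zP !orbT.
  apply: leq_trans (_ : #|[set a; b]| <= _); last by rewrite cards2 nab; lia.
  apply/subset_leq_card/subsetP => w; rewrite inE => /andP[wZ h].
  have wK : w \in K.
    have [<-|[q [pq qZ _]]] := reachP _ _ _ _ _ h; first exact: PK.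
    apply: (clK (last v q)) => //; last by move: pq; rewrite rcons_path => /andP[].
    by have := mem_last v q; rewrite inE => /predU1P[->|/qZ/ZK//]; exact: PK.
  by move: wZ; rewrite !inE wK andbT negb_or negbK => /andP[].
have [_ /subsetP C'K C'cn _] := C'c.
have aC' : a \notin C' by apply/negP => /C'K; rewrite !inE eqxx.
have bC' : b \notin C' by apply/negP => /C'K; rewrite !inE eqxx orbT.
have R : region e C' [:: a] [:: b].
  split=> //; try exact: geodesic1.
  - move=> u c ex; case: (component_exits C'c ex) => [|/and3P[uK cK uc]]; first by rewrite !inE.
    by move: uK; rewrite (clK c u) // eS.
  - by move=> x; rewrite inE => /eqP->.
  - by move=> x; rewrite inE => /eqP->.
  - by move=> x; rewrite inE => /eqP->; rewrite inE.
  - move=> x /andP[]; rewrite inE => /eqP-> _; exists b; rewrite ?mem_head //.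
    by apply: connect_restr1; rewrite // !inE ?aC' ?bC' ?eqxx ?orbT //= eq_sym nab.
  move=> x /andP[]; rewrite inE => /eqP-> _; exists a; rewrite ?mem_head //.
  by apply: connect_restr1; rewrite ?inE ?aC' ?bC' ?eqxx ?orbT ?nab //= 1?eS.
apply: (orderable_region R); last by left; apply: tight1.
have [|||u [c /andP[ex _]]] := @component_exit K C' [set z in [:: a; b]] a Kcn.
- by rewrite !inE eqxx.
- by apply/subsetP => z; rewrite inE => /PK.
- by [].
by exists u, c.
Qed.
End Scol.

(** * Weak reachability *)

Section Decomposition.
Variables (V : finType) (e : rel V).
Hypothesis (eS : symmetric e).

(* Blocks 0, .., dn - 1 are geodesics covering dU; blk x is the block of x, pos x its position
   there, and the earlier blocks adjacent to block i are among p1 i and p2 i (i itself when absent). *)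
Record decomp := Decomp {
  dn : nat; dU : {set V}; blk : V -> nat; pos : V -> nat; p1 : nat -> nat; p2 : nat -> nat }.

Definition parent (d : decomp) i j := (j == p1 d i) || (j == p2 d i).
Definition linked (d : decomp) i j := [|| i == j, parent d i j | parent d j i].

(** [v_linked] underlies the binomial count: the two parents of a block are equal or parent and
    child. In [v_geod] the walks may use uncovered vertices, so blocks added later cannot violate
    it. *)
Record valid (d : decomp) : Prop := Valid {
  v_lt : forall x, x \in dU d -> blk d x < dn d;
  v_edge : forall x y, x \in dU d -> y \in dU d -> e x y -> blk d y < blk d x ->
    parent d (blk d x) (blk d y);
  v_linked : forall i, linked d (p1 d i) (p2 d i);
  v_le : forall i, (p1 d i <= i) && (p2 d i <= i);
  v_out : forall i, dn d <= i -> p1 d i = i /\ p2 d i = i;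
  v_geod : forall x y q, x \in dU d -> y \in dU d -> blk d x = blk d y -> path e x (rcons q y) ->
    (forall z, z \in q -> (z \notin dU d) || (blk d x <= blk d z)) ->
    pos d y <= pos d x + (size q).+1;
  v_inj : forall x y, x \in dU d -> y \in dU d -> blk d x = blk d y -> pos d x = pos d y -> x = y }.

Record extends (d d' : decomp) : Prop := Extends {
  x_n : dn d <= dn d';
  x_U : dU d \subset dU d';
  x_old : forall x, x \in dU d -> blk d' x = blk d x;
  x_new : forall x, x \in dU d' -> x \notin dU d -> dn d <= blk d' x;
  x_p : forall i, i < dn d -> p1 d' i = p1 d i /\ p2 d' i = p2 d i }.

Lemma extends_refl d : extends d d.
Proof. by split=> // x ->. Qed.

Lemma extends_trans d1 d2 d3 : valid d1 -> extends d1 d2 -> extends d2 d3 -> extends d1 d3.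
Proof.
move=> v1 [n12 U12 o12 w12 p12] [n23 U23 o23 w23 p23]; split.
- exact: leq_trans n23.
- exact: subset_trans U23.
- by move=> x xU; rewrite o23 ?o12 // (subsetP U12).
- move=> x x3 x1; case: (boolP (x \in dU d2)) => x2; first by rewrite o23 ?w12.
  by apply: leq_trans n12 _; apply: w23.
by move=> i i1; have [-> ->] := p23 i (leq_trans i1 n12); apply: p12.
Qed.

(** The alternative [a = b = dn d] creates a block without parents, which starts a component of the
    graph. *)
Lemma add_block d (P : seq V) a b : valid d -> uniq P -> (forall x, x \in P -> x \notin dU d) ->
  geodesic e P (~: dU d) ->
  (forall x y, x \in P -> y \in dU d -> e x y -> (blk d y == a) || (blk d y == b)) ->
  [&& a < dn d, b < dn d & linked d a b] || (a == dn d) && (b == dn d) ->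
  exists d', [/\ valid d', extends d d', dU d' = dU d :|: [set z in P] & dn d' = (dn d).+1] /\
   [/\ forall x, x \in P -> blk d' x = dn d, p1 d' (dn d) = a & p2 d' (dn d) = b].
Proof.
move=> vd uP PU gP eP ab; set n := dn d in ab *.
have [an bn] : a <= n /\ b <= n.
  by case/orP: ab => [/and3P[/ltnW-> /ltnW->]|/andP[/eqP-> /eqP->]].
pose d' := Decomp n.+1 (dU d :|: [set z in P]) (fun x => if x \in P then n else blk d x)
  (fun x => if x \in P then index x P else pos d x)
  (fun i => if i == n then a else p1 d i) (fun i => if i == n then b else p2 d i).
have UP x : x \in dU d -> (x \in P) = false.
  by move=> xU; apply/negP => /PU; rewrite xU.
have par_old i j : i < n -> parent d' i j = parent d i j.
  by move=> i1; rewrite /parent /= (ltn_eqF i1).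
have link_old i j : i < n -> j < n -> linked d' i j = linked d i j.
  by move=> i1 j1; rewrite /linked !par_old.
have ltU x : x \in dU d -> blk d x < n := v_lt vd (x := x).
exists d'; split; split=> //=; rewrite ?eqxx //; last by move=> x ->.
  split=> /=.
  - move=> x; rewrite !inE => /orP[xU|->]; last exact: ltnSn.
    by rewrite (UP x xU) ltnS ltnW // ltU.
  - move=> x y; rewrite !inE => xU yU xy.
    case: (boolP (x \in P)) xU => xP; case: (boolP (y \in P)) yU => yP; rewrite ?orbT ?orbF.
    + by rewrite ltnn.
    + by move=> yU _ _; rewrite /parent /= eqxx; apply: (eP x y xP yU xy).
    + by move=> _ xU; rewrite ltnNge (ltnW (ltU x xU)).
    + move=> yU xU lt; rewrite par_old ?ltU //; exact: v_edge.
  - move=> i; case: ltngtP => [lt|gt|_].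
    + have /andP[l1 l2] := v_le vd i.
      by rewrite link_old ?(leq_ltn_trans _ lt) // (v_linked vd).
    + by have [-> ->] := v_out vd (ltnW gt); rewrite /linked eqxx.
    + case/orP: ab => [/and3P[al bl ll]|/andP[/eqP-> /eqP->]]; last by rewrite /linked eqxx.
      by rewrite link_old.
  - by move=> i; case: eqP => [->|_]; rewrite ?an ?bn // (v_le vd).
  - move=> i lt; rewrite (gtn_eqF lt); exact: (v_out vd (ltnW lt)).
  - move=> x y q; rewrite !inE => xU yU.
    have old z : z \in dU d -> (n == blk d z) = false by move=> zU; rewrite gtn_eqF // ltU.
    case: (boolP (x \in P)) xU => xP; case: (boolP (y \in P)) yU => yP; rewrite ?orbT ?orbF.
    + move=> _ _ _ pq qU; apply: gP => // z zq; rewrite inE; apply/negP => zU.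
      by have := qU z zq; rewrite !inE zU (UP z zU) /= leqNgt ltU.
    + by move=> yU _ /eqP; rewrite old.
    + by move=> _ xU /esym/eqP; rewrite old.
    + move=> yU xU exy pq qU; apply: (v_geod vd) => // z zq.
      have := qU z zq; rewrite !inE; case: (boolP (z \in dU d)) => //= zU.
      by rewrite (UP z zU).
  - move=> x y; rewrite !inE => xU yU.
    have old z : z \in dU d -> (n == blk d z) = false by move=> zU; rewrite gtn_eqF // ltU.
    case: (boolP (x \in P)) xU => xP; case: (boolP (y \in P)) yU => yP; rewrite ?orbT ?orbF.
    + by move=> _ _ _; apply: (index_inj x).
    + by move=> yU _ /eqP; rewrite old.
    + by move=> _ xU /esym/eqP; rewrite old.
    + by move=> yU xU; apply: (v_inj vd).
split=> //=.
- exact: subsetUl.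
- by move=> x xU; rewrite UP.
- by move=> x; rewrite !inE => /orP[->//|->].
- by move=> i lt; rewrite (ltn_eqF lt).
Qed.

(** Components are treated in turn, each on top of the blocks made for the earlier ones; hence the
    quantification over all extensions of [d]. *)
Lemma decomp_components (D : {set V}) d : valid d ->
  (forall C d', component e D C -> valid d' -> extends d d' -> [disjoint dU d' & C] ->
    exists d'', [/\ valid d'', extends d' d'' & dU d'' = dU d' :|: C]) ->
  forall d', valid d' -> extends d d' -> [disjoint dU d' & D] ->
    exists d'', [/\ valid d'', extends d' d'' & dU d'' = dU d' :|: D].
Proof.
move=> vd; have [n] := ubnP #|D|; elim: n D => // n IHn D ltD H d' vd' E dis.
have [->|[x xD]] := set_0Vmem D.
  by exists d'; split; rewrite ?setU0 //; apply: extends_refl.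
have [C Cc xC] := component_exists eS xD; have [_ CD _ clC] := Cc.
have [d1 [vd1 E1 U1]] := H C d' Cc vd' E (disjointWr CD dis).
have E01 := extends_trans vd E E1.
have lt : #|D :\: C| < n.
  suff : #|D :\: C| < #|D| by move: ltD; lia.
  by apply: proper_card; apply/properP; split; [apply: subsetDl|exists x; rewrite ?inE ?xC].
have [||d2 [vd2 E2 U2]] := IHn _ lt _ d1 vd1 E01.
- move=> C' d3 [C'0 C'D C'c clC'] vd3 E3 dis3; apply: (H C') => //; split=> //.
    by apply: subset_trans C'D (subsetDl _ _).
  move=> c y cC' yD cy; apply: (clC' c) => //; rewrite inE yD andbT; apply/negP => yC.
  have /setDP[cD] := subsetP C'D _ cC'.
  by move=> /negP; apply; apply: (clC y c) => //; rewrite eS.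
- rewrite U1; apply/pred0P => z /=; rewrite !inE; apply/negP => /andP[/orP[zU|zC] /andP[nzC zD]].
    by rewrite (disjointFr dis zU) in zD.
  by rewrite zC in nzC.
exists d2; split=> //; first exact: extends_trans E2.
rewrite U2 U1 -setUA; congr (_ :|: _); apply/setP => z; rewrite !inE.
by case: (boolP (z \in C)) => //= zC; rewrite (subsetP CD).
Qed.
End Decomposition.

(** * Existence of a geodesic decomposition *)

Section Existence.
Variables (V : finType) (e : rel V).
Hypothesis (eS : symmetric e) (AS : arc_separation e).
Notation decomp := (decomp V).
Notation valid := (valid e).

Definition block (d : decomp) i := [set x in dU d | blk d x == i].

Lemma block_extends d d' i : extends d d' -> i < dn d -> block d' i = block d i.
Proof.
move=> E lt; apply/setP => x; rewrite !inE; case: (boolP (x \in dU d)) => xU.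
  by rewrite (subsetP (x_U E)) // (x_old E).
case: (boolP (x \in dU d')) => //= xU'.
by rewrite gtn_eqF // (leq_trans lt) // (x_new E).
Qed.

(** A walk that starts in [C] and avoids [U] cannot leave [C], since all exits lie in [U]. *)
Lemma geodesic_outside (C U : {set V}) (P : seq V) : {subset P <= C} -> geodesic e P C ->
  (forall u c, exits e C u c -> u \in U) -> geodesic e P (~: U).
Proof.
move=> PC gP CU x y q xP yP pq qU; apply: gP => //.
have key z q' : z \in C -> path e z (rcons q' y) -> {subset q' <= ~: U} -> {subset q' <= C}.
  elim: q' z => //= v q' IHq z zC /andP[zv pq'] q'U w.
  have vC : v \in C.
    apply/negPn/negP => vC; have := q'U v; rewrite mem_head inE => /(_ isT).
    by rewrite (CU v z) // /exits zC vC eS.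
  rewrite inE => /predU1P[->//|]; apply: (IHq v vC pq') => w' w'q.
  by apply: q'U; rewrite inE w'q orbT.
exact: key (PC _ xP) pq qU.
Qed.

(** The counterpart of [region]: the parents are whole blocks, and the last clause joins them
    outside [C], as the cyclic order requires. *)
Definition attached (d : decomp) (C : {set V}) a b :=
  [/\ connected e C, [disjoint dU d & C],
    (forall u c, exits e C u c -> (u \in block d a) || (u \in block d b)) &
    (forall x y, x \in block d a -> y \in block d b -> connect (restr e (~: C)) x y)].

Definition completes (d : decomp) (C : {set V}) :=
  exists d', [/\ valid d', extends d d' & dU d' = dU d :|: C].

Definition extendable m := forall (C : {set V}) d a b, #|C| < m -> valid d -> a < dn d -> b < dn d ->
  linked d a b -> has_exit e C -> connected e (block d a) -> connected e (block d b) ->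
  attached d C a b -> completes d C.

(** [P] becomes a block with parents [a] and [b]. A remaining component sees only [P], or [P] and
    one old block [t] among its parents; in either case its two blocks are linked again. *)
Lemma add_geodesic m (C : {set V}) d a b (P : seq V) p : extendable m -> #|C| < m.+1 -> valid d ->
  [&& a < dn d, b < dn d & linked d a b] || (a == dn d) && (b == dn d) ->
  connected e C -> [disjoint dU d & C] ->
  (forall u c, exits e C u c -> (u \in block d a) || (u \in block d b)) ->
  p \in P -> uniq P -> sorted e P -> {subset P <= C} -> geodesic e P C ->
  (forall C', component e (C :\: [set z in P]) C' ->
    (forall u c, exits e C' u c -> u \in P) \/
    exists t, [/\ t < dn d, (t == a) || (t == b), connected e (block d t),
      forall u c, exits e C' u c -> (u \in P) || (u \in block d t) &
      exists2 c1, c1 \in P & forall x, x \in block d t -> connect (restr e (~: C')) x c1]) ->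
  completes d C.
Proof.
move=> IH ltC vd ab Cc dis N pP uP sP PC gP split_comp.
have NU u c : exits e C u c -> u \in dU d.
  by move/N; rewrite !inE => /orP[/andP[]|/andP[]].
have PU x : x \in P -> x \notin dU d by move=> /PC xC; rewrite (disjointFl dis xC).
have eP x y : x \in P -> y \in dU d -> e x y -> (blk d y == a) || (blk d y == b).
  move=> xP yU xy; have /N : exits e C y x.
    by rewrite /exits (disjointFr dis yU) PC //= eS.
  by rewrite !inE yU.
have [d1 [[vd1 E1 U1 n1] [blkP p1n p2n]]] :=
  add_block vd uP PU (geodesic_outside PC gP NU) eP ab.
have old_lt t : t < dn d -> t < dn d1 by rewrite n1; apply: leqW.
have blockP : block d1 (dn d) = [set z in P].
  apply/setP => z; rewrite !inE U1 !inE; case: (boolP (z \in P)) => zP.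
    by rewrite orbT blkP // eqxx.
  rewrite orbF; apply/andP => -[zU]; rewrite (x_old E1 zU) => /eqP bz.
  by have := v_lt vd zU; rewrite bz ltnn.
have [d2 [vd2 E2 U2]] : completes d1 (C :\: [set z in P]).
  apply: (decomp_components eS vd1) => //; last 2 first.
  - exact: extends_refl.
  - rewrite U1; apply/pred0P => z /=; rewrite !inE; apply/negP => /andP[/orP[zU|zP] /andP[nzP zC]].
      by rewrite (disjointFr dis zU) in zC.
    by rewrite zP in nzP.
  move=> C' d3 C'c vd3 E3 dis3.
  have E03 := extends_trans vd E1 E3.
  have [_ C'D C'cn _] := C'c.
  have C'C : {subset C' <= C} by move=> z /(subsetP C'D); rewrite inE => /andP[].
  have C'P z : z \in P -> z \notin C'.
    by move=> zP; apply/negP => /(subsetP C'D); rewrite !inE zP.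
  have ltC' : #|C'| < m.
    suff : #|C'| < #|C| by move: ltC; lia.
    apply: proper_card; apply/properP; split; first exact/subsetP.
    by exists p; [apply: PC|apply: C'P].
  have he : has_exit e C'.
    have [|||u [c /andP[ex _]]] := @component_exit _ e eS C C' [set z in P] p Cc.
    - by rewrite inE.
    - by apply/subsetP => z; rewrite inE => /PC.
    - by [].
    by exists u, c.
  have lt3 : dn d < dn d3 by apply: leq_trans (x_n E3); rewrite n1.
  have blockP3 : block d3 (dn d) = [set z in P] by rewrite (block_extends E3) // n1.
  have Pc : connected e (block d3 (dn d)) by rewrite blockP3; exact: sorted_connected.
  have PcC' x y : x \in P -> y \in P -> connect (restr e (~: C')) x y.
    move=> xP yP; apply: connect_restrS (sorted_connected eS sP _ _); rewrite ?inE //.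
    by move=> z; rewrite !inE => /C'P.
  case: (split_comp C' C'c) => [exP|[t [lt tab tc N' [c1 c1P tP]]]].
    apply: (IH C' d3 (dn d) (dn d)) => //; first by rewrite /linked eqxx.
    split=> // [u c /exP uP'|x y]; first by rewrite blockP3 inE uP'.
    by rewrite blockP3 !inE; apply: PcC'.
  have tE : block d3 t = block d t := block_extends E03 lt.
  apply: (IH C' d3 t (dn d)) => //.
  - exact: leq_trans lt (x_n E03).
  - rewrite /linked /parent; have [|-> ->] := x_p E3 (i := dn d); first by rewrite n1.
    by rewrite p1n p2n; case/orP: tab => ->; rewrite ?orbT.
  - by rewrite tE.
  split=> // [u c /N'|x y]; first by rewrite tE blockP3 inE orbC.
  rewrite tE blockP3 inE => xt yP.
  exact: connect_trans (tP x xt) (PcC' _ _ c1P yP).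
exists d2; split=> //; first exact: (extends_trans vd E1 E2).
rewrite U2 U1 -setUA; congr (_ :|: _); apply/setP => z; rewrite !inE.
by case: (boolP (z \in P)) => //= /PC->.
Qed.

Lemma extendable_all m : extendable m.
Proof.
elim: m => // m IHm C d a b ltC vd al bl ab [u0 [c0 ex0]] ac bc [Cc dis N link].
have abP : [&& a < dn d, b < dn d & linked d a b] || (a == dn d) && (b == dn d).
  by rewrite al bl ab.
have inU t z : z \in block d t -> z \in dU d by rewrite inE => /andP[].
have blkE t z : z \in block d t -> blk d z = t by rewrite inE => /andP[_ /eqP].
(* If all exits are at one block, a single vertex next to it serves as the new geodesic. *)
have single t : (t == a) || (t == b) -> u0 \in block d t ->
    (forall u c, exits e C u c -> u \in block d t) -> completes d C.
  move=> tab u0t Nt; have [u0C c0C uc0] := exits_in ex0.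
  have tl : t < dn d by case/orP: tab => /eqP->.
  have tc : connected e (block d t) by case/orP: tab => /eqP->.
  apply: (add_geodesic IHm ltC vd abP Cc dis N (mem_head c0 [::])) => //.
  - by move=> z; rewrite inE => /eqP->.
  - exact: geodesic1.
  move=> C' C'c; right; exists t; split=> // [u c exu|].
    by case: (component_exits eS C'c exu) => [|/Nt->]; [rewrite inE => ->|rewrite orbT].
  have [_ /subsetP C'D _ _] := C'c.
  have C'C z : z \notin C -> z \in ~: C'.
    by rewrite inE; apply: contra => /C'D; rewrite inE => /andP[].
  have tC' : {subset block d t <= ~: C'} by move=> z /inU zU; rewrite C'C // (disjointFr dis zU).
  exists c0 => [|x xt]; first exact: mem_head.
  apply: (@connect_trans _ _ u0); first by apply: connect_restrS (tc _ _ xt u0t).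
  apply: connect_restr1 => //; first exact: tC'.
  by rewrite inE; apply/negP => /C'D; rewrite !inE eqxx.
case: (boolP [exists u, [exists c, exits e C u c && (blk d u != blk d u0)]]); last first.
  move/existsPn => same; have [u0t|u0t] := orP (N _ _ ex0).
    apply: (single a) => // [|u c exu]; first by rewrite eqxx.
    have /existsPn/(_ c) := same u; rewrite exu negbK (blkE _ _ u0t) => /eqP ub.
    by case/orP: (N _ _ exu) => /inU uU; rewrite inE uU ub eqxx.
  apply: (single b) => // [|u c exu]; first by rewrite eqxx orbT.
  have /existsPn/(_ c) := same u; rewrite exu negbK (blkE _ _ u0t) => /eqP ub.
  by case/orP: (N _ _ exu) => /inU uU; rewrite inE uU ub eqxx.
case/existsP=> u /existsP[c /andP[exu nu]].
have nab : a != b.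
  apply: contra nu => /eqP eab; have := N _ _ exu; have := N _ _ ex0.
  by rewrite -eab !orbb => /blkE-> /blkE->.
have [exa exb] : (exists u c, exits e C u c && (u \in block d a)) /\
    (exists u c, exits e C u c && (u \in block d b)).
  case/orP: (N _ _ ex0) (N _ _ exu) => u0b /orP[ub|ub].
  - by move: nu; rewrite (blkE _ _ ub) (blkE _ _ u0b) eqxx.
  - by split; [exists u0, c0|exists u, c]; rewrite ?ex0 ?exu.
  - by split; [exists u, c|exists u0, c0]; rewrite ?ex0 ?exu.
  - by move: nu; rewrite (blkE _ _ ub) (blkE _ _ u0b) eqxx.
have tC t z : z \in block d t -> z \notin C by move/inU => zU; rewrite (disjointFr dis zU).
have tU t : block d t \subset ~: C by apply/subsetP => z /tC; rewrite inE.
have disab : [disjoint block d a & block d b].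
  apply/pred0P => z /=; apply/andP => -[/blkE za /blkE zb].
  by move: nab; rewrite -za zb eqxx.
have excn v0 d0 v c' : exits e C v0 d0 -> exits e C v c' -> connect (restr e (~: C)) v0 v.
  move=> /N v0ab /N vab; have [x xa] : exists x, x \in block d a.
    by have [w [? /andP[_ wa]]] := exa; exists w.
  have toa z : (z \in block d a) || (z \in block d b) -> connect (restr e (~: C)) x z.
    case/orP=> za; last exact: link.
    by apply: connect_restrS (ac _ _ xa za); apply/subsetP/tU.
  by apply: connect_trans (toa _ vab); rewrite (restr_csym eS); apply: toa.
have [u1 [c1 [u2 [c2 [w0 [[ex1 ex2 u1a u2a _] [_ sep]]]]]]] :=
  cut_exits_sets AS Cc (tU a) (tU b) disab ac bc excn exa exb.
have [_ c1C uc1] := exits_in ex1.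
have [P [[c1P c2P uP sP PC] [gP _]]] := geodesic_between Cc (exit_mem ex1) (exit_mem ex2).
apply: (add_geodesic IHm ltC vd abP Cc dis N c1P uP sP PC gP) => C' C'c; right.
have [_ C'sP C'cn _] := C'c.
have mem_ex w z : exits e C' w z -> z \in C' := @exit_mem _ _ _ w z.
have cases w z : exits e C' w z -> (w \in P) \/ exits e C w z.
  by move=> exw; case: (component_exits eS C'c exw) => [|]; [rewrite inE; left|right].
have Pc : connected e [set z in P] by exact: sorted_connected.
have PsC : [set z in P] \subset C by apply/subsetP => z; rewrite inE => /PC.
have c1P' : c1 \in [set z in P] by rewrite inE.
have c2P' : c2 \in [set z in P] by rewrite inE.
have [_ /subsetP C'D _ _] := C'c.
have UC' x y : connect (restr e (~: C)) x y -> connect (restr e (~: C')) x y.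
  apply: connect_restrS => z; rewrite !inE; apply: contra => /C'D.
  by rewrite inE => /andP[].
have aC' x y : connect (restr e (block d a)) x y -> connect (restr e (~: C')) x y.
  by move=> cxy; apply: UC'; apply: connect_restrS cxy; apply/subsetP/tU.
have u1c1 : connect (restr e (~: C')) u1 c1.
  apply: connect_restr1 => //; rewrite inE; apply/negP => /C'D; rewrite !inE ?c1P //.
  by rewrite (negbTE (tC _ _ u1a)) andbF.
case: (boolP [exists w, [exists z, exits e C' w z && (w \in block d a)]]) => [|nA].
  case/existsP=> w /existsP[z /andP[exw wa]].
  exists a; split=> // [|v z' exv|]; first by rewrite eqxx.
    case: (cases _ _ exv) => [->//|exv']; case/orP: (N _ _ exv') => [->|vb]; rewrite ?orbT //.
    case: (cases _ _ exw) => [/PC wC|exw']; first by move: (tC _ _ wa); rewrite wC.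
    by case: (sep _ _ Pc PsC c1P' c2P' C'cn C'sP _ _ _ _ exw' exv' (mem_ex _ _ exw) (mem_ex _ _ exv) wa vb).
  by exists c1 => // x xa; apply: (@connect_trans _ _ u1) => //; apply: aC' (ac _ _ xa u1a).
exists b; split=> // [|v z' exv|]; first by rewrite eqxx orbT.
  case: (cases _ _ exv) => [->//|exv']; case/orP: (N _ _ exv') => [va|->]; rewrite ?orbT //.
  by case/existsP: nA; exists v; apply/existsP; exists z'; rewrite exv.
exists c1 => // x xb; apply: (@connect_trans _ _ u1) => //.
by apply: UC'; rewrite (restr_csym eS); apply: link.
Qed.

Theorem decomp_exists : exists d, valid d /\ dU d = [set: V].
Proof.
pose d0 := Decomp 0 (set0 : {set V}) (fun=> 0) (fun=> 0) id id.
have v0 : valid d0.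
  split.
  - by move=> x; rewrite inE.
  - by move=> x y; rewrite inE.
  - by move=> i; rewrite /linked eqxx.
  - by move=> i; rewrite /= leqnn.
  - by [].
  - by move=> x y q; rewrite inE.
  by move=> x y; rewrite inE.
have [||d [vd _ Ud]] := decomp_components eS v0 (D := [set: V]) _ v0 (extends_refl d0).
- move=> K d Kc vd _ dis; have [/set0Pn[a aK] _ Kcn clK] := Kc.
  have nex u c : ~ exits e K u c.
    by case/and3P=> uK cK uc; move: uK; rewrite (clK c u) // eS.
  apply: (@add_geodesic #|K| K d (dn d) (dn d) [:: a] a) => //.
  + exact: extendable_all.
  + by rewrite !eqxx orbT.
  + by move=> u c /nex.
  + exact: mem_head.
  + by move=> z; rewrite inE => /eqP->.
  + exact: geodesic1.
  move=> C' C'c; left=> u c exu.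
  by case: (component_exits eS C'c exu) => [|/nex//]; rewrite inE.
- by apply/pred0P => z; rewrite /= !inE.
by exists d; split; rewrite // Ud setUT.
Qed.
End Existence.

(** * Counting the ancestors of a block *)

Section Wcol.
Variables (V : finType) (e : rel V).
Hypothesis (eS : symmetric e).
Variables (d : decomp V).
Hypothesis (vd : valid e d) (dT : dU d = [set: V]).

Fixpoint ancestors k i : seq nat :=
  if k is k'.+1 then i :: ancestors k' (p1 d i) ++ ancestors k' (p2 d i) else [:: i].

Lemma ancestorsE k i j : (j \in ancestors k.+1 i) =
  [|| j == i, j \in ancestors k (p1 d i) | j \in ancestors k (p2 d i)].
Proof. by rewrite /= inE mem_cat. Qed.

Lemma ancestorsS k i : {subset ancestors k i <= ancestors k.+1 i}.
Proof.
elim: k i => [|k IHk] i j; first by rewrite ancestorsE !inE => ->.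
by rewrite ancestorsE => /or3P[h|/IHk h|/IHk h]; rewrite ancestorsE h ?orbT.
Qed.

Lemma ancestors_mono k k' i : k <= k' -> {subset ancestors k i <= ancestors k' i}.
Proof.
move/subnKC <-; elim: (k' - k) => [|n IHn] j; first by rewrite addn0.
by move/IHn; rewrite addnS; apply: ancestorsS.
Qed.

Lemma ancestors_parent k i j : parent d i j -> {subset ancestors k j <= ancestors k.+1 i}.
Proof. by case/orP => /eqP-> z zk; rewrite /= inE mem_cat zk ?orbT. Qed.

Lemma parent_le i j : parent d i j -> j <= i.
Proof. by case/orP=> /eqP->; have /andP[] := v_le vd i. Qed.

(* j is an ancestor of i1, and i0 is a parent of i1 not below j: then i0 has j as an
   ancestor too, because the parents of a block are linked. *)
Lemma ancestors_shortcut k i1 i0 j : parent d i1 i0 -> j <= i0 -> j \in ancestors k i1 ->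
  j \in ancestors k i0.
Proof.
elim: k i1 => [|k IHk] i1 par ji0 /=.
  rewrite !inE => /eqP ji1; have := parent_le par; rewrite -ji1 => le.
  by rewrite eqn_leq ji0 le.
rewrite inE mem_cat => /or3P[/eqP ji1|h|h].
- have e1 : i0 = i1 by apply/eqP; rewrite eqn_leq (parent_le par) -ji1 ji0.
  by rewrite e1 inE ji1 eqxx.
- have q1 : parent d i1 (p1 d i1) by rewrite /parent eqxx.
  case/orP: par => /eqP ei0; first by rewrite ei0; apply: ancestorsS.
  have := v_linked vd i1; rewrite -ei0 => /or3P[/eqP ee|pp|pp].
  + by rewrite -ee; apply: ancestorsS.
  + by apply: ancestorsS; apply: IHk pp ji0 h.
  + exact: ancestors_parent pp _ h.
case/orP: par => /eqP ei0; last by rewrite ei0; apply: ancestorsS.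
have := v_linked vd i1; rewrite -ei0 => /or3P[/eqP ee|pp|pp].
+ by rewrite ee; apply: ancestorsS.
+ exact: ancestors_parent pp _ h.
by apply: ancestorsS; apply: IHk pp ji0 h.
Qed.

(** A step to an earlier block is a step to a parent. A step to a later block has the current block
    as a parent of the next, and [ancestors_shortcut] takes the ancestor [j] back. *)
Lemma walk_ancestors x p j : path e x p -> j <= blk d x -> {in p, forall z, j <= blk d z} ->
  j = blk d (last x p) -> j \in ancestors (size p) (blk d x).
Proof.
elim: p x => [|z p IHp] x /=; first by move=> _ _ _ ->; rewrite inE.
case/andP=> xz pp jx jp el.
have jz : j <= blk d z by apply: jp; rewrite mem_head.
have h := IHp z pp jz (fun w wp => jp w (@mem_behead _ (z :: p) w wp)) el.
have inT y : y \in dU d by rewrite dT inE.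
case: (ltngtP (blk d x) (blk d z)) => xz'.
- apply: ancestorsS; apply: ancestors_shortcut h => //.
  by apply: (v_edge vd) => //; rewrite eS.
- by apply: ancestors_parent h; apply: (v_edge vd).
by rewrite xz'; apply: ancestorsS.
Qed.

(* A vertex with linked parents a, b spends only one new ancestor per extra step of b. *)
Lemma ancestors_pair k j a b m : parent d b a -> j <= k ->
  (exists2 l, {subset ancestors k a <= l} & size l <= m) ->
  exists l, [/\ {subset ancestors k a <= l}, {subset ancestors j b <= l} & size l <= m + j.+1].
Proof.
move=> + + [l0 sub0 sz0].
elim: j b => [|j IHj] b par jk.
  exists (b :: l0); split=> [z /sub0 zl|z|]; last by rewrite addn1 ltnS.
    by rewrite inE zl orbT.
  by rewrite !inE => ->.
have aj : {subset ancestors j a <= ancestors k a} by apply: ancestors_mono; apply: ltnW.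
have [c [q1 q2 lac]] : exists c, [/\ {subset ancestors j (p1 d b) <= ancestors j a ++ ancestors j c},
    {subset ancestors j (p2 d b) <= ancestors j a ++ ancestors j c} & linked d a c].
  have lb := v_linked vd b; case/orP: par => /eqP ->; [exists (p2 d b)|exists (p1 d b)];
    split=> //; try by move=> z; rewrite mem_cat => ->; rewrite ?orbT.
  by case/or3P: lb => h; rewrite /linked 1?eq_sym h ?orbT.
have [l [la lc sl]] : exists l, [/\ {subset ancestors k a <= l}, {subset ancestors j c <= l} &
    size l <= m + j.+1].
  case/or3P: lac => [/eqP<-|pp|pp].
  - by exists l0; split=> // [z /aj/sub0//|]; apply: leq_trans sz0 (leq_addr _ _).
  - exists l0; split=> //; last by apply: leq_trans sz0 (leq_addr _ _).
    by move=> z /(ancestors_parent pp)/(ancestors_mono jk)/sub0.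
  - by apply: IHj => //; apply: ltnW.
have key z : z \in ancestors j a ++ ancestors j c -> z \in l.
  by rewrite mem_cat => /orP[/aj/la|/lc].
exists (b :: l); split=> [z /la zl|z|]; last by rewrite [m + j.+2]addnS ltnS.
  by rewrite inE zl orbT.
by rewrite ancestorsE inE => /or3P[->//|/q1/key->|/q2/key->]; rewrite orbT.
Qed.

(** Pascal's rule: one for the block itself, the ancestors of one parent by induction, and by
    [ancestors_pair] at most [k+1] further ones for the other parent. *)
Lemma ancestors_card k i : exists2 l, {subset ancestors k i <= l} & size l <= 'C(k + 2, 2).
Proof.
elim: k i => [|k IHk] i; first by exists [:: i].
have bE : 'C(k.+1 + 2, 2) = ('C(k + 2, 2) + k.+1).+1.
  by rewrite addSn binS bin1 addn2 addnS.
have [a [b [q1 q2 lab]]] : exists a b, [/\ {subset ancestors k (p1 d i) <= ancestors k a ++ ancestors k b},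
    {subset ancestors k (p2 d i) <= ancestors k a ++ ancestors k b} & (a == b) || parent d b a].
  have in1 a b : {subset ancestors k a <= ancestors k a ++ ancestors k b}.
    by move=> z; rewrite mem_cat => ->.
  have in2 a b : {subset ancestors k b <= ancestors k a ++ ancestors k b}.
    by move=> z; rewrite mem_cat => ->; rewrite orbT.
  case/or3P: (v_linked vd i) => h.
  - by exists (p1 d i), (p2 d i); rewrite h.
  - by exists (p2 d i), (p1 d i); rewrite h orbT.
  by exists (p1 d i), (p2 d i); rewrite h orbT.
have [l [la lb sl]] : exists l, [/\ {subset ancestors k a <= l}, {subset ancestors k b <= l} &
    size l <= 'C(k + 2, 2) + k.+1].
  case/orP: lab => [/eqP<-|par]; last exact: ancestors_pair par (leqnn k) (IHk a).
  have [l la sl] := IHk a; exists l; split=> //; apply: leq_trans sl (leq_addr _ _).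
have key z : z \in ancestors k a ++ ancestors k b -> z \in l.
  by rewrite mem_cat => /orP[/la|/lb].
exists (i :: l) => [z|]; last by rewrite bE /= ltnS.
by rewrite ancestorsE inE => /or3P[->//|/q1/key->|/q2/key->]; rewrite orbT.
Qed.
End Wcol.

Lemma card_cover (T : finType) (I : eqType) (c : I -> {set T}) (Q : {set T}) (l : seq I) m :
  (forall w, w \in Q -> exists2 i, i \in l & w \in c i) -> (forall i, #|Q :&: c i| <= m) ->
  #|Q| <= size l * m.
Proof.
elim: l Q => [|i l IHl] Q Ql Qm.
  have [->|[w wQ]] := set_0Vmem Q; first by rewrite cards0.
  by have [i] := Ql w wQ.
rewrite -(cardsID (c i) Q) /= mulSn leq_add //.
apply: IHl => [w|i'].
  rewrite inE => /andP[wi wQ]; have [i'] := Ql w wQ.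
  by rewrite inE => /predU1P[->|i'l wi']; [rewrite (negbTE wi)|exists i'].
by apply: leq_trans (Qm i'); apply/subset_leq_card/setSI/subsetDl.
Qed.

Theorem wcol_order (V : finType) (e : rel V) : symmetric e -> arc_separation e ->
  exists2 rk : V -> nat, injective rk & forall s v,
    #|[set w | (rk w <= rk v) && reach e [set z | rk w < rk z] s v w]| <= 'C(s + 2, 2) * (2 * s + 1).
Proof.
move=> eS AS; have [d [vd dT]] := decomp_exists eS AS.
have inT y : y \in dU d by rewrite dT inE.
(* Lexicographic order: first the block, then the position, with [M] above all positions. *)
pose M := (\max_x pos d x).+1; pose rk x := blk d x * M + pos d x.
have posM x : pos d x < M by rewrite ltnS leq_bigmax.
have blkE x : blk d x = rk x %/ M by rewrite divnMDl // divn_small ?addn0.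
have blk_le x y : rk x <= rk y -> blk d x <= blk d y.
  by rewrite !blkE; apply: leq_div2r.
exists rk => [x y exy|s v].
  have eb : blk d x = blk d y by rewrite !blkE exy.
  by apply: (v_inj vd) => //; move: exy; rewrite /rk eb => /addnI.
have [l sub sl] := ancestors_card vd s (blk d v).
apply: leq_trans (_ : size l * (2 * s + 1) <= _); last by rewrite leq_mul2r sl orbT.
set Q := [set w | _].
have QP w : w \in Q -> blk d w <= blk d v /\
    (v = w \/ exists q, [/\ path e v (rcons q w), {in q, forall z, blk d w <= blk d z} & size q < s]).
  rewrite inE => /andP[wv /reachP h]; split; first exact: blk_le.
  case: h => [->|[q [pq qZ sq]]]; [by left|right; exists q; split=> // z /qZ].
  by rewrite inE => /ltnW/blk_le.
apply: (card_cover (c := fun t => [set w | blk d w == t])) => [w /QP[bw h]|t].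
  exists (blk d w); last by rewrite inE eqxx.
  apply: sub; case: h => [->|[q [pq qZ sq]]].
    apply: (ancestors_mono (k := 0)) => //; exact: mem_head.
  apply: (ancestors_mono (k := size (rcons q w))); first by rewrite size_rcons.
  apply: (walk_ancestors eS vd dT) => //; last by rewrite last_rcons.
  by move=> z; rewrite mem_rcons inE => /predU1P[->|/qZ].
(* Two targets in block [t] are joined through [v] by a walk of length at most [2s] in blocks not
   before [t], so [v_geod] bounds the difference of their positions. *)
apply: (@card_inj_window _ (pos d)) => [w w'|w w'].
  rewrite ![_ \in _ :&: _]inE !inE => /andP[_ /eqP bw] /andP[_ /eqP bw']; apply: (v_inj vd) => //.
  by rewrite bw bw'.
rewrite !in_setI => /andP[/QP[bwv h]]; rewrite inE => /eqP bw /andP[/QP[_ h']]; rewrite inE => /eqP bw'.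
have geo q : path e w (rcons q w') -> {in q, forall z, t <= blk d z} -> pos d w' <= pos d w + (size q).+1.
  move=> pq qt; apply: (v_geod vd) => // [|z /qt zt]; first by rewrite bw bw'.
  by rewrite bw zt orbT.
rewrite bw in bwv.
case: h => [vw|[q [/(rev_walk eS) pq qZ sq]]]; case: h' => [vw'|[q' [pq' qZ' sq']]].
- by rewrite -vw -vw'; lia.
- rewrite bw' in qZ'; rewrite vw in pq'; have := geo _ pq' qZ'; lia.
- rewrite bw in qZ; rewrite vw' in pq.
  have := geo _ pq; rewrite size_rev => /(_ _) h.
  have : pos d w' <= pos d w + (size q).+1 by apply: h => z; rewrite mem_rev; apply: qZ.
  lia.
rewrite bw in qZ; rewrite bw' in qZ'.
have := geo (rev q ++ v :: q'); rewrite size_cat size_rev /= => h.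
have : pos d w' <= pos d w + (size q + (size q').+1).+1.
  apply: h; first by rewrite rcons_cat -cat_rcons cat_path pq last_rcons.
  by move=> z; rewrite mem_cat mem_rev inE => /or3P[/qZ|/eqP->|/qZ'].
lia.
Qed.

(** * From graphs to shallow minors *)

Definition sreach (V : finType) (e : rel V) (rk : V -> nat) s v :=
  [set w | (rk w <= rk v) && reach e [set z | rk v < rk z] s v w].
Definition wreach (V : finType) (e : rel V) (rk : V -> nat) s v :=
  [set w | (rk w <= rk v) && reach e [set z | rk w < rk z] s v w].

Section Order.
Variables (W : finType) (h : rel W) (rk : W -> nat).
Hypothesis rkI : injective rk.

Lemma perm_of_rank : exists sigma : {perm W}, forall x y, (key sigma x <= key sigma y) = (rk x <= rk y).
Proof.
(* The permutation sends [x] to the element whose index is the number of elements below [x]. *)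
pose below x := [set z | rk z < rk x].
have lt x : #|below x| < #|W|.
  rewrite -cardsT; apply: proper_card; apply/properP; split; first exact: subsetT.
  by exists x; rewrite !inE ?ltnn.
have mono x y : rk x < rk y -> #|below x| < #|below y|.
  move=> xy; apply: proper_card; apply/properP; split.
    by apply/subsetP => z; rewrite !inE => /ltn_trans; apply.
  by exists x; rewrite !inE ?ltnn.
have leE x y : (#|below x| <= #|below y|) = (rk x <= rk y).
  apply/idP/idP => [|]; last first.
    by rewrite leq_eqVlt => /predU1P[/rkI->//|/mono/ltnW].
  by apply: contraTT; rewrite -!ltnNge; apply: mono.
pose f x := enum_val (Ordinal (lt x)).
have fI : injective f.
  move=> x y /enum_val_inj/(congr1 val) /= exy; apply: rkI; apply/eqP.
  by rewrite eqn_leq -!leE exy leqnn.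
by exists (perm fI) => x y; rewrite /key !permE /f !enum_valK leE.
Qed.

Lemma exists_walk_reach (Z : pred W) s v w :
  [exists n : 'I_s.+1, exists p : n.-tuple W,
    [&& path h v p, last v p == w & all Z (take (size p).-1 p)]] ->
  reach h [set z | Z z] s v w.
Proof.
case/existsP=> -[n ltn] /existsP[[p /= /eqP sp]] /and3P[pp /eqP pl aZ]; apply/reachP.
case/lastP: p sp pp pl aZ => [|q y] sp pp pl aZ; first by left.
right; exists q; move: pl aZ; rewrite last_rcons => <-.
have -> : take (size (rcons q y)).-1 (rcons q y) = q by rewrite size_rcons -cats1 take_size_cat.
move=> /allP qZ; split=> // [z /qZ|]; first by rewrite inE.
by rewrite -ltnS; apply: leq_trans ltn; rewrite -sp size_rcons.
Qed.

Lemma bigminn_le (I : finType) (F : I -> nat) m i : \big[minn/m]_(j : I) F j <= F i.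
Proof.
have : i \in index_enum I by rewrite mem_index_enum.
elim: (index_enum I) => // j r IHr; rewrite big_cons inE => /predU1P[->|/IHr le].
  exact: geq_minl.
exact: leq_trans (geq_minr _ _) le.
Qed.

Lemma scol_le s N : (forall v, #|sreach h rk s v| <= N) -> scol h s <= N.
Proof.
move=> le; have [sigma sE] := perm_of_rank.
apply: leq_trans (bigminn_le _ _ sigma) _; apply/bigmax_leqP => v _.
apply: leq_trans (le v); apply/subset_leq_card/subsetP => w.
rewrite inE => /andP[wv /exists_walk_reach]; rewrite inE -sE wv /=.
congr (is_true (reach _ _ _ _ _)); apply/setP => z.
by rewrite !inE ltnNge sE -ltnNge.
Qed.

Lemma wcol_le s N : (forall v, #|wreach h rk s v| <= N) -> wcol h s <= N.
Proof.
move=> le; have [sigma sE] := perm_of_rank.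
apply: leq_trans (bigminn_le _ _ sigma) _; apply/bigmax_leqP => v _.
apply: leq_trans (le v); apply/subset_leq_card/subsetP => w.
rewrite inE => /andP[wv /exists_walk_reach]; rewrite inE -sE wv /=.
congr (is_true (reach _ _ _ _ _)); apply/setP => z.
by rewrite !inE ltnNge sE -ltnNge.
Qed.

(** Stopping at the first visit to [y] makes the inequalities strict, since [rk] is injective.
    Lifted and projected walks give only weak ones. *)
Lemma reach_first (k : nat) x y p : path h x p -> last x p = y -> size p <= k ->
  {in p, forall z, rk y <= rk z} -> reach h [set z | rk y < rk z] k x y.
Proof.
move=> pp pl sp pz; apply/reachP; case: (eqVneq x y) => [|xy]; [by left|right].
have yp : y \in p by have := mem_last x p; rewrite pl inE eq_sym (negbTE xy).
have [q1 [q2 [ep nq]]] : exists q1 q2, p = q1 ++ y :: q2 /\ y \notin q1.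
  exists (take (index y p) p), (drop (index y p).+1 p); split.
    by rewrite -{1}(cat_take_drop (index y p) p) (drop_nth y) ?index_mem // nth_index.
  by rewrite in_take_leq ?ltnn // index_size.
exists q1; split.
- by move: pp; rewrite ep -cat_rcons cat_path => /andP[].
- move=> z zq; rewrite inE ltn_neqAle pz ?ep ?mem_cat ?zq // andbT.
  by apply: contra nq => /eqP/rkI->.
by apply: leq_trans sp; rewrite ep size_cat /= addnS ltnS leq_addr.
Qed.

(** Restarting at the last visit to [x] makes the inequalities strict. *)
Lemma reach_last (k : nat) x y q : path h x (rcons q y) -> size q < k ->
  {in q, forall z, rk x <= rk z} -> reach h [set z | rk x < rk z] k x y.
Proof.
have [n] := ubnP (size q); elim: n q => // n IHn q lt pq sq qz.
case: (boolP (x \in q)) => xq; last first.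
  apply/reachP; right; exists q; split=> // z zq; rewrite inE ltn_neqAle qz // andbT.
  by apply: contra xq => /eqP/rkI->.
have eq : q = take (index x q) q ++ x :: drop (index x q).+1 q.
  by rewrite -{1}(cat_take_drop (index x q) q) (drop_nth x) ?index_mem // nth_index.
have sz : size (drop (index x q).+1 q) < size q.
  by rewrite size_drop; move: xq; rewrite -index_mem; slia.
apply: (IHn (drop (index x q).+1 q)).
- by apply: leq_trans sz _; rewrite -ltnS.
- by move: pq; rewrite {1}eq rcons_cat -cat_rcons cat_path last_rcons => /andP[].
- exact: ltn_trans sz sq.
- by move=> z /mem_drop/qz.
Qed.
End Order.

(** * Colouring numbers of the embedded graph *)

Section Base.
Variables (V : finType) (e : rel V) (g : nat).
Hypothesis (eS : symmetric e) (eI : irreflexive e).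

(** On a vertical path the levels are distinct, and inside the ball they differ by at most [2s]. *)
Lemma vertical_path_ball (lev : V -> nat) par u (Z : {set V}) s v : bfs_forest e lev par ->
  #|[set w | fconnect par u w && reach e Z s v w]| <= 2 * s + 1.
Proof.
case=> lev_e lev_par par0 _.
have lev_par_le x : lev (par x) <= lev x.
  by case: (posnP (lev x)) => [/par0->//|/lev_par[_ ->]].
have lev_iter k x : lev (iter k par x) <= lev x.
  by elim: k => //= k IHk; apply: leq_trans (lev_par_le _) IHk.
have fixl k x : lev (iter k par x) = lev x -> iter k par x = x.
  case: (posnP (lev x)) => [/par0 px _|lx]; first by elim: k => //= k ->.
  case: k => // k; rewrite iterSr => ek.
  by have [_ lp] := lev_par _ lx; have := lev_iter k (par x); rewrite ek lp ltnn.
have lev_walk x q y : path e x q -> last x q = y -> lev y <= lev x + size q.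
  elim: q x => [|z q IHq] x /=; first by move=> _ ->; rewrite addn0.
  case/andP=> xz /IHq h /h /leq_trans; apply.
  by have := lev_e _ _ xz; lia.
apply: (@card_inj_window _ lev) => [w w'|w w'].
  rewrite !inE => /andP[/iter_findex ew _] /andP[/iter_findex ew' _].
  set k := findex _ _ _ in ew; set k' := findex _ _ _ in ew'.
  case: (leqP k k') => kk.
    rewrite -(subnK kk) iterD ew in ew' => e1.
    by rewrite -ew' fixl // ew'.
  rewrite -(subnK (ltnW kk)) iterD ew' in ew => e1.
  by rewrite -ew fixl // ew.
rewrite !inE => /andP[_ /reachP h] /andP[_ /reachP h'].
have lv : lev v <= lev w + s.
  case: h => [->|[q [/(rev_walk eS) pq _ sq]]]; first exact: leq_addr.
  apply: leq_trans (lev_walk _ _ _ pq (last_rcons _ _ _)) _.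
  by rewrite leq_add2l size_rcons size_rev.
have lw : lev w' <= lev v + s.
  case: h' => [->|[q [pq _ sq]]]; first exact: leq_addr.
  apply: leq_trans (lev_walk _ _ _ pq (last_rcons _ _ _)) _.
  by rewrite leq_add2l size_rcons.
by move: lv lw; lia.
Qed.

Lemma genus_reduction : embeds_with_eg e g -> exists S : {set V},
  arc_separation (restr e (~: S)) /\
  forall (Z Q : {set V}) s v, Q \subset S -> (forall w, w \in Q -> reach e Z s v w) ->
    #|Q| <= 2 * g * (2 * s + 1).
Proof.
case=> F [t0 [t1 [t2 [phi [mg gE]]]]].
have [lev [par bf]] := bfs_forest_exists eS.
have [ends [sz endsP]] := homology_cut eS eI mg gE bf.
exists [set v | has (fconnect par ^~ v) ends]; split.
  apply: (arc_separation_flags eS eI mg) => psi p1 p2 pS.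
  by apply: endsP => // x x1 x2; apply: pS; rewrite inE.
move=> Z Q s v /subsetP QS Qr.
apply: leq_trans (_ : size ends * (2 * s + 1) <= _); last by rewrite leq_mul2r sz orbT.
apply: (card_cover (c := fun u => [set w | fconnect par u w])) => [w /QS|u].
  by rewrite inE => /hasP[u uE uw]; exists u; rewrite ?inE.
apply: leq_trans (vertical_path_ball u Z s v bf); apply/subset_leq_card/subsetP => w.
by rewrite !inE => /andP[/Qr -> ->].
Qed.

Lemma back_bounded_split s N (e' : rel V) L1 v L2 : back_bounded e' s N (L1 ++ v :: L2) ->
  #|reached e' [set z in L2] s v| <= N.
Proof. by elim: L1 => [|u L1 IHL] /= /andP[]. Qed.

(** Indices in [enum S] are at most [#|V|], so the offset puts [S] below everything else. *)
Definition prefix_rank (S : {set V}) (rk : V -> nat) x :=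
  if x \in S then index x (enum S) else #|V|.+1 + rk x.

Section Prefix.
Variables (S : {set V}) (rk : V -> nat).
Hypothesis rkI : injective rk.
Notation rk' := (prefix_rank S rk).

Lemma prefix_rank_in x y : x \in S -> rk' y <= rk' x -> y \in S.
Proof.
rewrite /prefix_rank => xS; rewrite xS; case: ifP => // _.
have : index x (enum S) <= #|V| by apply: leq_trans (index_size _ _) _; rewrite -cardE max_card.
by lia.
Qed.

Lemma prefix_rank_out x y : x \notin S -> y \notin S ->
  (rk' x <= rk' y) = (rk x <= rk y) /\ (rk' x < rk' y) = (rk x < rk y).
Proof.
by rewrite /prefix_rank => /negbTE-> /negbTE->; rewrite leq_add2l ltn_add2l.
Qed.

Lemma prefix_rank_inj : injective rk'.
Proof.
move=> x y exy; case: (boolP (x \in S)) => xS.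
  have yS : y \in S by apply: (prefix_rank_in xS); rewrite exy.
  by move: exy; rewrite /prefix_rank xS yS; apply: (index_inj x); rewrite mem_enum.
have yS : y \notin S by apply: contra xS => yS; apply: (prefix_rank_in yS); rewrite exy.
by move: exy; rewrite /prefix_rank (negbTE xS) (negbTE yS) => /addnI/rkI.
Qed.

Lemma reach_restr (Z : {set V}) s v w : Z \subset ~: S -> v \notin S -> w \notin S ->
  reach e Z s v w -> reach (restr e (~: S)) Z s v w.
Proof.
move=> /subsetP ZS vS wS /reachP[->|[q [pq qZ sq]]]; apply/reachP; [by left|right].
exists q; split=> //; apply: restr_path => // z.
rewrite inE mem_rcons inE => /or3P[/eqP->|/eqP->|/qZ/ZS//]; by rewrite inE.
Qed.
End Prefix.

Lemma scol_graph s : embeds_with_eg e g -> 0 < s -> exists2 rk : V -> nat, injective rk &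
  forall v, #|sreach e rk s v| <= (4 * g + 5) * s + 2 * g + 1.
Proof.
move=> /genus_reduction[S [AS ball]] s0; set e' := restr e _ in AS.
have e'S : symmetric e' by apply: restr_sym.
have e'I : irreflexive e' by move=> x; rewrite /e' /restr eI !andbF.
have [L [uL mL okL]] := orderable_setT e'S e'I s0 AS.
have LT x : x \in L by rewrite mL inE.
have idxI : injective (index^~ L) by move=> x y; apply: (index_inj x).
exists (prefix_rank S (index^~ L)) => [|v]; first exact: prefix_rank_inj.
set rk := prefix_rank _ _; set Q := sreach _ _ _ _.
rewrite -(cardsID S Q).
(* The first summand is for [S], the second for the order of the rest. *)
have -> : (4 * g + 5) * s + 2 * g + 1 = 2 * g * (2 * s + 1) + (5 * s + 1) by lia.
apply: leq_add.
  apply: (ball [set z | rk v < rk z] _ s v); first exact: subsetIr.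
  by move=> w; rewrite !inE => /andP[/andP[]].
have eL : L = take (index v L) L ++ v :: drop (index v L).+1 L.
  by rewrite -{1}(cat_take_drop (index v L) L) (drop_nth v) ?index_mem // nth_index.
have memL2 z : (z \in drop (index v L).+1 L) = (index v L < index z L).
  apply/idP/idP => [zd|lt].
    rewrite ltnNge -ltnS; apply/negP => lt.
    have zt : z \in take (index v L).+1 L by rewrite in_take.
    move: uL; rewrite -{1}(cat_take_drop (index v L).+1 L) cat_uniq => /and3P[_ /hasPn/(_ z zd)].
    by rewrite /= zt.
  have zN : z \notin take (index v L).+1 L by rewrite in_take // -leqNgt.
  by have := LT z; rewrite -{1}(cat_take_drop (index v L).+1 L) mem_cat (negbTE zN).
have := okL; rewrite eL => /back_bounded_split; apply: leq_trans.
apply/subset_leq_card/subsetP => w; case/setDP=> + wS; rewrite /Q /sreach in_set => /andP[wv h].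
have vS : v \notin S by apply: contra wS => vS; apply: prefix_rank_in vS wv.
have [le _] := prefix_rank_out (index^~ L) wS vS.
rewrite inE inE memL2 -leqNgt -le wv /=.
have eZ : [set z | rk v < rk z] = [set z in drop (index v L).+1 L] :\: S.
  apply/setP => z; rewrite !inE memL2; case: (boolP (z \in S)) => zS /=.
    apply/negP => lt; move: vS; rewrite (prefix_rank_in zS (ltnW lt)) //.
  by have [_ ->] := prefix_rank_out (index^~ L) vS zS.
have ZS : [set z | rk v < rk z] \subset ~: S.
  by rewrite eZ; apply/subsetP => z; rewrite !inE => /andP[].
have := reach_restr ZS vS wS h; rewrite -/e' => /reachP[->|[q [pq qZ sq]]]; apply/reachP; [by left|right].
by exists q; split=> // z /qZ; rewrite eZ inE => /andP[].
Qed.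

Lemma wcol_graph : embeds_with_eg e g -> exists2 rk : V -> nat, injective rk &
  forall s v, #|wreach e rk s v| <= (2 * g + 'C(s + 2, 2)) * (2 * s + 1).
Proof.
move=> /genus_reduction[S [AS ball]]; set e' := restr e _ in AS.
have e'S : symmetric e' by apply: restr_sym.
have [rk0 rkI rkP] := wcol_order e'S AS.
exists (prefix_rank S rk0) => [|s v]; first exact: prefix_rank_inj.
set rk := prefix_rank _ _; set Q := wreach _ _ _ _.
rewrite -(cardsID S Q) mulnDl; apply: leq_add.
  (* The admissible interior depends on the target [w], so the ball is taken in the whole graph. *)
  apply: (ball setT _ s v); first exact: subsetIr.
  move=> w; rewrite !inE => /andP[/andP[_ /reachP h] _]; apply/reachP.
  by case: h => [->|[q [pq _ sq]]]; [left|right; exists q; split=> // z; rewrite inE].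
apply: leq_trans (rkP s v); apply/subset_leq_card/subsetP => w.
case/setDP=> + wS; rewrite /Q /wreach in_set => /andP[wv h].
have vS : v \notin S by apply: contra wS => vS; apply: prefix_rank_in vS wv.
have [le _] := prefix_rank_out rk0 wS vS; rewrite inE -le wv /=.
have eZ : [set z | rk w < rk z] \subset [set z | rk0 w < rk0 z] :\: S.
  apply/subsetP => z; rewrite !inE => lt; case: (boolP (z \in S)) => zS /=.
    by move: wS; rewrite (prefix_rank_in zS (ltnW lt)).
  by have [_ <-] := prefix_rank_out rk0 wS zS.
have ZS : [set z | rk w < rk z] \subset ~: S.
  by apply: subset_trans eZ _; apply/subsetP => z; rewrite !inE => /andP[].
have := reach_restr ZS vS wS h; rewrite -/e' => /reachP[->|[q [pq qZ sq]]]; apply/reachP; [by left|right].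
by exists q; split=> // z /qZ /(subsetP eZ); rewrite inE => /andP[].
Qed.
End Base.

(** * Passing to the strong product *)

Section Product.
Variables (V : finType) (e : rel V) (l : nat).
Hypothesis eS : symmetric e.

Lemma strong_prod_sym : symmetric (strong_prod e l).
Proof. by move=> x y; rewrite /strong_prod eq_sym [x.1 == _]eq_sym eS. Qed.

Variable rk : V -> nat.
Hypothesis rkI : injective rk.

(** Each copy of [K_l] is an interval of the order, so inequalities project to weak inequalities in
    the graph. *)
Definition lex_rank (x : V * 'I_l) := rk x.1 * l + x.2.

Lemma lex_rankE x : lex_rank x %/ l = rk x.1.
Proof.
have l0 : 0 < l by apply: leq_ltn_trans (ltn_ord x.2).
by rewrite /lex_rank divnMDl // divn_small ?addn0.
Qed.

Lemma lex_rank_inj : injective lex_rank.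
Proof.
move=> x y exy; have e1 : x.1 = y.1 by apply: rkI; rewrite -!lex_rankE exy.
case: x y e1 exy => [a i] [b j] /= <-; rewrite /lex_rank /= => /addnI/val_inj->.
by [].
Qed.

Lemma lex_rank_le x y : lex_rank x <= lex_rank y -> rk x.1 <= rk y.1.
Proof. by rewrite -!lex_rankE; apply: leq_div2r. Qed.

Lemma project_walk x p : path (strong_prod e l) x p -> exists p', [/\ path e x.1 p',
  last x.1 p' = (last x p).1, size p' <= size p & {subset p' <= map fst p}].
Proof.
elim: p x => [|z p IHp] x /=; first by exists [::].
case/andP=> /andP[_ /orP xz] /IHp[p' [pp pl sp sub]].
case: xz => [/eqP xz|xz].
  exists p'; rewrite xz; split=> // [|w /sub]; first exact: leqW.
  by rewrite inE orbC => ->.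
exists (z.1 :: p'); rewrite /= xz; split=> // w; rewrite !inE => /predU1P[->|/sub->].
  by rewrite eqxx.
by rewrite orbT.
Qed.

Lemma card_columns (X : {set V}) (Q : {set V * 'I_l}) :
  (forall x, x \in Q -> x.1 \in X) -> #|Q| <= l * #|X|.
Proof.
move=> QX; rewrite mulnC -[l in leqRHS]card_ord -cardsT -cardsX.
by apply/subset_leq_card/subsetP => x /QX xX; rewrite !inE xX.
Qed.

(** The projected walk may revisit both ends. It is cut at the first visit to [y.1], so that its
    interior comes from [q], and then restarted at the last visit to [x.1]. *)
Lemma sreach_strong_prod k N : (forall v, #|sreach e rk k v| <= N) ->
  forall x, #|sreach (strong_prod e l) lex_rank k x| <= l * N.
Proof.
move=> leN x; apply: leq_trans (_ : l * #|sreach e rk k x.1| <= _); last by rewrite leq_mul2l leN orbT.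
apply: card_columns => y; rewrite !inE => /andP[/lex_rank_le -> /reachP h] /=.
case: h => [<-|[q [pq qZ sq]]]; first by apply/reachP; left.
have [p' [pp pl sp sub]] := project_walk pq.
rewrite last_rcons in pl; rewrite size_rcons in sp.
case: (eqVneq x.1 y.1) => [->|xy]; first by apply/reachP; left.
have yp : y.1 \in p' by have := mem_last x.1 p'; rewrite pl inE eq_sym (negbTE xy).
have ep : p' = take (index y.1 p') p' ++ y.1 :: drop (index y.1 p').+1 p'.
  by rewrite -{1}(cat_take_drop (index y.1 p') p') (drop_nth y.1) ?index_mem // nth_index.
apply: (reach_last rkI (q := take (index y.1 p') p')).
- by move: pp; rewrite {1}ep -cat_rcons cat_path => /andP[].
- apply: leq_trans (leq_trans sp sq); rewrite size_take ifT ?index_mem //.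
- move=> z zt; have /sub/mapP[w] := mem_take zt; rewrite mem_rcons inE => /predU1P[->|wq] ez.
    by move: zt; rewrite ez in_take_leq ?index_size // ltnn.
  by rewrite ez; apply: lex_rank_le; have := qZ w wq; rewrite inE => /ltnW.
Qed.

Lemma wreach_strong_prod k N : (forall v, #|wreach e rk k v| <= N) ->
  forall x, #|wreach (strong_prod e l) lex_rank k x| <= l * N.
Proof.
move=> leN x; apply: leq_trans (_ : l * #|wreach e rk k x.1| <= _); last by rewrite leq_mul2l leN orbT.
apply: card_columns => y; rewrite !inE => /andP[/lex_rank_le -> /reachP h] /=.
case: h => [<-|[q [pq qZ sq]]]; first by apply/reachP; left.
have [p' [pp pl sp sub]] := project_walk pq.
rewrite last_rcons in pl; rewrite size_rcons in sp.
apply: (reach_first rkI pp pl) => [|z /sub/mapP[w]]; first exact: leq_trans sp sq.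
rewrite mem_rcons inE => /predU1P[->->//|wq ->].
by apply: lex_rank_le; have := qZ w wq; rewrite inE => /ltnW.
Qed.
End Product.

(** * Passing to shallow minors *)

Section Minor.
Variables (U W : finType) (e : rel U) (h : rel W) (r : nat) (mu : W -> {set U}).
Hypothesis eS : symmetric e.
Hypothesis mu_disj : forall v w, v != w -> [disjoint mu v & mu w].
Hypothesis mu_rad : forall v, exists2 c, c \in mu v &
  forall x, x \in mu v -> exists p : seq U,
    [/\ path e c p, last c p = x, all (fun y => y \in mu v) p & size p <= r].
Hypothesis mu_edge : forall v w, h v w -> exists x y, [/\ x \in mu v, y \in mu w & e x y].
Variable rk : U -> nat.
Hypothesis rkI : injective rk.

Lemma branch_inj x v w : x \in mu v -> x \in mu w -> v = w.
Proof.
move=> xv xw; apply/eqP/negPn/negP => /mu_disj d.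
by have := disjointFr d xv; rewrite xw.
Qed.

Lemma branch_walk v x y : x \in mu v -> y \in mu v -> exists p,
  [/\ path e x p, last x p = y, {subset p <= mu v} & size p <= 2 * r].
Proof.
have [c cv rad] := mu_rad v => /rad[p [pp pl /allP pv sp]] /rad[q [pq ql /allP qv sq]].
have rp : path e x (rev (belast c p)).
  by rewrite -pl rev_path (@eq_path _ _ e) // => a b; rewrite eS.
have rl : last x (rev (belast c p)) = c.
  by case: (p) pl => [|z p'] /=; [move=> ->|rewrite rev_cons last_rcons].
exists (rev (belast c p) ++ q); split.
- by rewrite cat_path rp rl.
- by rewrite last_cat rl.
- move=> z; rewrite mem_cat mem_rev => /orP[/mem_belast|/qv//].
  by rewrite inE => /predU1P[->|/pv].
by rewrite size_cat size_rev size_belast mul2n -addnn leq_add.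
Qed.

(** A walk of [n] steps visits [n+1] branch sets, each crossed through its centre in at most [2r]
    steps, and uses [n] edges between them: [2r(n+1) + n] in total. *)
Lemma minor_walk v p x y : path h v p -> x \in mu v -> y \in mu (last v p) -> exists q,
  [/\ path e x q, last x q = y, size q <= (2 * r + 1) * size p + 2 * r
    & forall z, z \in q -> exists2 u, u \in v :: p & z \in mu u].
Proof.
elim: p v x => [|w p IHp] v x /=.
  move=> _ xv yv; have [q [pq ql qv sq]] := branch_walk xv yv.
  by exists q; split=> // [|z /qv zv]; [rewrite muln0|exists v; rewrite ?mem_head].
case/andP=> vw pp xv yl; have [a [b [av bw ab]]] := mu_edge vw.
have [q1 [pq1 ql1 qv1 sq1]] := branch_walk xv av.
have [q2 [pq2 ql2 sq2 qv2]] := IHp w b pp bw yl.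
exists (q1 ++ b :: q2); split.
- by rewrite cat_path pq1 ql1 /= ab.
- by rewrite last_cat ql1.
- by rewrite size_cat /=; lia.
move=> z; rewrite mem_cat inE => /or3P[/qv1 zv|/eqP->|/qv2[u up zu]].
- by exists v => //; apply: mem_head.
- by exists w => //; rewrite !inE eqxx orbT.
by exists u => //; rewrite inE up orbT.
Qed.

Lemma branch_min : exists m : W -> U, forall v, m v \in mu v /\ forall z, z \in mu v -> rk (m v) <= rk z.
Proof.
have ex v : exists x, (x \in mu v) && [forall z in mu v, rk x <= rk z].
  have [c cv _] := mu_rad v; case: (arg_minnP rk cv) => x xv xmin; exists x; apply/andP; split=> //.
  by apply/forallP => z; apply/implyP => /xmin.
exists (fun v => xchoose (ex v)) => v; have /andP[-> /forallP min] := xchooseP (ex v).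
by split=> // z zv; have := min z; rewrite zv.
Qed.

Variable m : W -> U.
Hypothesis mP : forall v, m v \in mu v /\ forall z, z \in mu v -> rk (m v) <= rk z.
Let rkm v := rk (m v).

Lemma branch_min_inj : injective m.
Proof. by move=> v w emw; apply: (branch_inj (mP v).1); rewrite emw; case: (mP w). Qed.

Lemma branch_rank_inj : injective rkm.
Proof. by move=> v w /rkI/branch_min_inj. Qed.

(** Every branch set on the walk has its least vertex at or above [m w], so the lifted walk never
    goes below [m w]. *)
Lemma wreach_minor s v : #|wreach h rkm s v| <= #|wreach e rk ((2 * r + 1) * s + 2 * r) (m v)|.
Proof.
rewrite -(card_imset _ branch_min_inj); apply/subset_leq_card/subsetP => _ /imsetP[w + ->].
rewrite !inE => /andP[wv /reachP hw]; rewrite wv /=.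
case: hw => [->|[q [pq qZ sq]]]; first by apply/reachP; left.
have mw : m w \in mu (last v (rcons q w)) by rewrite last_rcons; case: (mP w).
have [p [pp pl sp pmu]] := minor_walk pq (mP v).1 mw.
apply: (reach_first rkI pp pl) => [|z /pmu[u uq zu]].
  apply: leq_trans sp _; rewrite size_rcons leq_add2r leq_mul2l sq orbT //.
have le : rkm w <= rkm u.
  move: uq; rewrite inE mem_rcons inE => /or3P[/eqP->//|/eqP->//|/qZ].
  by rewrite inE => /ltnW.
by apply: leq_trans le _; apply: (mP u).2.
Qed.

(* The first vertex below m v on the lifted walk lies in the branch set of w. *)
Lemma sreach_minor s v : #|sreach h rkm s v| <= #|sreach e rk ((2 * r + 1) * s + 2 * r) (m v)|.
Proof.
set S := sreach e _ _ _.
have key w : w \in sreach h rkm s v -> exists2 y, y \in mu w & y \in S.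
  rewrite inE => /andP[wv /reachP hw].
  case: hw => [<-|[q [pq qZ sq]]].
    by exists (m v); [case: (mP v)|rewrite inE leqnn; apply/reachP; left].
  case: (eqVneq v w) => [<-|vw].
    by exists (m v); [case: (mP v)|rewrite inE leqnn; apply/reachP; left].
  have lt : rkm w < rkm v.
    by rewrite ltn_neqAle wv andbT; apply: contra vw => /eqP/branch_rank_inj->.
  have mw : m w \in mu (last v (rcons q w)) by rewrite last_rcons; case: (mP w).
  have [p [pp pl sp pmu]] := minor_walk pq (mP v).1 mw.
  have hs : has (fun z => rk z < rkm v) p.
    apply/hasP; exists (m w) => //.
    have := mem_last (m v) p; rewrite pl inE => /predU1P[/branch_min_inj wv'|//].
    by rewrite wv' eqxx in vw.
  set y := nth (m v) p (find (fun z => rk z < rkm v) p).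
  have yp : y \in p by rewrite mem_nth // -has_find.
  have ylt : rk y < rkm v by apply: (nth_find (m v) hs).
  have yw : y \in mu w.
    have [u uq yu] := pmu y yp; have uy := (mP u).2 y yu.
    move: uq; rewrite inE mem_rcons inE => /or3P[/eqP uv|/eqP <- //|/qZ].
      by move: uy ylt; rewrite uv leqNgt => /negbTE->.
    by rewrite inE => vu; have := ltn_trans (leq_ltn_trans uy ylt) vu; rewrite ltnn.
  exists y => //; rewrite inE (ltnW ylt) /=.
  pose i := find (fun z => rk z < rkm v) p; have ip : i < size p by rewrite -has_find.
  apply: (reach_last rkI (q := take i p)).
  - by move: pp; rewrite -{1}(cat_take_drop i p) (drop_nth (m v)) // -cat_rcons cat_path => /andP[].
  - rewrite size_takel ?(ltnW ip) //; apply: leq_trans ip (leq_trans sp _).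
    by rewrite size_rcons leq_add2r leq_mul2l sq orbT.
  move=> z zt; have /(nthP (m v))[j] := zt; rewrite size_takel ?(ltnW ip) // => ji <-.
  by rewrite nth_take // leqNgt; have /negbT := before_find (m v) ji.
pose f w := odflt (m w) [pick y | (y \in mu w) && (y \in S)].
have fP w : w \in sreach h rkm s v -> f w \in mu w /\ f w \in S.
  move=> /key[y yw yS]; rewrite /f; case: pickP => [z /andP[]//|/(_ y)].
  by rewrite yw yS.
rewrite -(@card_in_imset _ _ f) => [|w w' /fP[fw _] /fP[fw' _] eqf].
  by apply/subset_leq_card/subsetP => _ /imsetP[w /fP[_ ?] ->].
by apply: (branch_inj fw); rewrite eqf.
Qed.
End Minor.

Theorem theorem19 (g r l : nat) (V : finType) (e : rel V)
    (W : finType) (h : rel W) :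
  symmetric e -> irreflexive e -> symmetric h -> irreflexive h ->
  1 <= l ->
  euler_genus_is e g ->
  shallow_minor r h (strong_prod e l) ->
  forall s : nat, 1 <= s ->
    scol h s <= l * ((4 * g + 5) * (2 * r * s + 2 * r + s) + 2 * g + 1)
    /\
    wcol h s <= l * (2 * g + 'C((2 * r + 1) * s + 2 * r + 2, 2))
                  * ((4 * r + 2) * s + 4 * r + 1).
Proof.
move=> eS eI hS hI l1 [eg _] [mu [mu_disj mu_rad mu_edge]] s s1.
have pS := strong_prod_sym (l := l) eS.
(* This radius replaces [s] in the bounds for the graph; twice it plus one is the last factor of the
   weak bound. *)
have k0 : 0 < (2 * r + 1) * s + 2 * r by lia.
split.
  have [rk rkI rkP] := scol_graph eS eI eg k0.
  have [m mP] := branch_min mu_rad (lex_rank (l := l) rk).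
  have lI := lex_rank_inj (l := l) rkI.
  apply: (scol_le (branch_rank_inj mu_disj lI mP)) => v.
  apply: leq_trans (sreach_minor pS mu_disj mu_rad mu_edge lI mP s v) _.
  apply: leq_trans (sreach_strong_prod rkI rkP (m v)) _.
  by rewrite leq_mul2l; apply/orP; right; lia.
have [rk rkI rkP] := wcol_graph eS eI eg.
have [m mP] := branch_min mu_rad (lex_rank (l := l) rk).
have lI := lex_rank_inj (l := l) rkI.
apply: (wcol_le (branch_rank_inj mu_disj lI mP)) => v.
apply: leq_trans (wreach_minor pS mu_disj mu_rad mu_edge lI mP s v) _.
apply: leq_trans (wreach_strong_prod rkI (rkP _) (m v)) _.
rewrite -mulnA leq_mul2l leq_mul2l; apply/orP; right; apply/orP; right; lia.
Qed.
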